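(* Let $n\ge1$ and let $\mathbf e$ be a reverse Hessenberg function of length $n$. Then $$\chi_{\mathbf e}[X;q]=q^{\binom n2-n-|\mathbf e|}\sum_{\lambda\vdash n}\Bigg(q^{\ell(\lambda)}[\lambda_1]_q\cdots[\lambda_{\ell(\lambda)}]_q\sum_{T\in\overline{\mathrm{SYT}}{}^{\mathbf e}_\lambda}\ \prod_{\substack{i\prec j\\ c_j(T)\ne c_i(T)+1}}\frac{q^{c_j(T)}-q^{c_i(T)}}{q^{c_j(T)}-q^{c_i(T)+1}}\Bigg)e_\lambda[X].$$ Moreover, setting $q=1$ in this identity yields a positive expansion (all coefficients nonnegative) into the elementary basis, explicitly $$\chi_{\mathbf e}[X;1]=\sum_{\lambda\vdash n}\Bigg(\lambda_1\cdots\lambda_{\ell(\lambda)}\sum_{T\in\overline{\mathrm{SYT}}{}^{\mathbf e}_\lambda}\ \prod_{\substack{i\prec j\\ c_j(T)\ne c_i(T)+1}}\frac{|c_j(T)-c_i(T)|}{|c_j(T)-c_i(T)-1|}\Bigg)e_\lambda[X].$$ This proves the Stanley--Stembridge conjecture: the chromatic symmetric function (at $q=1$) of the incomparability graph of any finite $(3+1)$-free poset is a nonnegative linear combination of the $e_\lambda$.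
   Context: A reverse Hessenberg function of length $n$ is a weakly increasing $\mathbf e:[n]\to\{0,\dots,n-1\}$ with $\mathbf e(i)<i$ for all $i$; $|\mathbf e|=\sum_i\mathbf e(i)$. Write $i\prec j$ if $\mathbf e(j)<i<j$, and $i\preceq j$ if $i\prec j$ or $i=j$. The unit interval graph $\Gamma_{\mathbf e}$ has vertex set $[n]$ and edges $\{i,j\}$ for $i\prec j$. For a graph $G$ on an ordered vertex set, $\chi_G[X;q]=\sum_\kappa q^{\mathrm{asc}(\kappa)}\prod_v x_{\kappa(v)}$, sum over proper colorings $\kappa:V\to\mathbb Z_{>0}$, where $\mathrm{asc}(\kappa)$ is the number of edges $ij$ with $i<j$ and $\kappa(i)<\kappa(j)$; $\chi_{\mathbf e}=\chi_{\Gamma_{\mathbf e}}$. At $q=1$ this is Stanley's chromatic symmetric function. A poset is $(3+1)$-free if it has no induced subposet that is the disjoint union of a 3-element chain and a 1-element chain. $[m]_q=(1-q^m)/(1-q)$; $e_\lambda=\prod_ie_{\lambda_i}$ are the elementary symmetric functions. $\mathrm{SYT}^{\mathbf e}_\lambda$ is the set of standard Young tableaux $T$ of shape $\lambda$ (French convention) such that for each $i$ the cells with entries $j\preceq i$ form a horizontal strip (no two cells in the same column). $\overline{\mathrm{SYT}}{}^{\mathbf e}_\lambda$ is the set of $T\in\mathrm{SYT}^{\mathbf e}_\lambda$ such that for every entry $i$ not in the first column there is an entry $j$ in the column immediately to the left of the column of $i$ with $j\prec i$. $c_i(T)$ is the column of the entry $i$ in $T$, with columns numbered from $0$. The products are over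 pairs $(i,j)$ in $[n]$ satisfying the listed conditions. *)

(* Defs.v *)
From HB Require Import structures.
From mathcomp Require Import all_boot all_order all_algebra.
From mathcomp.classical Require Import boolp classical_sets functions.
From mathcomp.classical Require Import cardinality fsbigop.
From mathcomp Require Import finmap.
From mathcomp.multinomials Require Import monalg.

Set Implicit Arguments.
Unset Strict Implicit.
Unset Printing Implicit Defensive.

Import Order.TTheory GRing.Theory Num.Theory.
Local Open Scope ring_scope.
Local Open Scope classical_set_scope.

(* A formal power series over [R] in the countably many variables
   x_0, x_1, x_2, ... is the family of its coefficients, indexed by the
   monomials [{cmonom nat}]. The variables (and the colors of graph colorings)
   are numbered from 0 instead of from 1.
   Caution: a sum [\sum_(i \in A) F i] over a classical set is 0 when [F] has
   infinite support in [A]. All the sets summed over in this file are finite: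
   see [factorizations_finite], [colorings_finite], [partitions_finite]. *)
Definition fseries (R : Type) : Type := {cmonom nat} -> R.

Definition factorizations (m : {cmonom nat}) :
    set ({cmonom nat} * {cmonom nat}) :=
  [set p | mmul p.1 p.2 = m].

Definition series_one (R : comNzRingType) : fseries R :=
  fun m => (m == mone)%:R.

Definition series_mul (R : comNzRingType) (f g : fseries R) : fseries R :=
  fun m => \sum_(p \in factorizations m) f p.1 * g p.2.

(* e_k: the sum of all squarefree monomials of degree k *)
Definition elementary (R : comNzRingType) (k : nat) : fseries R :=
  fun m => ((mdeg m == k) && all (fun i => m i <= 1)%N (finsupp m))%:R.

Definition elementary_part (R : comNzRingType) (lam : seq nat) : fseries R :=
  \big[@series_mul R/@series_one R]_(k <- lam) elementary R k.

Definition is_partition (n : nat) (lam : seq nat) : bool :=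
  [&& sorted geq lam, 0%N \notin lam & sumn lam == n].

Definition partitions (n : nat) : set (seq nat) :=
  [set lam | is_partition n lam].

Section Chromatic.
Variables (V : finType) (E : rel V).

Definition proper_coloring (k : {ffun V -> nat}) : bool :=
  [forall u, forall v, E u v ==> (k u != k v)].

Definition coloring_monomial (k : {ffun V -> nat}) : {cmonom nat} :=
  \big[mmul/mone]_(v : V) ucm (k v).

Definition colorings (m : {cmonom nat}) : set {ffun V -> nat} :=
  [set k | proper_coloring k /\ coloring_monomial k = m].

(* [lt] is the strict order on the vertices *)
Definition asc (lt : rel V) (k : {ffun V -> nat}) : nat :=
  #|[set p : V * V | [&& lt p.1 p.2, E p.1 p.2 & (k p.1 < k p.2)%N]]%SET|.

Definition chromatic (R : comNzRingType) (lt : rel V) (q : R) : fseries R :=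
  fun m => \sum_(k \in colorings m) q ^+ asc lt k.

Definition stanley_chromatic (R : comNzRingType) : fseries R :=
  fun m => \sum_(k \in colorings m) (1 : R).

Lemma chromatic1 (R : comNzRingType) (lt : rel V) :
  chromatic lt 1 = stanley_chromatic R.
Proof.
by apply/funext => m; apply: eq_fsbigr => k _; rewrite expr1n.
Qed.

End Chromatic.

(* Vertices and tableau entries are numbered by ['I_n], so that [i : 'I_n]
   stands for the element i + 1 of {1, ..., n}. *)
Definition reverse_hessenberg (n : nat) (e : 'I_n -> 'I_n) : Prop :=
  (forall i j : 'I_n, (i <= j)%N -> (e i <= e j)%N) /\
  (forall i : 'I_n, (e i < i.+1)%N).

Definition hess_weight (n : nat) (e : 'I_n -> 'I_n) : nat := (\sum_(i < n) e i)%N.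

Definition prec (n : nat) (e : 'I_n -> 'I_n) : rel 'I_n :=
  fun i j => (e j < i.+1 < j.+1)%N.

Definition preceq (n : nat) (e : 'I_n -> 'I_n) : rel 'I_n :=
  fun i j => prec e i j || (i == j).

Definition unit_interval_graph (n : nat) (e : 'I_n -> 'I_n) : rel 'I_n :=
  fun i j => prec e i j || prec e j i.

Definition chi (R : comNzRingType) (n : nat) (e : 'I_n -> 'I_n) (q : R) :
    fseries R :=
  chromatic (unit_interval_graph e) (fun i j : 'I_n => (i < j)%N) q.

(* A tableau with [n] cells maps each entry to its cell (row, column), both
   numbered from 0; the cells of a partition of [n] fit in an n x n square. *)
Section Tableaux.
Variables (n : nat) (T : {ffun 'I_n -> 'I_n * 'I_n}).

Definition trow (i : 'I_n) : nat := (T i).1.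
Definition tcol (i : 'I_n) : nat := (T i).2.

Definition is_filling (lam : seq nat) : bool :=
  injectiveb T &&
  [forall x : 'I_n * 'I_n, (x \in codom T) == (x.2 < nth 0 lam x.1)%N].

Definition is_SYT (lam : seq nat) : bool :=
  [&& is_filling lam,
      [forall i, forall j,
        (trow i == trow j) && (tcol i < tcol j)%N ==> (i < j)%N] &
      [forall i, forall j,
        (tcol i == tcol j) && (trow i < trow j)%N ==> (i < j)%N]].

Variable e : 'I_n -> 'I_n.

Definition is_SYTe (lam : seq nat) : bool :=
  is_SYT lam &&
  [forall i, forall j, forall k,
    [&& preceq e j i, preceq e k i & j != k] ==> (tcol j != tcol k)].

Definition is_SYTe_bar (lam : seq nat) : bool :=
  is_SYTe lam &&
  [forall i, (0 < tcol i)%N ==>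
    [exists j, (tcol i == (tcol j).+1) && prec e j i]].

End Tableaux.

Definition qint (F : fieldType) (q : F) (m : nat) : F :=
  (1 - q ^+ m) / (1 - q).

Definition e_coef (F : fieldType) (q : F) (n : nat) (e : 'I_n -> 'I_n)
    (lam : seq nat) : F :=
  q ^+ size lam * (\prod_(k <- lam) qint q k) *
  \sum_(T : {ffun 'I_n -> 'I_n * 'I_n} | is_SYTe_bar T e lam)
    \prod_(p : 'I_n * 'I_n | prec e p.1 p.2 && (tcol T p.2 != (tcol T p.1).+1))
      ((q ^+ tcol T p.2 - q ^+ tcol T p.1) /
       (q ^+ tcol T p.2 - q ^+ (tcol T p.1).+1)).

Definition q_exponent (n : nat) (e : 'I_n -> 'I_n) : int :=
  'C(n, 2)%:Z - n%:Z - (hess_weight e)%:Z.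

Definition e_coef_at1 (n : nat) (e : 'I_n -> 'I_n) (lam : seq nat) : rat :=
  (\prod_(k <- lam) k%:R) *
  \sum_(T : {ffun 'I_n -> 'I_n * 'I_n} | is_SYTe_bar T e lam)
    \prod_(p : 'I_n * 'I_n | prec e p.1 p.2 && (tcol T p.2 != (tcol T p.1).+1))
      (`|(tcol T p.2)%:R - (tcol T p.1)%:R| /
       `|(tcol T p.2)%:R - (tcol T p.1)%:R - 1|).

Notation ratfun := {fraction {poly rat}}.

Definition qvar : ratfun := tofrac ('X : {poly rat}).

(* the rational function [f] has no pole at [a], and its value there is [v] *)
Definition has_value_at (f : ratfun) (a v : rat) : Prop :=
  exists p s : {poly rat},
    [/\ s.[a] != 0, f = tofrac p / tofrac s & v = p.[a] / s.[a]].

Definition three_plus_one_free (d : Order.disp_t) (P : finPOrderType d) : Prop :=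
  ~ exists a b c x : P,
      [/\ (a < b)%O, (b < c)%O & [/\ (x >< a)%O, (x >< b)%O & (x >< c)%O]].

Definition incomparability_graph (d : Order.disp_t) (P : finPOrderType d) :
    rel P :=
  fun x y => (x >< y)%O.

Lemma factorizations_finite (m : {cmonom nat}) :
  finite_set (factorizations m).
Proof.
pose K := (\max_(i <- finsupp m) m i).+1.
pose mk (f : {ffun finsupp m -> 'I_K}) : {cmonom nat} :=
  mkcmonom [fsfun i : finsupp m => (f i : nat) | 0%N].
pose D := mk @` setT.
have finD : finite_set D by apply/finite_image/finite_finset.
have inD (a b : {cmonom nat}) : mmul a b = m -> D a.
  move=> ab.
  have le i : (a i <= m i)%N by rewrite -ab cmM leq_addr.
  have lt (i : finsupp m) : (a (val i) < K)%N.
    rewrite ltnS (leq_trans (le _)) //.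
    by rewrite (big_rem (val i)) /= ?leq_maxl //; exact: valP.
  exists [ffun i => Ordinal (lt i)] => //.
  apply/eqP/cmP => i; rewrite /mk cmE /= fsfun_ffun.
  case: insubP => [u _ <-|]; first by rewrite /= ffunE.
  move=> im; apply/esym/eqP; rewrite -leqn0.
  by rewrite (leq_trans (le i)) // leqn0 cmE_eq0.
apply: (@sub_finite_set _ _ (D `*` D)); last exact: finite_setX.
by move=> [a b] /= ab; split; [exact: inD ab | apply: (inD b a); rewrite mulmC].
Qed.

Lemma colorings_finite (V : finType) (E : rel V) (m : {cmonom nat}) :
  finite_set (colorings E m).
Proof.
pose mk (f : {ffun V -> finsupp m}) : {ffun V -> nat} := [ffun v => val (f v)].
apply: (@sub_finite_set _ _ (mk @` setT)); last exact/finite_image/finite_finset.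
move=> k [_ km].
have sup v : k v \in finsupp m.
  rewrite -cmE_neq0 -km /coloring_monomial (bigD1 v) //= cmM cmU eqxx.
  by [].
exists [ffun v => [` sup v]%fset] => //.
by apply/ffunP => v; rewrite !ffunE.
Qed.

Lemma partitions_finite (n : nat) : finite_set (partitions n).
Proof.
pose mk (t : {s : 'I_n.+1 & s.-tuple 'I_n.+1}) : seq nat :=
  [seq nat_of_ord i | i <- tagged t].
apply: (@sub_finite_set _ _ (mk @` setT)); last exact/finite_image/finite_finset.
move=> lam /and3P[_ lam0 /eqP sumlam].
have le k : k \in lam -> (k < n.+1)%N.
  rewrite ltnS -sumlam; elim: (lam) => //= x s IH.
  rewrite inE => /orP[/eqP->|/IH /leq_trans -> //]; first exact: leq_addr.
  exact: leq_addl.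
have sz : (size lam < n.+1)%N.
  rewrite ltnS -sumlam; elim: (lam) lam0 => //= x s IH.
  rewrite inE negb_or => /andP[x0 /IH le_s].
  by rewrite -add1n leq_add // lt0n eq_sym.
pose t : (Ordinal sz).-tuple 'I_n.+1 := map_tuple inord (in_tuple lam).
exists (Tagged (fun s : 'I_n.+1 => s.-tuple 'I_n.+1) t) => //.
rewrite /mk /= -map_comp -[RHS]map_id; apply/eq_in_map => k /le kn /=.
by rewrite inordK.
Qed.

(* Main.v *)
(* Consider sums over words c_1 ... c_n of nonnegative integers, weighted by a
   product over j of local factors F({c_i : i -< j}, c_j). The chromatic
   quasisymmetric function is such a sum over colorings, and so is the right-hand
   side: a tableau is determined by the word of the columns of its entries, and
   the words that do not come from a tableau have weight 0. For both choices of
   F, symmetrizing over two consecutive letters shows that the sums satisfy the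
   modular laws, linear relations between the values at Hessenberg functions that
   differ at one or two places. These laws determine a function of e from its
   values on disjoint unions of cliques; a clique of size b contributes
   [b]_q! e_b to both sides.

   In a (3+1)-free order with an induced 2+2 formed by a < x and b < y, let C be
   the class of x for the equivalence relation generated by the pairs (x, y) of
   this kind, and L the set of elements below some but not all of C. The rest of
   the order distinguishes neither the elements of C from each other nor those of
   L. Up to duality there is an injection tau from L to C. For a permutation s of
   C, put l in L below all of C if l < s(tau l), and beside all of C otherwise.
   This gives a (3+1)-free order with fewer 2+2. A color class meets L and C in
   at most one element each, so for a fixed coloring the conditions between L and
   C are those of a partial matching, which a uniform s makes equidistributed
   with the pairs (l, s(tau l)). Hence the mean over s of the chromatic symmetric
   functions of the new orders is that of the old one. The orders without 3+1 and
   2+2 are the unit interval orders. *)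
Require Import Defs.
From mathcomp Require Import all_boot all_order all_algebra.
From mathcomp.classical Require Import boolp classical_sets functions.
From mathcomp.classical Require Import cardinality fsbigop.
From mathcomp Require Import perm finmap.
From mathcomp.multinomials Require Import monalg.
From mathcomp Require Import zify ring.

Set Implicit Arguments.
Unset Strict Implicit.
Unset Printing Implicit Defensive.

Import Order.TTheory GRing.Theory Num.Theory.
Local Open Scope ring_scope.

(** * The modular laws *)

(** A modular law relates three functions, none of them simpler than the others. Along a run of
    equal values, however, law A is a linear recurrence with characteristic roots $1$ and $q^{-1}$,
    so the values at the two ends of an interval determine a solution: the determinant is a sum of
    powers of $q^{-1}$, and this is where $q$ must not be a root of unity. Law B extends the
    argument to runs of several positions.

    The weight of a word of columns carries one factor $q$ for each pair $i\prec j$ with $c_j\ne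
    c_i+1$. For words of tableaux the number of these pairs depends only on $\mathbf e$ and the
    number of rows, which yields the power of $q$ in front. The factors $[\lambda_i]_q
    e_{\lambda_i}$ stay out of the local weights, in a product that depends only on how often each
    column occurs; like the monomial of a coloring, it is invariant under permutations of the
    positions.

    At $q=1$ the denominators of the tableau sum vanish before cancellation. The identity is
    therefore proved over the rational functions in $q$, and its coefficients are evaluated at 1
    afterwards. *)

Section Strip.
Variables (R : fieldType) (V : lmodType R) (q : R).
Hypothesis q_neq0 : q != 0.
Hypothesis q_pow_neq1 : forall k, q ^+ k.+1 != 1.

Lemma geom_neq0 k : \sum_(i < k.+1) q ^- i != 0.
Proof.
have qV1 : q^-1 != 1 by rewrite invr_eq1; exact: (q_pow_neq1 0).
apply/eqP => s0; have := subrX1 q^-1 k.+1.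
under [X in _ * X]eq_bigr do rewrite exprVn.
rewrite s0 mulr0 => /eqP; rewrite subr_eq0 exprVn invr_eq1.
exact/negP/q_pow_neq1.
Qed.

(* A sequence [r] with [path leq L (rcons r M)] is a weakly increasing
   sequence with values in [L, M]. *)
Lemma strip_vanish s (psi : seq nat -> V) L M :
    (forall r1 a r2, size (r1 ++ a :: r2) = s ->
       path leq L (r1 ++ a :: a.+2 :: rcons r2 M) ->
       (1 + q) *: psi (r1 ++ a.+1 :: r2) =
       q *: psi (r1 ++ a.+2 :: r2) + psi (r1 ++ a :: r2)) ->
    (forall r1 a r2, size (r1 ++ a :: a :: r2) = s ->
       path leq L (r1 ++ a :: a.+1 :: rcons r2 M) ->
       (1 + q) *: psi (r1 ++ a :: a.+1 :: r2) =
       q *: psi (r1 ++ a.+1 :: a.+1 :: r2) + psi (r1 ++ a :: a :: r2)) ->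
    (forall r, size r = s -> path leq L (rcons r M) ->
       all (pred2 L M) r -> psi r = 0) ->
  forall r, size r = s -> path leq L (rcons r M) -> psi r = 0.
Proof.
elim: s psi L => [|s IH] psi L lawA lawB bd.
  by move=> [] // _ LM; apply: bd.
have psiL r : size r = s -> path leq L (rcons r M) -> psi (L :: r) = 0.
  apply: (IH (fun r => psi (L :: r))) => [r1 a r2 sz so|r1 a r2 sz so|r' sz so al].
  - by apply: (lawA (L :: r1)); rewrite /= ?sz //= leqnn.
  - by apply: (lawB (L :: r1)); rewrite /= ?sz //= leqnn.
  - by apply: bd; rewrite /= ?sz ?leqnn ?eqxx.
have psiM r : size r = s -> path leq L (rcons r M) -> psi (rcons r M) = 0.
  have pathM x : path leq L (rcons x M) -> path leq L (rcons (rcons x M) M).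
    by move=> so; rewrite rcons_path so last_rcons leqnn.
  apply: (IH (fun r => psi (rcons r M))) => [r1 a r2 sz so|r1 a r2 sz so|r' sz so al].
  - rewrite !rcons_cat !rcons_cons; apply: lawA.
      by rewrite -rcons_cons -rcons_cat size_rcons sz.
    by have := pathM (r1 ++ a :: a.+2 :: r2); rewrite !rcons_cat /=; apply.
  - rewrite !rcons_cat !rcons_cons; apply: lawB.
      by rewrite -!rcons_cons -rcons_cat size_rcons sz.
    by have := pathM (r1 ++ a :: a.+1 :: r2); rewrite !rcons_cat /=; apply.
  - by apply: bd; rewrite ?size_rcons ?sz ?pathM // all_rcons /= eqxx orbT.
have bounds x r : path leq x (rcons r M) -> all (fun y => x <= y <= M)%N (rcons r M).
  elim: r x => [|y r IHr] x /=; first by rewrite !andbT leqnn andbT.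
  move=> /andP[xy /[dup] /IHr al _]; rewrite xy /=.
  apply/andP; split; first by have := al; rewrite all_rcons => /andP[/andP[]].
  by apply: sub_all al => z /andP[yz ->]; rewrite (leq_trans xy yz).
(* Law A in the first entry gives the value at [x] from those at [x - 1] and [x - 2], so only the
   first entries [L] and [L.+1] matter, and [psiL] settles [L]. *)
suff psiS : (L < M)%N -> forall r, size r = s -> path leq L.+1 (rcons r M) ->
    psi (L.+1 :: r) = 0.
  case=> // x r [sz] /= /andP[Lx so].
  have xM : (x <= M)%N by have := bounds _ _ so; rewrite all_rcons => /andP[/andP[]].
  have [m] := ubnP (x - L)%N; elim: m x Lx xM so => // m IHm x Lx xM so lem.
  move: Lx; rewrite leq_eqVlt => /orP[/eqP Lx|]; first by subst x; exact: psiL.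
  rewrite leq_eqVlt => /orP[/eqP Lx|Lx]; first by subst x; exact: psiS.
  case: x => [|[|a]] // in Lx xM so lem *.
  have pw b : (b <= a.+2)%N -> path leq b (rcons r M).
    by move=> ba; case: (rcons r M) so => //= y r' /andP[ay ->]; rewrite (leq_trans ba ay).
  have La : (L <= a)%N by lia.
  have := lawA [::] a r; rewrite /= sz La so andbT => /(_ erefl) E.
  have {}E := E (ltnW (leqnSn _)).
  rewrite (IHm a.+1) ?(IHm a) in E; try (by rewrite ?pw //; lia).
  by move/esym/eqP: E; rewrite scaler0 addr0 scaler_eq0 (negPf q_neq0) => /eqP.
move=> LM.
case: s => [|s] in IH lawA lawB bd psiL psiM *.
  case=> // _ _.
  (* With a single entry, law A makes the successive differences geometric of ratio $q^{-1}$. They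
     add up to [psi [:: M] - psi [:: L] = 0], while the sum of the ratios is nonzero by
     [geom_neq0]. *)
  pose d j := psi [:: (L + j.+1)%N] - psi [:: (L + j)%N].
  have dE j : (L + j.+1 <= M)%N -> d j = q ^- j *: psi [:: L.+1].
    elim: j => [|j IHj] jM.
      by rewrite /d addn1 addn0 expr0 invr1 scale1r psiL ?subr0 //= andbT ltnW.
    have := lawA [::] (L + j)%N [::] erefl; rewrite /= leq_addr leqW //= => E.
    apply: (scalerI q_neq0); rewrite scalerA exprS invfM mulrA divff // mul1r.
    rewrite -IHj ?(ltnW (leq_trans _ jM)) ?ltn_add2l // /d scalerBr !addnS.
    have -> : q *: psi [:: (L + j).+2] =
              (1 + q) *: psi [:: (L + j).+1] - psi [:: (L + j)%N].
      by rewrite E ?addrK //; move: jM; rewrite !addnS andbT. 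
    by rewrite scalerDl scale1r addrAC addrK.
  suff p0 : psi [:: L.+1] = 0 by [].
  have [k Mk] : exists k, M = (L + k.+1)%N by exists (M - L).-1; lia.
  have tele : psi [:: M] - psi [:: L] = (\sum_(j < k.+1) q ^- j) *: psi [:: L.+1].
    rewrite scaler_suml Mk -{2}(addn0 L).
    rewrite -(telescope_sumr (fun j => psi [:: (L + j)%N])) // big_mkord.
    by apply: eq_bigr => j _; rewrite -dE //= Mk leq_add2l.
  move/eqP: tele; rewrite (psiM [::]) ?(psiL [::]) //= ?(ltnW LM) //.
  by rewrite subr0 eq_sym scaler_eq0 (negPf (geom_neq0 k)) => /eqP.
move=> r sz so.
(* The shorter strip has bounds [L.+1] and [M]. On its boundary, a second entry [L.+1] allows law B,
   whose other two sequences begin with [L]; a second entry [M] forces every later entry to be [M],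
   and [psiM] applies. *)
apply: (IH (fun r => psi (L.+1 :: r)) L.+1) so => //.
- move=> r1 a r2 sz' so; apply: (lawA (L.+1 :: r1)); rewrite /= ?sz' //.
  by rewrite leqnSn so.
- move=> r1 a r2 sz' so; apply: (lawB (L.+1 :: r1)); rewrite /= ?sz' //.
  by rewrite leqnSn so.
- case=> // x r' [sz'] so /= /andP[/orP[/eqP xL|/eqP xM] al].
    subst x; have so' : path leq L (L :: L.+1 :: rcons r' M).
      by move: so; rewrite /= !leqnn ?leqnSn => /andP[_ ->].
    have := lawB [::] L r'; rewrite /= sz' => /(_ erefl).
    move: (so'); rewrite /= => -> /(_ isT).
    rewrite psiL ?psiL /= ?sz' //; first last.
    + by move: so'; rewrite /= !leqnn ?leqnSn => /andP[_ ->].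
    + move: so'; rewrite /= !leqnn ?leqnSn /=; case: (r') => [|y r2] /=; first lia.
      by move=> /andP[/ltnW -> ->].
    rewrite scaler0 addr0 => /esym/eqP; rewrite scaler_eq0 (negPf q_neq0).
    by move=> /eqP.
  have rM : r' = nseq (size r') M.
    apply/all_pred1P/allP => y yr; move: so; rewrite /= => /andP[_ /bounds].
    rewrite all_rcons => /andP[_ /allP/(_ _ yr)]; rewrite xM => /andP[h1 h2].
    by rewrite /= eqn_leq h1 h2.
  have cr : x :: r' = rcons r' M.
    by rewrite xM rM; elim: (size r') => //= k ->.
  rewrite cr -rcons_cons; apply: psiM; first by rewrite /= sz'.
  move: so; rewrite cr rcons_path => /andP[+ _] => so.
  by rewrite /= leqnSn so.
Qed.
End Strip.

(** Reverse Hessenberg functions as functions on all of [nat], positions counted from 0. Only the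
    values below [n] are constrained, so a value can be changed, or [n] lowered, without changing
    types. *)
Definition hess n (e : nat -> nat) :=
  (forall j, (j < n)%N -> (e j <= j)%N) /\
  (forall i j, (i <= j)%N -> (j < n)%N -> (e i <= e j)%N).

Definition upd (e : nat -> nat) i x : nat -> nat :=
  fun k => if k == i then x else e k.

(** The vertices [a] and [a.+1] are adjacent and have the same other neighbours, except that [i] is
    joined to both, to [a.+1] only, or to neither, according to its value [a], [a.+1] or [a.+2]. *)
Definition modular_law_A (R : pzRingType) (V : lmodType R) (q : R) n
    (Z : (nat -> nat) -> V) :=
  forall e i a, hess n e -> (i < n)%N -> (a.+1 < i)%N -> e a = e a.+1 ->
    (forall j, (j < i)%N -> (e j <= a)%N) ->
    (forall j, (i < j < n)%N -> (a.+2 <= e j)%N) ->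
    (1 + q) *: Z (upd e i a.+1) = q *: Z (upd e i a.+2) + Z (upd e i a).

(** The vertex [a] is joined to [u] only, to neither of [u] and [u.+1], or to both. No later value
    equals [u.+1], so no later vertex separates [u] from [u.+1]. *)
Definition modular_law_B (R : pzRingType) (V : lmodType R) (q : R) n
    (Z : (nat -> nat) -> V) :=
  forall e u a, hess n e -> (u.+1 < n)%N -> (a < u)%N ->
    (forall j, (j < u)%N -> (e j <= a)%N) ->
    (forall j, (u.+1 < j < n)%N -> (a < e j)%N && (e j != u.+1)) ->
    (1 + q) *: Z (upd (upd e u a) u.+1 a.+1) =
    q *: Z (upd (upd e u a.+1) u.+1 a.+1) + Z (upd (upd e u a) u.+1 a).

(** * Solutions of the modular laws are determined by unions of cliques *)

Section Uniqueness.
Variables (R : fieldType) (V : lmodType R) (q : R) (n : nat).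
Hypothesis q_neq0 : q != 0.
Hypothesis q_pow_neq1 : forall k, q ^+ k.+1 != 1.
Variable Z : (nat -> nat) -> V.
Hypothesis Z_ext : forall e e', (forall j, (j < n)%N -> e j = e' j) -> Z e = Z e'.
Hypothesis Z_A : modular_law_A q n Z.
Hypothesis Z_B : modular_law_B q n Z.

(* [e] has no bad value exactly when its graph is a disjoint union of cliques. *)
Definition bad (e : nat -> nat) b :=
  [&& (0 < b)%N, e b.-1 == e b & has (fun j => e j == b) (iota 0 n)].

(** A value weighs more than all larger ones together ([sum_pow2]), so the largest bad value may be
    traded for any set of bad values above it. *)
Definition badness e := (\sum_(b < n) bad e b * 2 ^ (n - b))%N.

Definition fst_ge (e : nat -> nat) a := find (fun j => a <= e j)%N (iota 0 n).

Lemma fst_ge_le e a : (fst_ge e a <= n)%N.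
Proof. by have := find_size (fun j => a <= e j)%N (iota 0 n); rewrite size_iota. Qed.

Lemma fst_geP e a j : hess n e -> (j < n)%N -> (a <= e j)%N = (fst_ge e a <= j)%N.
Proof.
move=> [_ mono] jn; rewrite leqNgt; case: (ltnP j (fst_ge e a)) => [jp|pj].
  have := before_find 0%N jp; rewrite nth_iota // add0n; move: (e j) => x.
  by move/negbT; rewrite -ltnNge => ->.
have pn : (fst_ge e a < n)%N by exact: leq_ltn_trans jn.
have := @nth_find _ 0%N (fun j => a <= e j)%N (iota 0 n).
rewrite has_find size_iota => /(_ pn); rewrite nth_iota // add0n => ap.
by rewrite -leqNgt (leq_trans ap) // mono.
Qed.

Lemma sum_pow2 a : (a < n)%N -> (\sum_(b < n | a < b) 2 ^ (n - b) < 2 ^ (n - a))%N.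
Proof.
move=> an; rewrite -(big_mkord (fun b => a < b)%N (fun b => 2 ^ (n - b)))%N.
rewrite (big_cat_nat (n := a.+1)) //= big_nat_cond big1 ?add0n; last first.
  by move=> i /andP[/andP[_ ia] ai]; rewrite ltnS leqNgt ai in ia.
rewrite big_nat_cond (eq_bigl (fun i => (a.+1 <= i < n)%N)) -?big_nat; last first.
  by move=> i /=; case: (ltnP a i); rewrite ?andbT ?andbF.
have [k ->] : exists k, n = (a.+1 + k)%N by exists (n - a.+1)%N; lia.
elim: k a {an} => [|k IH] a; first by rewrite addn0 big_geq // expn_gt0.
rewrite big_ltn ?addnS ?ltnS ?leq_addr // -addSn.
have := IH a.+1; have -> : (a.+2 + k - a.+1 = k.+1)%N by lia.
have -> : (a.+2 + k - a = k.+2)%N by lia.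
by rewrite (expnS 2 k.+1) mul2n -addnn ltn_add2l.
Qed.

Definition set_run e w (r : seq nat) : nat -> nat :=
  fun k => if (w <= k < w + size r)%N then nth 0%N r (k - w) else e k.

(* [e] takes its largest bad value on a run of consecutive positions. Varying
   the values on that run gives a family with the relations of [strip_vanish],
   and the extreme members of this family have a smaller badness. *)
Theorem hess_vanish :
    (forall e, hess n e -> (forall b, (b < n)%N -> ~~ bad e b) -> Z e = 0) ->
  forall e, hess n e -> Z e = 0.
Proof.
move=> Z_good e; have [m] := ubnP (badness e); elim: m e => // m IH e lem he.
have [/hasP[b0 b0n bad0]|/hasPn no_bad] := boolP (has (bad e) (iota 0 n)); last first.
  by apply: Z_good => // b bn; apply: no_bad; rewrite mem_iota.
have [a an [bada amax]] : exists2 a, (a < n)%N & bad e a /\ forall b, (b < n)%N -> bad e b -> (b <= a)%N.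
  have ex : exists b, (b < n)%N && bad e b by exists b0; move: b0n; rewrite mem_iota add0n => /= ->.
  have ub b : (b < n)%N && bad e b -> (b <= n)%N by case/andP => /ltnW.
  case: (ex_maxnP ex ub) => a /andP[an ba] mx; exists a => //; split=> // b bn bb.
  by apply: mx; rewrite bn.
have /and3P[a_gt0 /eqP ea1 /hasP[j0]] := bada.
rewrite mem_iota add0n /= => j0n /eqP ej0.
have [ele mono] := he.
(* The run where [e] takes the value [a] is [[w, w1)]; the plateau of [e] containing both [a.-1] and
   [a] is [[u0, u1)]. *)
set w := fst_ge e a; set w1 := fst_ge e a.+1.
set u0 := fst_ge e (e a); set u1 := fst_ge e (e a).+1.
have wn : (w < n)%N by apply: leq_ltn_trans (j0n); rewrite -(fst_geP _ he j0n) ej0.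
have w1n : (w1 <= n)%N by exact: fst_ge_le.
have ew : e w = a.
  apply/eqP; rewrite eqn_leq (fst_geP _ he wn) leqnn andbT -[leqRHS]ej0 mono //.
  by rewrite -fst_geP // ej0.
have run k : (k < n)%N -> (e k == a) = (w <= k < w1)%N.
  by move=> kn; rewrite eqn_leq andbC (leqNgt _ a) !(fst_geP _ he kn) -ltnNge.
have ww1 : (w < w1)%N by move: (run w wn); rewrite ew eqxx => /esym/andP[].
have eaa : (e a < a)%N.
  by have := ele a.-1 (ltac:(lia)); rewrite ea1; lia.
have aw : (a < w)%N.
  have := ele _ wn; rewrite ew leq_eqVlt => /orP[/eqP aw|//].
  by move: eaa; rewrite {1}aw ew ltnn.
have u0a : (u0 < a)%N.
  by have := fst_geP (e a) he (ltac:(lia) : a.-1 < n)%N; rewrite ea1 leqnn -/u0; lia.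
have au1 : (a < u1)%N by rewrite ltnNge -(fst_geP _ he an) ltnn.
have u1w : (u1 <= w)%N by rewrite -(fst_geP _ he wn) ew.
have flat k : (u0 <= k < u1)%N -> e k = e a.
  move=> /andP[uk ku]; have kn : (k < n)%N by lia.
  by apply/eqP; rewrite eqn_leq (leqNgt _ (e a)) !(fst_geP _ he kn) uk -ltnNge ku.
(* Values between [L] and [M] keep the function weakly increasing. Since [u0 <= L] and [M <= u1],
   whenever [x] and [x.+2] are in this range, [x] and [x.+1] lie on the plateau, as law A requires.
   Since [u1 <= w], the values do not exceed their positions. *)
set L := maxn (e w.-1) u0; set M := minn (if (w1 < n)%N then e w1 else n) u1.
have La : (L < a)%N.
  by rewrite gtn_max u0a andbT ltnNge fst_geP // -/w; lia.
have aM : (a < M)%N.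
  by rewrite leq_min au1 andbT; case: ifP => // w1n'; rewrite fst_geP.
have Mw : (M <= w)%N by rewrite (leq_trans (geq_minr _ _)).
set s := (w1 - w)%N.
pose psi r := Z (set_run e w r).
have runE r j : size r = s -> set_run e w r j = if (w <= j < w1)%N then nth 0%N r (j - w) else e j.
  by move=> sz; rewrite /set_run sz subnKC // ltnW.
have nthE r k : size r = s -> (k < s)%N -> nth 0%N (L :: rcons r M) k.+1 = nth 0%N r k.
  by move=> sz ks; rewrite /= nth_rcons sz ks.
have nthM r : size r = s -> nth 0%N (L :: rcons r M) s.+1 = M.
  by move=> sz; rewrite /= nth_rcons sz ltnn eqxx.
have nth_homo r k l : size r = s -> path leq L (rcons r M) -> (k <= l)%N -> (l <= s.+1)%N ->
    (nth 0%N (L :: rcons r M) k <= nth 0%N (L :: rcons r M) l)%N.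
  move=> sz so kl ls.
  apply: (sorted_leq_nth leq_trans leqnn) => //; rewrite ?inE /= size_rcons sz; lia.
have nthr r k : size r = s -> path leq L (rcons r M) -> (k < s)%N ->
    (L <= nth 0%N r k <= M)%N.
  move=> sz so ks; have := nth_homo r k.+1 s.+1 sz so; have := nth_homo r 0%N k.+1 sz so.
  rewrite (nthM r sz) (nthE r k sz ks) -[nth _ _ 0]/L; lia.
have nthm r k l : size r = s -> path leq L (rcons r M) -> (k <= l)%N -> (l < s)%N ->
    (nth 0%N r k <= nth 0%N r l)%N.
  move=> sz so kl ls; have := nth_homo r k.+1 l.+1 sz so.
  rewrite !nthE //; lia.
have hess_run r : size r = s -> path leq L (rcons r M) -> hess n (set_run e w r).
  move=> sz so; split=> [j jn|i j ij jn]; rewrite !runE //.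
    case: ifP => [/andP[wj jw]|_]; last exact: ele.
    have /andP[_ rM] := nthr r (j - w)%N sz so (ltac:(lia)); lia.
  case: ifP => [/andP[wi iw]|iW]; case: ifP => [/andP[wj jw]|jW].
  - by apply: nthm => //; lia.
  - have /andP[_ rM] := nthr r (i - w)%N sz so (ltac:(lia)).
    have w1j : (w1 <= j)%N by lia.
    have w1n' : (w1 < n)%N by exact: leq_ltn_trans jn.
    apply: leq_trans rM _; apply: leq_trans (geq_minl _ _) _.
    by rewrite w1n'; apply: mono.
  - have /andP[rL _] := nthr r (j - w)%N sz so (ltac:(lia)).
    apply: leq_trans rL; apply: leq_trans (leq_maxl _ _).
    by apply: mono; lia.
  - exact: mono.
have -> : Z e = psi (nseq s a).
  apply: Z_ext => j jn; rewrite runE ?size_nseq //; case: ifP => // wjw.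
  rewrite nth_nseq; have -> : (j - w < s)%N by lia.
  by apply/eqP; rewrite run.
have path_in r1 x y r2 (z : nat) : (x <= z <= y)%N ->
    path leq L (r1 ++ x :: y :: rcons r2 M) -> path leq L (rcons (r1 ++ z :: r2) M).
  move=> /andP[xz zy]; rewrite rcons_cat !cat_path /= => /and3P[-> lx /andP[_ py]] /=.
  rewrite (leq_trans lx xz) /=.
  by move: py; case: (rcons r2 M) => //= t r /andP[yt ->]; rewrite (leq_trans zy yt).
have size_mid r1 x y (r2 : seq nat) : size (r1 ++ x :: r2) = s -> size (r1 ++ y :: r2) = s.
  by rewrite !size_cat.
have mid (r1 : seq nat) x r2 : size (r1 ++ x :: r2) = s -> (w <= w + size r1 < w1)%N /\ (w + size r1 < n)%N.
  by rewrite size_cat /=; lia.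
have runi r1 x r2 : size (r1 ++ x :: r2) = s -> set_run e w (r1 ++ x :: r2) (w + size r1)%N = x.
  move=> sz.
  by rewrite runE // (proj1 (mid _ _ _ sz)) addKn nth_cat ltnn subnn.
have run_upd r1 x y r2 j : size (r1 ++ x :: r2) = s ->
    upd (set_run e w (r1 ++ x :: r2)) (w + size r1)%N y j = set_run e w (r1 ++ y :: r2) j.
  move=> sz; have szy := size_mid _ _ y _ sz; rewrite /upd (runE _ _ sz) (runE _ _ szy).
  case: eqP => [->|ne]; first by rewrite (proj1 (mid _ _ _ sz)) addKn nth_cat ltnn subnn.
  case: ifP => // wj; rewrite !nth_cat; case: ltnP => // rj.
  by have [k ->] : exists k, (j - w - size r1 = k.+1)%N by exists (j - w - size r1).-1; lia.
apply: (@strip_vanish _ _ q q_neq0 q_pow_neq1 s psi L M); rewrite ?size_nseq //.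
- move=> r1 x r2 sz so; rewrite /psi.
  have [i1 i2] := mid _ _ _ sz.
  have sz2 := size_mid _ _ x.+2 _ sz.
  have p0 := path_in r1 x x.+2 r2 x (ltac:(lia)) so.
  have p2 := path_in r1 x x.+2 r2 x.+2 (ltac:(lia)) so.
  have h0 := hess_run _ sz p0; have h2 := hess_run _ sz2 p2.
  have k1 : (size r1 < s)%N by rewrite -sz size_cat /=; lia.
  have := nthr _ _ sz p0 k1; have := nthr _ _ sz2 p2 k1.
  rewrite !nth_cat ltnn subnn /= => /andP[_ xM] /andP[Lx _].
  have ups y : Z (set_run e w (r1 ++ y :: r2)) =
      Z (upd (set_run e w (r1 ++ x :: r2)) (w + size r1)%N y).
    by apply: Z_ext => j _; rewrite run_upd.
  rewrite !ups; apply: Z_A => //; first by lia.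
  + by rewrite !runE //; do 2![case: ifP => [?|_]; first lia]; rewrite !flat //; lia.
  + move=> j ji; rewrite -[leqRHS](runi r1 x r2) //.
    by apply: (proj2 h0); lia.
  + move=> j /andP[ij jn]; rewrite -(run_upd r1 x.+2 x r2) //.
    rewrite /upd gtn_eqF // -[leqLHS](runi r1 x.+2 r2) //.
    by apply: (proj2 h2); lia.
- move=> r1 x r2 sz so; rewrite /psi.
  have cr y z : r1 ++ y :: z :: r2 = rcons r1 y ++ z :: r2 by rewrite cat_rcons.
  have sr y : (w + size (rcons r1 y) = (w + size r1).+1)%N by rewrite size_rcons addnS.
  have szy y z : size (r1 ++ y :: z :: r2) = s by rewrite -sz !size_cat.
  have [i1 i2] := mid _ _ _ sz.
  have szr y z : size (rcons r1 y ++ z :: r2) = s by rewrite -cr.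
  have := mid _ _ _ (szr x x); rewrite !sr => -[j1 j2].
  have so' y z : (x <= y)%N -> (y <= z)%N -> (z <= x.+1)%N ->
      path leq L (rcons (r1 ++ y :: z :: r2) M).
    move=> xy yz zx; move: so; rewrite rcons_cat !cat_path /= => /and3P[-> lx /andP[_]].
    rewrite yz (leq_trans lx xy) /=.
    by case: (rcons r2 M) => //= t r /andP[yt ->]; rewrite (leq_trans zx yt).
  have p0 := so' x x (leqnn _) (leqnn _) (leqnSn _).
  have p2 := so' x.+1 x.+1 (leqnSn _) (leqnn _) (leqnn _).
  have h0 := hess_run _ (szy _ _) p0; have h2 := hess_run _ (szy _ _) p2.
  have k1 : (size r1 < s)%N by rewrite -sz size_cat /=; lia.
  have := nthr _ _ (szy _ _) p0 k1; have := nthr _ _ (szy _ _) p2 k1.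
  rewrite !nth_cat ltnn subnn /= => /andP[_ xM] /andP[Lx _].
  have upE y z j : upd (upd (set_run e w (r1 ++ x :: x :: r2)) (w + size r1)%N y)
      (w + size r1)%N.+1 z j = set_run e w (r1 ++ y :: z :: r2) j.
    rewrite [in RHS]cr -(run_upd (rcons r1 y) x z r2) //. rewrite size_rcons addnS -cr.
    rewrite {1}/upd [RHS]/upd; case: ifP => // _; exact: run_upd.
  have ups y z : Z (set_run e w (r1 ++ y :: z :: r2)) =
      Z (upd (upd (set_run e w (r1 ++ x :: x :: r2)) (w + size r1)%N y) (w + size r1)%N.+1 z).
    by apply: Z_ext => j _; rewrite upE.
  rewrite !ups; apply: Z_B => //; first by lia.
  + move=> j ji; rewrite -[leqRHS](runi r1 x (x :: r2)) //.
    by apply: (proj2 h0); lia.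
  + move=> j /andP[ij jn]; apply/andP; split.
      have := upE x.+1 x.+1 j; rewrite /upd !gtn_eqF //; last lia.
      move=> ->; rewrite -[ltnLHS]/(x.+1.-1) prednK //.
      rewrite -[leqLHS](runi r1 x.+1 (x.+1 :: r2)) //.
      by apply: (proj2 h2); lia.
    rewrite runE //; case: ifP => [/andP[wj jw]|jW].
      by have := nthr _ (j - w)%N sz p0; lia.
    (* Both positions of law B carry the value [a] under [e]. A later value equal to the second
       position would therefore be bad, and it is larger than [a]: this is why the largest bad value
       was chosen. *)
    apply/negP => /eqP ej; have := amax (w + size r1)%N.+1 j2.
    rewrite /bad /= (eqP (etrans (run _ i2) i1)) (eqP (etrans (run _ j2) j1)) eqxx /=.
    have -> : has (fun j => e j == (w + size r1)%N.+1) (iota 0 n).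
      by apply/hasP; exists j; rewrite ?mem_iota ?ej.
    by move=> /(_ isT); lia.
- move=> r sz so al; apply: IH; last exact: hess_run.
  rewrite -ltnS (leq_trans _ lem) // ltnS.
  (* The ends of the strip create no bad value up to [a]. The end [M] exceeds [a]. The end [L] is
     [e w.-1], which [e] takes already, or [u0], which is not bad because a plateau starts there. *)
  have bad_lt b : (b < n)%N -> (b <= a)%N -> bad (set_run e w r) b -> (b < a)%N && bad e b.
    move=> bn ba /and3P[b_gt0]; rewrite !runE //.
    do 2![case: ifP => [?|_]; first lia]; move=> /eqP eb /hasP[j].
    rewrite mem_iota add0n /= => jn; rewrite runE //; case: ifP => [/andP[wj jw] /eqP rb|jW /eqP ejb].
      have jws : (j - w < s)%N by lia.
      move/(all_nthP 0%N)/(_ (j - w)%N): al; rewrite sz jws rb => /(_ isT) /=.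
      rewrite (ltn_eqF (leq_ltn_trans ba aM)) orbF => /eqP bL.
      rewrite bL La /= -bL /bad b_gt0 eb eqxx /=.
      have [bw|bu] : b = e w.-1 \/ b = u0 by rewrite bL /L /maxn; case: ifP; [right|left].
        by apply/hasP; exists w.-1; rewrite ?mem_iota ?bw //; lia.
      have := fst_geP (e a) he bn; have := fst_geP (e a) he (ltac:(lia) : b.-1 < n)%N.
      by rewrite eb -/u0 => ->; rewrite bu; lia.
    rewrite /bad b_gt0 eb eqxx /= ltn_neqAle ba andbT; apply/andP; split.
      by apply/eqP => bE; move: (run _ jn); rewrite ejb bE eqxx jW.
    by apply/hasP; exists j; rewrite ?mem_iota ?ejb.
  apply: (@leq_ltn_trans (\sum_(b < n | (b < a)%N) bad e b * 2 ^ (n - b) +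
                          \sum_(b < n | (a < b)%N) 2 ^ (n - b))%N).
    rewrite [X in (_ <= X + _)%N]big_mkcond [X in (_ <= _ + X)%N]big_mkcond -big_split.
    apply: leq_sum => b _ /=; case: (ltnP a b) => [ab|ba].
      by rewrite ifF ?leq_mul2r //=; [case: bad; rewrite ?mul1n ?mul0n ?add0n | lia].
    case: (boolP (bad (set_run e w r) b)) => // /(bad_lt _ (ltn_ord b) ba) /andP[-> ->].
    by rewrite addn0.
  rewrite /badness [X in (_ < X)%N](bigID (fun b : 'I_n => (b < a)%N)) /= ltn_add2l.
  rewrite [X in (_ < X)%N](bigD1 (Ordinal an)) /= ?ltnn // bada mul1n.
  by apply: leq_trans (leq_addr _ _); exact: sum_pow2.
- rewrite /psi; have -> : rcons (nseq s a) M = nseq s a ++ [:: M] by rewrite cats1.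
  rewrite cat_path /=; apply/andP; split.
    by elim: (s) (L) (ltnW La) => //= k IHk x xa; rewrite xa IHk.
  by rewrite andbT; elim: (s) (L) (ltnW La) => [|k IHk] x xa /=; [lia|apply: IHk].
Qed.
End Uniqueness.

(** * Sums over words with local weights *)

Definition lower (e : nat -> nat) (x : nat -> nat) j : seq nat :=
  [seq x k | k <- index_iota (e j) j].

Definition weight (R : comPzRingType) (F : seq nat -> nat -> R) n
    (e x : nat -> nat) : R :=
  \prod_(j < n) F (lower e x j) (x j).

(* The value is 0 out of range. *)
Definition word n K (c : {ffun 'I_n -> 'I_K}) : nat -> nat :=
  fun k => if insub k is Some i then c i else 0%N.

Lemma wordE n K (c : {ffun 'I_n -> 'I_K}) (i : 'I_n) : word c i = c i.
Proof. by rewrite /word valK. Qed.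

Lemma word_ge n K (c : {ffun 'I_n -> 'I_K}) k : (n <= k)%N -> word c k = 0%N.
Proof. by move=> nk; rewrite /word insubF // ltnNge nk. Qed.

Definition wsum (R : comPzRingType) (V : lmodType R) (F : seq nat -> nat -> R)
    n K (Th : {ffun 'I_n -> 'I_K} -> V) (e : nat -> nat) : V :=
  \sum_(c : {ffun 'I_n -> 'I_K}) weight F n e (word c) *: Th c.

Definition swap_nat u k := if k == u then u.+1 else if k == u.+1 then u else k.

Lemma swap_nat_id u k : k != u -> k != u.+1 -> swap_nat u k = k.
Proof. by rewrite /swap_nat => /negPf-> /negPf->. Qed.

Lemma swap_natL u : swap_nat u u = u.+1.
Proof. by rewrite /swap_nat eqxx. Qed.

Lemma swap_natR u : swap_nat u u.+1 = u.
Proof. by rewrite /swap_nat eqxx gtn_eqF. Qed.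

Lemma map_swap_nat (x : nat -> nat) u l r : ((r <= u) || (u.+1 < l))%N ->
  [seq (x \o swap_nat u) k | k <- index_iota l r] = [seq x k | k <- index_iota l r].
Proof.
move=> ulr; apply/eq_in_map => k; rewrite mem_index_iota /= => lkr.
by rewrite swap_nat_id //; lia.
Qed.

Lemma perm_swap2 (T : eqType) (a b : T) s : perm_eq (a :: b :: s) (b :: a :: s).
Proof. by apply/seq.permP => p /=; rewrite addnCA. Qed.

(** The window [[e j, j)] contains both of [u] and [u.+1] or neither, so the exchange at most
    permutes its letters. *)
Lemma lower_swap e x u j : j != u -> j != u.+1 -> e j != u.+1 ->
  perm_eq (lower e (x \o swap_nat u) j) (lower e x j).
Proof.
move=> ju ju1 eu; rewrite /lower; case: (leqP (e j) u) => eju; last first.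
  by rewrite map_swap_nat //; lia.
case: (ltnP u.+1 j) => uj; last by rewrite map_swap_nat //; lia.
have -> : index_iota (e j) j = index_iota (e j) u ++ u :: u.+1 :: index_iota u.+2 j.
  rewrite /index_iota; have -> : (j - e j = (u - e j) + (2 + (j - u.+2)))%N by lia.
  by rewrite iotaD subnKC //= addnS /=; congr (_ ++ _ :: _ :: iota _ _); lia.
rewrite !map_cat !map_cons map_swap_nat ?leqnn // map_swap_nat ?ltnSn ?orbT //.
by rewrite perm_cat2l /= swap_natL swap_natR perm_swap2.
Qed.

Section ModularLaws.
Variables (R : fieldType) (V : lmodType R) (q : R) (F : seq nat -> nat -> R).
Variables (n K : nat) (Th : {ffun 'I_n -> 'I_K} -> V).
Hypothesis two_neq0 : 2 != 0 :> R.
Hypothesis F_perm : forall s s' g, perm_eq s s' -> F s g = F s' g.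
Hypothesis F_mem : forall s g, g \in s -> F s g = 0.
(** [F_A] and [F_B] are the modular laws for one local factor, symmetrized over the exchanged
    letters [a] and [b]. In [F_A], the letters in [A] are seen by both exchanged positions, and [B]
    is what the position with letter [g] sees beyond those two. In [F_B] both positions see [B], and
    [p] is the letter at the vertex to which they may or may not be joined. *)
Hypothesis F_A : forall A B a b g, a \notin B -> b \notin B ->
  (1 + q) * (F A a * F (a :: A) b * F (b :: B) g +
             F A b * F (b :: A) a * F (a :: B) g) =
  (F A a * F (a :: A) b + F A b * F (b :: A) a) * (q * F B g + F (a :: b :: B) g).
Hypothesis F_B : forall B p a b, p \notin B ->
  (1 + q) * (F (p :: B) a * F (a :: B) b + F (p :: B) b * F (b :: B) a) =
  q * (F B a * F (a :: B) b + F B b * F (b :: B) a) +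
  (F (p :: B) a * F (a :: p :: B) b + F (p :: B) b * F (b :: p :: B) a).
Hypothesis Th_sym : forall (c : {ffun 'I_n -> 'I_K}) u v,
  Th [ffun i => c (tperm u v i)] = Th c.

Let Z := wsum F Th.

Lemma weight_ext e e' x : (forall j, (j < n)%N -> e j = e' j) ->
  weight F n e x = weight F n e' x.
Proof. by move=> ee; apply: eq_bigr => j _; rewrite /lower ee. Qed.

Lemma wsum_ext e e' : (forall j, (j < n)%N -> e j = e' j) -> Z e = Z e'.
Proof. by move=> ee; apply: eq_bigr => c _; rewrite (weight_ext _ ee). Qed.

Lemma weight_eq0 e x i j : (i < j)%N -> (j < n)%N -> (e j <= i)%N -> x i = x j ->
  weight F n e x = 0.
Proof.
move=> ij jn ei xij; rewrite /weight (bigD1 (Ordinal jn)) //= F_mem ?mul0r //.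
by rewrite -xij map_f // mem_index_iota ei.
Qed.

Lemma wsum_swap u e : (u.+1 < n)%N ->
  Z e = \sum_(c : {ffun 'I_n -> 'I_K}) weight F n e (word c \o swap_nat u) *: Th c.
Proof.
move=> un; pose u0 := Ordinal (ltnW un : u < n)%N; pose u1 := Ordinal un.
pose h (c : {ffun 'I_n -> 'I_K}) := [ffun i => c (tperm u0 u1 i)].
have hK : involutive h by move=> c; apply/ffunP => i; rewrite !ffunE tpermK.
rewrite /Z /wsum (reindex_inj (inv_inj hK)); apply: eq_bigr => c _; rewrite Th_sym.
congr (weight _ _ _ _ *: _); apply/funext => k /=.
have sn : (swap_nat u k < n)%N = (k < n)%N.
  by rewrite /swap_nat; case: eqP => [->|_]; last case: eqP => [->|_]; lia.
case: (ltnP k n) => kn; last by rewrite !word_ge // leqNgt sn -leqNgt.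
have skn : (swap_nat u k < n)%N by rewrite sn.
rewrite (wordE _ (Ordinal kn)) (wordE _ (Ordinal skn)) ffunE.
congr (nat_of_ord (c _)); apply/val_inj; rewrite /= /swap_nat.
case: tpermP => [[->]|[->]|/eqP iu /eqP iu1]; rewrite /= ?eqxx //.
  by rewrite (gtn_eqF (ltnSn u)).
by move: iu iu1; rewrite -!val_eqE /= => /negPf-> /negPf->.
Qed.

(* [Z] does not change when two consecutive letters are exchanged inside the
   words, so that [2 *: Z] is the sum of the symmetrized weights. *)
Lemma wsum_relation u e0 e1 e2 : (u.+1 < n)%N ->
    (forall x : nat -> nat,
      (1 + q) * (weight F n e1 x + weight F n e1 (x \o swap_nat u)) =
      q * (weight F n e2 x + weight F n e2 (x \o swap_nat u)) +
      (weight F n e0 x + weight F n e0 (x \o swap_nat u))) ->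
  (1 + q) *: Z e1 = q *: Z e2 + Z e0.
Proof.
move=> un rel; apply: (scalerI two_neq0); rewrite scalerDr !scalerA ![2 * _]mulrC.
have dbl e : 2 *: Z e = \sum_(c : {ffun 'I_n -> 'I_K})
    (weight F n e (word c) + weight F n e (word c \o swap_nat u)) *: Th c.
  rewrite scaler_nat mulr2n {2}(wsum_swap _ un) -big_split /=.
  by apply: eq_bigr => c _; rewrite scalerDl.
rewrite -!scalerA !dbl !scaler_sumr -big_split /=; apply: eq_bigr => c _.
by rewrite !scalerA -scalerDl rel.
Qed.

Lemma wsum_modular_A : modular_law_A q n Z.
Proof.
move=> e i a [ele mono] i_n ai eaa elow ehigh.
have an : (a.+1 < n)%N by exact: ltn_trans (i_n).
apply: (@wsum_relation a) => // x.
pose io := Ordinal i_n; pose ao := Ordinal (ltnW an : a < n)%N; pose a1o := Ordinal an.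
pose rest (y : nat -> nat) := \prod_(j < n | [&& j != io, j != a1o & j != ao]) F (lower e y j) (y j).
have ea : (e a <= a)%N by apply: ele; exact: ltnW.
pose A := lower e x a; pose B := [seq x k | k <- index_iota a.+2 i].
have neq : [&& a != i, a.+1 != i & a != a.+1] by lia.
have lowA y : perm_eq (lower e y a.+1) (y a :: lower e y a).
  rewrite /lower -eaa /index_iota subSn // -addn1 iotaD map_cat /= subnKC //.
  by rewrite cats1 perm_rcons.
have wE b y : weight F n (upd e i b) y =
    F [seq y k | k <- index_iota b i] (y i) *
    (F (y a :: lower e y a) (y a.+1) * (F (lower e y a) (y a) * rest y)).
  rewrite /weight (bigD1 io) //= (bigD1 a1o) /=; last by rewrite -val_eqE /=; lia.
  rewrite (bigD1 ao) /=; last by rewrite -!val_eqE /=; lia.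
  rewrite -(F_perm _ (lowA y)) /lower /upd !eqxx !ifF; try lia.
  congr (_ * (_ * (_ * _))); apply: eq_big => [j|j]; first by rewrite -!andbA.
  by rewrite -!val_eqE /= => /andP[/andP[/negPf-> _] _].
have restE : rest (x \o swap_nat a) = rest x.
  apply: eq_bigr => j; rewrite -!val_eqE /= => /and3P[ji ja1 ja].
  rewrite (swap_nat_id ja ja1); apply: F_perm; apply: lower_swap => //.
  have := elow j; have := ehigh j; have := ltn_ord j; lia.
have lowa : lower e (x \o swap_nat a) a = A by rewrite /lower map_swap_nat ?leqnn.
have mapB : [seq (x \o swap_nat a) k | k <- index_iota a.+2 i] = B.
  by rewrite map_swap_nat ?ltnSn ?orbT.
have iota1 : index_iota a.+1 i = a.+1 :: index_iota a.+2 i.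
  by rewrite /index_iota -(subnSK ai).
have iota0 : index_iota a i = a :: index_iota a.+1 i.
  by rewrite /index_iota -(subnSK (ltnW ai)).
rewrite !wE restE lowa iota0 iota1 !map_cons mapB /= swap_natL swap_natR.
rewrite (@swap_nat_id a i) ?gtn_eqF ?(ltnW ai) // -/A -/B.
(* A position strictly between [a.+1] and [i] sees both exchanged positions. If it repeats one of
   their letters, the remaining product vanishes, which is why [F_A] is asked only for letters
   outside [B]. *)
have [xB|xB] := boolP ((x a \in B) || (x a.+1 \in B)).
  have -> : rest x = 0; last by rewrite !(mulr0, addr0).
  have [u /andP[au ua] [k kB xk]] : exists2 u, (a <= u <= a.+1)%N &
      exists2 k, k \in index_iota a.+2 i & x u = x k.
    case/orP: xB => /mapP[k kB xk]; [exists a|exists a.+1]; rewrite ?leqnn ?leqnSn //; by exists k.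
  move: kB; rewrite mem_index_iota => /andP[ak ki].
  have kn : (k < n)%N by exact: ltn_trans (i_n).
  rewrite /rest (bigD1 (Ordinal kn)) /=; last by rewrite -!val_eqE /=; lia.
  rewrite F_mem ?mul0r // -xk map_f // mem_index_iota.
  have := elow k ki; lia.
move: xB; rewrite negb_or => /andP[aB bB].
have /(congr1 (fun z => z * rest x)) E := F_A A (x i) aB bB.
rewrite (F_perm (x i) (perm_swap2 (x a.+1) (x a) B)).
by apply: etrans (etrans E _) => /=; ring.
Qed.

Lemma wsum_modular_B : modular_law_B q n Z.
Proof.
move=> e u a he un au elow ehigh.
apply: (@wsum_relation u) => // x.
pose uo := Ordinal (ltnW un : u < n)%N; pose u1o := Ordinal un.
pose rest (y : nat -> nat) := \prod_(j < n | (j != u1o) && (j != uo)) F (lower e y j) (y j).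
pose B := [seq x k | k <- index_iota a.+1 u].
have wE b c y : weight F n (upd (upd e u b) u.+1 c) y =
    F [seq y k | k <- index_iota c u.+1] (y u.+1) *
    (F [seq y k | k <- index_iota b u] (y u) * rest y).
  rewrite /weight (bigD1 u1o) //= (bigD1 uo) /=; last by rewrite -val_eqE /=; lia.
  rewrite /lower /upd !eqxx ltn_eqF //; congr (_ * (_ * _)).
  by apply: eq_big => // j; rewrite -!val_eqE /= => /andP[/negPf-> /negPf->].
have restE : rest (x \o swap_nat u) = rest x.
  apply: eq_bigr => j; rewrite -!val_eqE /= => /andP[ju1 ju].
  rewrite (swap_nat_id ju ju1); apply: F_perm; apply: lower_swap => //.
  by have := elow j; have := ehigh j; have := ltn_ord j; lia.
have iotaS b : (b <= u)%N -> index_iota b u.+1 = rcons (index_iota b u) u.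
  by move=> bu; rewrite /index_iota subSn // -addn1 iotaD subnKC // cats1.
have iota0 : index_iota a u = a :: index_iota a.+1 u.
  by rewrite /index_iota -(subnSK au).
have consE y z s : F (rcons s y) z = F (y :: s) z by apply: F_perm; rewrite perm_rcons.
have mapB : [seq (x \o swap_nat u) k | k <- index_iota a.+1 u] = B.
  by rewrite map_swap_nat ?leqnn.
rewrite !wE restE !iotaS ?(ltnW au) // !iota0 !map_rcons !map_cons mapB !consE.
rewrite [(_ \o _) u]/= [(_ \o _) u.+1]/= [(_ \o _) a]/= swap_natL swap_natR.
have -> : swap_nat u a = a by rewrite swap_nat_id //; lia.
rewrite -/B.
have [pB|pB] := boolP (x a \in B).
  have -> : rest x = 0; last by rewrite !(mulr0, addr0).
  case/mapP: pB => k; rewrite mem_index_iota => /andP[ak ku] xk.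
  have kn : (k < n)%N by lia.
  rewrite /rest (bigD1 (Ordinal kn)) /=; last by rewrite -!val_eqE /=; lia.
  rewrite F_mem ?mul0r // -xk map_f // mem_index_iota.
  by have := elow k ku; lia.
have /(congr1 (fun z => z * rest x)) E := F_B (x u) (x u.+1) pB.
by apply: etrans (etrans E _) => /=; ring.
Qed.
End ModularLaws.

(** * Local weights of colorings *)

Section ColorWeight.
Variables (R : fieldType) (q : R).

Definition edge_weight (x g : nat) : R :=
  if x == g then 0 else if (x < g)%N then q else 1.

Definition color_weight (s : seq nat) (g : nat) : R := \prod_(x <- s) edge_weight x g.

Lemma color_weight_perm s s' g : perm_eq s s' -> color_weight s g = color_weight s' g.
Proof. exact: perm_big. Qed.

Lemma color_weight_mem s g : g \in s -> color_weight s g = 0.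
Proof.
by move=> gs; rewrite /color_weight (big_rem g) //= /edge_weight eqxx mul0r.
Qed.

Lemma color_weight_cons x s g :
  color_weight (x :: s) g = edge_weight x g * color_weight s g.
Proof. exact: big_cons. Qed.

(** The factors coming from [A] and [B] are common to all terms. What remains depends only on the
    relative order of the three letters. *)
Lemma color_weight_A A B a b g :
  (1 + q) * (color_weight A a * color_weight (a :: A) b * color_weight (b :: B) g +
             color_weight A b * color_weight (b :: A) a * color_weight (a :: B) g) =
  (color_weight A a * color_weight (a :: A) b + color_weight A b * color_weight (b :: A) a) *
  (q * color_weight B g + color_weight (a :: b :: B) g).
Proof.
have loc : (1 + q) * (edge_weight a b * edge_weight b g + edge_weight b a * edge_weight a g) =
    (edge_weight a b + edge_weight b a) * (q + edge_weight a g * edge_weight b g).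
  rewrite /edge_weight; case: (ltngtP a b) => ab; case: (ltngtP b g) => bg;
    case: (ltngtP a g) => ag; try lia; ring.
rewrite !color_weight_cons; move: (color_weight A a) (color_weight A b) (color_weight B g).
move=> x y z; move/(congr1 (fun t => x * y * z * t)): loc => loc.
by apply: etrans (etrans loc _); ring.
Qed.

Lemma color_weight_B B p a b :
  (1 + q) * (color_weight (p :: B) a * color_weight (a :: B) b +
             color_weight (p :: B) b * color_weight (b :: B) a) =
  q * (color_weight B a * color_weight (a :: B) b + color_weight B b * color_weight (b :: B) a) +
  (color_weight (p :: B) a * color_weight (a :: p :: B) b +
   color_weight (p :: B) b * color_weight (b :: p :: B) a).
Proof.
have loc : (1 + q) * (edge_weight p a * edge_weight a b + edge_weight p b * edge_weight b a) =
    (edge_weight a b + edge_weight b a) * (q + edge_weight p a * edge_weight p b).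
  rewrite /edge_weight; case: (ltngtP a b) => ab; case: (ltngtP p b) => bg;
    case: (ltngtP p a) => ag; try lia; ring.
rewrite !color_weight_cons; move: (color_weight B a) (color_weight B b).
move=> x y; move/(congr1 (fun t => x * y * t)): loc => loc.
by apply: etrans (etrans loc _); ring.
Qed.
End ColorWeight.

(** * Local weights of columns *)

Section ColumnWeight.
Variables (R : fieldType) (q : R).
Hypothesis q_neq0 : q != 0.
Hypothesis q_pow_neq1 : forall k, q ^+ k.+1 != 1.

(** The value 1 at [g = x.+1] stands for the factor omitted from the product, whose denominator
    vanishes there. The extra [q] in every other factor produces the power of $q$ in front of the
    tableau sum, see [card_nonlinks]. *)
Definition column_factor (g x : nat) : R :=
  if g == x.+1 then 1 else q * (q ^+ g - q ^+ x) / (q ^+ g - q ^+ x.+1).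

(** The condition that cuts $\overline{\mathrm{SYT}}$ out of $\mathrm{SYT}$, for a new entry in
    column [g] when [s] lists the columns of the entries preceding it. *)
Definition reachable (s : seq nat) (g : nat) : bool := (g == 0%N) || (g.-1 \in s).

Definition column_weight (s : seq nat) (g : nat) : R :=
  (reachable s g)%:R * \prod_(x <- s) column_factor g x.

Lemma column_weight_perm s s' g : perm_eq s s' -> column_weight s g = column_weight s' g.
Proof.
by move=> ss; rewrite /column_weight /reachable (perm_big _ ss) (perm_mem ss).
Qed.

Lemma column_weight_mem s g : g \in s -> column_weight s g = 0.
Proof.
move=> gs; rewrite /column_weight (big_rem g) //= /column_factor ltn_eqF //.
by rewrite subrr mulr0 mul0r mul0r mulr0.
Qed.

Lemma reachable_cons x s g : reachable (x :: s) g = reachable s g || (g == x.+1).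
Proof. by rewrite /reachable inE; case: g => //= g; rewrite eqSS orbC. Qed.

Lemma reachable_succ x s : x \notin s -> reachable s x.+1 = false.
Proof. by rewrite /reachable /= => /negPf. Qed.

Lemma qpow_sub_neq0 a b : a != b -> q ^+ a - q ^+ b != 0.
Proof.
wlog ab : a b / (a < b)%N => [hw|].
  rewrite neq_ltn => /orP[ab|ba]; first by apply: hw => //; rewrite ltn_eqF.
  by rewrite -opprB oppr_eq0; apply: hw => //; rewrite ltn_eqF.
move=> _; have -> : b = (a + (b - a).-1.+1)%N by lia.
rewrite exprD -[X in X - _]mulr1 -mulrBr mulf_neq0 ?expf_neq0 //.
by rewrite subr_eq0 eq_sym.
Qed.


Lemma column_factorE g x : g != x.+1 ->
  column_factor g x = q * (q ^+ g - q ^+ x) / (q ^+ g - q * q ^+ x).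
Proof. by rewrite /column_factor => /negPf->; rewrite exprS. Qed.

Lemma column_factorS x : column_factor x.+1 x = 1.
Proof. by rewrite /column_factor eqxx. Qed.

Lemma column_factorD x : column_factor x x = 0.
Proof. by rewrite column_factorE ?ltn_eqF // subrr mulr0 mul0r. Qed.

(** The flags stand for the reachability of [a] and [b] from [A] and of [g] from [B]. As [a] and [b]
    occur in neither list, the columns next to them are not reachable yet; this is what the four
    assumptions record. Away from the coincidences among [a], [b], [g] and their successors, the
    claim is a rational identity in the powers of [q]. *)
Lemma local_A (ja jb jg : bool) a b g :
    ~~ ((b == a.+1) && jb) -> ~~ ((a == b.+1) && ja) ->
    ~~ ((g == a.+1) && jg) -> ~~ ((g == b.+1) && jg) ->
  (1 + q) * (ja%:R * ((jb || (b == a.+1))%:R * column_factor b a) *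
               ((jg || (g == b.+1))%:R * column_factor g b) +
             jb%:R * ((ja || (a == b.+1))%:R * column_factor a b) *
               ((jg || (g == a.+1))%:R * column_factor g a)) =
  (ja%:R * ((jb || (b == a.+1))%:R * column_factor b a) +
   jb%:R * ((ja || (a == b.+1))%:R * column_factor a b)) *
  (q * jg%:R + (jg || (g == b.+1) || (g == a.+1))%:R *
     (column_factor g a * column_factor g b)).
Proof.
case: (eqVneq b a.+1) => [eb|nb]; case: (eqVneq a b.+1) => [ea|na]; try (exfalso; lia);
case: (eqVneq g a.+1) => [ega|nga]; case: (eqVneq g b.+1) => [egb|ngb];
  try (exfalso; lia); case: ja => //= ; case: jb => //=; case: jg => //= _ _ _ _;
  rewrite !(mul1r, mul0r, mulr1, mulr0, add0r, addr0) //; try (have ab : a = b by lia); try subst b;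
  try subst a; try subst g; rewrite ?column_factorS ?column_factorD ?mulr0 ?mul0r //.
all: rewrite ?column_factorE ?exprS //.
all: try lia.
all: field; rewrite -?exprS ?qpow_sub_neq0 //; lia.
Qed.

Lemma column_weight_A A B a b g : a \notin B -> b \notin B ->
  (1 + q) * (column_weight A a * column_weight (a :: A) b * column_weight (b :: B) g +
             column_weight A b * column_weight (b :: A) a * column_weight (a :: B) g) =
  (column_weight A a * column_weight (a :: A) b + column_weight A b * column_weight (b :: A) a) *
  (q * column_weight B g + column_weight (a :: b :: B) g).
Proof.
move=> aB bB; have [aA|aA] := boolP (a \in A).
  rewrite [column_weight A a]column_weight_mem // [column_weight (b :: A) a]column_weight_mem ?inE ?aA ?orbT //.
  by rewrite !(mul0r, mulr0, addr0).
have [bA|bA] := boolP (b \in A).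
  rewrite [column_weight A b]column_weight_mem // [column_weight (a :: A) b]column_weight_mem ?inE ?bA ?orbT //.
  by rewrite !(mul0r, mulr0, addr0).
have := @local_A (reachable A a) (reachable A b) (reachable B g) a b g.
have suc x y s : x \notin s -> ~~ ((y == x.+1) && reachable s y).
  by move=> xs; apply/negP => /andP[/eqP->]; rewrite reachable_succ.
move=> /(_ (suc _ _ _ aA) (suc _ _ _ bA) (suc _ _ _ aB) (suc _ _ _ bB)).
rewrite /column_weight !reachable_cons !big_cons.
move: (\prod_(x <- A) _) (\prod_(x <- A) _) (\prod_(x <- B) _) => x y z.
move/(congr1 (fun t => x * y * z * t)) => loc.
by apply: etrans (etrans loc _); ring.
Qed.

Lemma local_B (ja jb : bool) a b p :
    ~~ ((b == a.+1) && jb) -> ~~ ((a == b.+1) && ja) ->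
    ~~ ((a == p.+1) && ja) -> ~~ ((b == p.+1) && jb) ->
  (1 + q) * ((ja || (a == p.+1))%:R * column_factor a p *
               ((jb || (b == a.+1))%:R * column_factor b a) +
             (jb || (b == p.+1))%:R * column_factor b p *
               ((ja || (a == b.+1))%:R * column_factor a b)) =
  q * (ja%:R * ((jb || (b == a.+1))%:R * column_factor b a) +
       jb%:R * ((ja || (a == b.+1))%:R * column_factor a b)) +
  ((ja || (a == p.+1))%:R * column_factor a p *
     ((jb || (b == p.+1) || (b == a.+1))%:R * (column_factor b a * column_factor b p)) +
   (jb || (b == p.+1))%:R * column_factor b p *
     ((ja || (a == p.+1) || (a == b.+1))%:R * (column_factor a b * column_factor a p))).
Proof.
case: (eqVneq b a.+1) => [eb|nb]; case: (eqVneq a b.+1) => [ea|na]; try (exfalso; lia);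
case: (eqVneq a p.+1) => [eap|nap]; case: (eqVneq b p.+1) => [ebp|nbp];
  try (exfalso; lia); case: ja => //= ; case: jb => //= _ _ _ _;
  rewrite !(mul1r, mul0r, mulr1, mulr0, add0r, addr0) //; try (have ab : a = b by lia);
  try (have pa : p = a by lia); try (have pb : p = b by lia);
  try subst p; try subst b;
  try subst a; rewrite ?column_factorS ?column_factorD ?mulr0 ?mul0r //.
all: rewrite ?column_factorE ?exprS //.
all: try lia.
all: field; rewrite -?exprS ?qpow_sub_neq0 //; lia.
Qed.

Lemma column_weight_B B p a b : p \notin B ->
  (1 + q) * (column_weight (p :: B) a * column_weight (a :: B) b +
             column_weight (p :: B) b * column_weight (b :: B) a) =
  q * (column_weight B a * column_weight (a :: B) b + column_weight B b * column_weight (b :: B) a) +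
  (column_weight (p :: B) a * column_weight (a :: p :: B) b +
   column_weight (p :: B) b * column_weight (b :: p :: B) a).
Proof.
move=> pB; have cw0 x s : x \in B -> subseq B s -> column_weight s x = 0.
  by move=> xB /mem_subseq/(_ _ xB); exact: column_weight_mem.
have sub1 x : subseq B (x :: B) by exact: subseq_cons.
have sub2 x y : subseq B (x :: y :: B) by exact: subseq_trans (sub1 y) (subseq_cons _ _).
have [aB|aB] := boolP (a \in B).
  by rewrite !(cw0 a) // !(mul0r, mulr0, addr0).
have [bB|bB] := boolP (b \in B).
  by rewrite !(cw0 b) // !(mul0r, mulr0, addr0).
have := @local_B (reachable B a) (reachable B b) a b p.
have suc x y : x \notin B -> ~~ ((y == x.+1) && reachable B y).
  by move=> xs; apply/negP => /andP[/eqP->]; rewrite reachable_succ.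
move=> /(_ (suc _ _ aB) (suc _ _ bB) (suc _ _ pB) (suc _ _ pB)).
rewrite /column_weight !reachable_cons !big_cons.
move: (\prod_(x <- B) _) (\prod_(x <- B) _) => x y.
move/(congr1 (fun t => x * y * t)) => loc.
by apply: etrans (etrans loc _); ring.
Qed.
End ColumnWeight.

(** * Disjoint unions of cliques *)

Definition idempotent_on n (e : nat -> nat) := forall j, (j < n)%N -> e (e j) = e j.

(** At a least [j] with [e (e j) < e j], the value [b = e j] is bad: minimality gives
    [e (e b) = e b], and [e b <= b.-1 < b] then forces [e b.-1 = e b]. *)
Lemma not_bad_idempotent n e : hess n e ->
  (forall b, (b < n)%N -> ~~ bad n e b) -> idempotent_on n e.
Proof.
move=> [ele mono] no_bad j; have [m] := ubnP j; elim: m j => // m IH j jm jn.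
apply/eqP; rewrite eqn_leq ele ?(leq_ltn_trans (ele _ jn)) //=.
rewrite leqNgt; apply/negP => eej; set b := e j in eej *.
have bj : (b <= j)%N by exact: ele.
have bj' : (b < j)%N.
  by rewrite ltn_neqAle bj andbT; apply/eqP => bj'; move: eej; rewrite {1}bj' -/b ltnn.
have bn : (b < n)%N by exact: ltn_trans jn.
have eeb : e (e b) = e b by apply: IH => //; lia.
have b_gt0 : (0 < b)%N by lia.
have := no_bad b bn; rewrite /bad b_gt0 /=.
have -> : has (fun j => e j == b) (iota 0 n).
  by apply/hasP; exists j; rewrite ?mem_iota ?eqxx.
rewrite andbT => /negP; apply; rewrite eqn_leq mono ?leq_pred //= -eeb mono //; lia.
Qed.

Lemma idempotent_block n e j k : hess n e -> idempotent_on n e -> (j < n)%N ->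
  (e j <= k <= j)%N -> e k = e j.
Proof.
move=> [ele mono] idem jn /andP[ek kj]; apply/eqP; rewrite eqn_leq mono //=.
by rewrite -{1}(idem _ jn) mono //; apply: leq_ltn_trans jn.
Qed.

Lemma hessW n m e : (m <= n)%N -> hess n e -> hess m e.
Proof.
move=> mn [ele mono]; split=> [j jm|i j ij jm]; first by apply: ele; apply: leq_trans mn.
by apply: mono => //; apply: leq_trans mn.
Qed.

Section Words.
Variables (R : comPzRingType) (K : nat).

Definition wcons (x : nat -> nat) n y : nat -> nat := fun k => if k == n then y else x k.

Lemma sum_word_rcons (V : nmodType) n (G : (nat -> nat) -> V) :
  \sum_(c : {ffun 'I_n.+1 -> 'I_K}) G (word c) =
  \sum_(c : {ffun 'I_n -> 'I_K}) \sum_(y : 'I_K) G (wcons (word c) n y).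
Proof.
pose mk (p : {ffun 'I_n -> 'I_K} * 'I_K) : {ffun 'I_n.+1 -> 'I_K} :=
  [ffun i => if unlift ord_max i is Some j then p.1 j else p.2].
pose un (c : {ffun 'I_n.+1 -> 'I_K}) := ([ffun j => c (lift ord_max j)], c ord_max).
have mkK : cancel mk un.
  move=> [c y]; rewrite /un /mk /= !ffunE unlift_none; congr (_, _).
  by apply/ffunP => j; rewrite !ffunE liftK.
have unK : cancel un mk.
  move=> c; apply/ffunP => i; rewrite ffunE /=.
  by case: unliftP => [j|] ->; rewrite ?ffunE.
rewrite pair_bigA (reindex mk) /=; last by exists un => ? _; [apply: mkK|apply: unK].
apply: eq_bigr => -[c y] _; congr G; apply/funext => k /=; rewrite /wcons.
case: eqP => [->|/eqP kn].
  by rewrite (wordE _ (ord_max : 'I_n.+1)) ffunE unlift_none.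
case: (ltnP k n) => [kn'|nk]; last first.
  by rewrite !word_ge // ltn_neqAle eq_sym kn.
rewrite (wordE c (Ordinal kn')) (wordE _ (Ordinal (leqW kn' : k < n.+1)%N)) ffunE.
case: unliftP => [j /(congr1 val)|/(congr1 val)] /=.
  rewrite -[LHS]/k -[bump n j]/(nat_of_ord (lift ord_max j)) lift_max => kj.
  by congr (nat_of_ord (c _)); apply/val_inj.
by move=> kE; have := kn'; rewrite {1}kE ltnn.
Qed.

Lemma weight_rcons (F : seq nat -> nat -> R) n e x y :
  (forall j, (j <= n)%N -> (e j <= j)%N) ->
  weight F n.+1 e (wcons x n y) = weight F n e x * F (lower e x n) y.
Proof.
move=> ele; rewrite /weight big_ord_recr /=.
have lowE j : (j <= n)%N -> lower e (wcons x n y) j = lower e x j.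
  move=> jn; apply/eq_in_map => k; rewrite mem_index_iota => /andP[_ kj].
  by rewrite /wcons ltn_eqF // (leq_trans kj).
rewrite lowE // {3}/wcons eqxx; congr (_ * _).
by apply: eq_bigr => j _; rewrite lowE 1?ltnW // /wcons ltn_eqF.
Qed.
End Words.

Section QNumbers.
Variables (R : fieldType) (q : R).

Definition qnum n : R := \sum_(i < n) q ^+ i.
Definition qfact n : R := \prod_(i < n) qnum i.+1.

Lemma qnumE n : q != 1 -> qint q n = qnum n.
Proof.
move=> q1; rewrite /qint -[X in X - _](expr1n _ n) subrXX.
rewrite mulrAC divff ?mul1r ?subr_eq0 1?eq_sym //.
rewrite /qnum; apply: eq_bigr => i _; by rewrite expr1n mul1r.
Qed.

(** Removing the largest element of [S], which has rank [#|S| - 1], leaves the other ranks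
    unchanged. *)
Lemma sum_rank K (S : {set 'I_K}) :
  \sum_(y in S) q ^+ #|[set z in S | (z < y)%N]| = qnum #|S|.
Proof.
have [m] := ubnP #|S|; elim: m S => // m IH S.
have [->|[s0 s0S]] := set_0Vmem S; first by rewrite big_set0 cards0 /qnum big_ord0.
have [t tS tmax] := @arg_maxnP _ s0 (mem S) (fun z : 'I_K => z : nat) s0S.
have {}tS : t \in S := tS.
rewrite (big_setD1 t) //= (cardsD1 t S) tS add1n ltnS => Sm.
rewrite /qnum big_ord_recr addrC /=; congr (_ + _).
  rewrite -/(qnum _) -IH //; apply: eq_bigr => y; rewrite !inE => /andP[yt yS].
  congr (q ^+ #|pred_of_set _|); apply/setP => z; rewrite !inE.
  case: (eqVneq z t) => [->|//]; rewrite tS /=.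
  by apply/negbTE; rewrite -leqNgt; exact: tmax.
congr (q ^+ #|pred_of_set _|); apply/setP => z; rewrite !inE.
case: (boolP (z \in S)) => zS; rewrite ?andbT ?andbF //=.
by rewrite ltn_neqAle (tmax z zS : z <= t)%N andbT val_eqE.
Qed.
End QNumbers.

Section CliqueColorings.
Variables (R : fieldType) (q : R) (A : comAlgType R) (K : nat) (X : nat -> A).

Definition elsym k : A := \sum_(S : {set 'I_K} | #|S| == k) \prod_(i in S) X i.

Definition wmon n (x : nat -> nat) : A := \prod_(i < n) X (x i).

Definition block p k (x : nat -> nat) : {set 'I_K} :=
  [set y : 'I_K | val y \in [seq x j | j <- iota p k]].

Definition csum n e : A :=
  \sum_(c : {ffun 'I_n -> 'I_K}) weight (color_weight q) n e (word c) *: wmon n (word c).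

(** The last letter [y] of the block must avoid the earlier ones and contributes [q] to the number
    of smaller letters among them. Fixing the set [S] of letters of the block makes this exponent
    the rank of [y] in [S], independent of the word, so that [sum_rank] sums over [y]. *)
Lemma csum_block p k e (S : {set 'I_K}) : hess (p + k)%N e ->
    (forall j, (p <= j < p + k)%N -> e j = p) ->
  \sum_(c : {ffun 'I_(p + k)%N -> 'I_K})
     (block p k (word c) == S)%:R *:
       (weight (color_weight q) (p + k)%N e (word c) *: wmon (p + k)%N (word c)) =
  ((#|S| == k)%:R * qfact q k) *: (csum p e * \prod_(i in S) X i).
Proof.
elim: k S => [|k IH] S he ep.
  rewrite addn0 cards_eq0 /qfact big_ord0 mulr1.
  have b0 x : block p 0%N x = finset.set0 by apply/setP => y; rewrite !inE.
  under [LHS]eq_bigr do rewrite b0 eq_sym.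
  have [->|S0] := eqVneq S finset.set0; last by rewrite !scale0r big1 // => c _; rewrite scale0r.
  by rewrite scale1r big_set0 mulr1; apply: eq_bigr => c _; rewrite scale1r.
rewrite addnS in he ep *.
rewrite (@sum_word_rcons K _ _ (fun x => (block p k.+1 x == S)%:R *:
  (weight (color_weight q) (p + k)%N.+1 e x *: wmon (p + k)%N.+1 x))) exchange_big /=.
have ele j : (j <= p + k)%N -> (e j <= j)%N by move=> jp; apply: (proj1 he).
have blockS x (y : 'I_K) : block p k.+1 (wcons x (p + k)%N y) = y |: block p k x.
  have iotaS : iota p k.+1 = iota p k ++ [:: (p + k)%N] by rewrite -addn1 iotaD.
  apply/setP => z; rewrite /block iotaS !inE map_cat mem_cat orbC /= inE {1}/wcons eqxx val_eqE.
  congr (_ || (_ \in (_ : seq nat))); apply/eq_in_map => j; rewrite mem_iota => /andP[_ jp].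
  by rewrite /wcons ltn_eqF.
have lowE (y : 'I_K) (c : {ffun 'I_(p + k)%N -> 'I_K}) :
    weight (color_weight q) (p + k)%N e (word c) *
      color_weight q (lower e (word c) (p + k)%N) y =
    weight (color_weight q) (p + k)%N e (word c) *
      ((y \notin block p k (word c))%:R * q ^+ #|[set z in block p k (word c) | (z < y)%N]|).
  (* A repeated letter inside the block already annihilates the weight; otherwise the letters
     enumerate [block] without repetition. *)
  have [un|/uniqPn] := boolP (uniq [seq word c j | j <- iota p k]); last first.
    move=> /(_ 0%N)[i [j [ij]]]; rewrite size_map size_iota => jk.
    rewrite !(nth_map 0%N) ?size_iota ?(ltn_trans ij) // !nth_iota ?(ltn_trans ij) // => wij.
    rewrite (weight_eq0 _ (i := (p + i)%N) (j := (p + j)%N)) ?mul0r //; try lia.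
      exact: color_weight_mem.
    by rewrite ep; lia.
  congr (_ * _); rewrite /lower ep /index_iota ?addKn; last lia.
  have mem_block z : (z \in block p k (word c)) = (val z \in [seq word c j | j <- iota p k]).
    by rewrite inE.
  have pe : perm_eq [seq word c j | j <- iota p k] (map val (enum (block p k (word c)))).
    apply: uniq_perm => // [|z]; first by rewrite map_inj_uniq ?enum_uniq //; exact: val_inj.
    apply/idP/mapP => [zin|[t + ->]]; last by rewrite mem_enum mem_block.
    have zK : (z < K)%N.
      case/mapP: (zin) => j; rewrite mem_iota => /andP[_ jp] ->.
      by rewrite (wordE c (Ordinal jp)) ltn_ord.
    by exists (Ordinal zK); rewrite // mem_enum mem_block.
  rewrite (color_weight_perm _ _ pe) /color_weight big_map big_enum /=.
  case: (boolP (y \in block p k (word c))) => yb.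
    by rewrite mul0r (bigD1 y) //= /edge_weight eqxx mul0r.
  rewrite mul1r -[RHS]mulr1 -prodr_const (bigID (fun z : 'I_K => z < y)%N) /=.
  congr (_ * _).
    apply: eq_big => [z|z /andP[zb zy]]; first by rewrite !inE.
    by rewrite /edge_weight ltn_eqF ?zy.
  apply: big1 => z /andP[zb zy]; rewrite /edge_weight (negPf zy) ifF //.
  by apply/negbTE; apply: contraNneq yb => /val_inj <-.
have hepk : hess (p + k)%N e := hessW (leqnSn _) he.
transitivity (\sum_(y in S) \sum_(c : {ffun 'I_(p + k)%N -> 'I_K})
   (q ^+ #|[set z in S | (z < y)%N]|) *: (X y * ((block p k (word c) == S :\ y)%:R *:
       (weight (color_weight q) (p + k)%N e (word c) *: wmon (p + k)%N (word c))))).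
  rewrite [RHS]big_mkcond; apply: eq_bigr => y _; case: ifP => yS; last first.
    rewrite big1 // => c _; rewrite blockS; case: eqP => [|_]; last by rewrite scale0r.
    by move/setP/(_ y); rewrite !inE eqxx yS.
  apply: eq_bigr => c _; rewrite blockS weight_rcons // lowE.
  have -> : wmon (p + k)%N.+1 (wcons (word c) (p + k)%N y) = wmon (p + k)%N (word c) * X y.
    rewrite /wmon big_ord_recr /= {2}/wcons eqxx; congr (_ * _).
    by apply: eq_bigr => i _; rewrite /wcons ltn_eqF.
  set w := weight _ _ _ _; set m := wmon _ _; set b := block p k _.
  have [yb|yb] := boolP (y \in b).
    rewrite mul0r mulr0 scale0r scaler0.
    case: eqP => [bS|_]; last by rewrite scale0r mulr0 scaler0.
    by move: yb; rewrite bS !inE eqxx.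
  have -> : (y |: b == S) = (b == S :\ y).
    apply/eqP/eqP => [<-|->]; first by rewrite finset.setU1K.
    by rewrite finset.setD1K.
  case: eqP => [bS|_]; last by rewrite !scale0r mulr0 scaler0.
  rewrite !scale1r mul1r bS -!scalerAr scalerA [q ^+ _ * w]mulrC [X y * m]mulrC.
  congr ((w * q ^+ #|pred_of_set _|) *: _); apply/setP => z; rewrite !inE.
  by case: eqVneq => [->|//]; rewrite ltnn !andbF.
have SE y : y \in S -> (#|S :\ y| == k) = (#|S| == k.+1).
  by move=> yS; rewrite (cardsD1 y S) yS.
under [LHS]eq_bigr => y yS.
  rewrite -scaler_sumr -mulr_sumr IH //; last by move=> j jp; apply: ep; lia.
  rewrite -scalerAr mulrCA -(big_setD1 y yS) scalerA mulrC (SE _ yS).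
  over.
rewrite -scaler_suml -mulr_sumr sum_rank; case: eqP => [->|_]; last by rewrite !mul0r.
by rewrite /qfact big_ord_recr mulrA.
Qed.

Lemma csum_clique p k e : hess (p + k)%N e ->
    (forall j, (p <= j < p + k)%N -> e j = p) ->
  csum (p + k)%N e = csum p e * (qfact q k *: elsym k).
Proof.
move=> he ep; rewrite /elsym scaler_sumr mulr_sumr [RHS]big_mkcond /=.
rewrite [RHS](eq_bigr (fun S : {set 'I_K} => \sum_(c : {ffun 'I_(p + k)%N -> 'I_K})
     (block p k (word c) == S)%:R *:
       (weight (color_weight q) (p + k)%N e (word c) *: wmon (p + k)%N (word c)))).
  rewrite exchange_big /=; apply: eq_bigr => c _.
  rewrite (bigD1 (block p k (word c))) //= eqxx scale1r big1 ?addr0 // => S.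
  by rewrite eq_sym => /negPf->; rewrite scale0r.
move=> S _; rewrite csum_block //; case: eqP => _; last by rewrite mul0r scale0r.
by rewrite mul1r scalerAr.
Qed.
End CliqueColorings.

Section CliqueColumns.
Variables (R : fieldType) (q : R).
Hypothesis q_neq0 : q != 0.
Hypothesis q_pow_neq1 : forall k, q ^+ k.+1 != 1.

Definition col_num t : R := if t == 0%N then 1 else qnum q t.

(** When the earlier vertices of a clique occupy the columns [0, ..., t - 1], the next one must go
    to column [t]: smaller columns are taken and larger ones are not reachable. At [g = t > 0] the
    factors telescope to $[t]_q$. At [t = 0] the product is empty, whence the special value of
    [col_num]. *)
Lemma column_weight_iota t g :
  column_weight q (iota 0 t) g = if g == t then col_num t else 0.
Proof.
case: eqP => [->{g}|/eqP gt]; last first.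
  have [tg|tg|gE] := ltngtP g t; last by rewrite gE eqxx in gt.
    by apply: column_weight_mem; rewrite mem_iota.
  rewrite /column_weight /reachable mem_iota /= add0n.
  by rewrite (_ : _ || _ = false) ?mul0r //; lia.
rewrite /column_weight /col_num; case: t => [|t].
  by rewrite big_nil mulr1.
have -> : reachable (iota 0 t.+1) t.+1 by rewrite /reachable /= -[_ :: _]/(iota 0 t.+1) mem_iota /= add0n.
rewrite mul1r.
rewrite -addn1 iotaD big_cat big_seq1 /= add0n addn1 column_factorS mulr1.
have tele m : (m <= t)%N -> \prod_(x <- iota 0 m) column_factor q t.+1 x =
    q ^+ m * (q ^+ t.+1 - 1) / (q ^+ t.+1 - q ^+ m).
  elim: m => [|m IH] mt.
    by rewrite big_nil expr0 mul1r divff // subr_eq0.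
  rewrite -addn1 iotaD big_cat big_seq1 /= add0n IH 1?ltnW // addn1.
  rewrite column_factorE ?eqSS ?gtn_eqF // (exprS q m).
  field; rewrite -?exprS !qpow_sub_neq0 //; lia.
rewrite tele // [q ^+ t.+1 - 1]subrX1 -/(qnum q t.+1).
have q1 : q - 1 != 0 by rewrite subr_eq0; exact: (q_pow_neq1 0).
rewrite exprS -[X in _ * q ^+ t - X]mul1r -mulrBl; field.
by rewrite q1 expf_neq0.
Qed.

Variables (n : nat) (e : nat -> nat).
Hypothesis he : hess n e.
Hypothesis idem : idempotent_on n e.

Lemma clique_column_unique x : weight (column_weight q) n e x != 0 ->
  forall j, (j < n)%N -> x j = (j - e j)%N.
Proof.
move=> wx j; have [m] := ubnP j; elim: m j => // m IH j jm jn.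
move: wx; rewrite /weight => /prodf_neq0/(_ (Ordinal jn) isT) /=.
rewrite (_ : lower e x j = iota 0 (j - e j)%N) ?column_weight_iota.
  by case: (x j =P _) => [-> //|_]; rewrite eqxx.
rewrite /lower -[RHS]map_id /index_iota -{1}[e j]addn0 iotaDl -map_comp.
apply/eq_in_map => i; rewrite mem_iota /= add0n => ij.
have ele := proj1 he j jn.
by rewrite IH ?(idempotent_block he idem jn) ?addKn //; lia.
Qed.

Lemma clique_column_weight x : (forall j, (j < n)%N -> x j = (j - e j)%N) ->
  weight (column_weight q) n e x = \prod_(j < n) col_num (j - e j)%N.
Proof.
move=> xE; apply: eq_bigr => j _; have jn := ltn_ord j.
rewrite (_ : lower e x j = iota 0 (j - e j)%N) ?column_weight_iota ?xE ?eqxx //.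
rewrite /lower -[RHS]map_id /index_iota -{1}[e j]addn0 iotaDl -map_comp.
apply/eq_in_map => i; rewrite mem_iota /= add0n => ij.
have ele := proj1 he j jn.
by rewrite xE ?(idempotent_block he idem jn) ?addKn //; lia.
Qed.
End CliqueColumns.

Definition letter_count n K (c : {ffun 'I_n -> 'I_K}) (t : nat) : nat :=
  #|[set i | c i == t :> nat]|.

Section PathProduct.
Variables (A : comPzRingType) (P : nat -> A) (n K : nat).

(* The word of columns [c] decomposes into directed paths visiting the columns
   0, 1, 2, ... in turn; [letter_count c t - letter_count c t.+1] is the number
   of those of length [t.+1]. *)
Definition path_prod (c : {ffun 'I_n -> 'I_K}) : A :=
  \prod_(t < K) P t.+1 ^+ (letter_count c t - letter_count c t.+1).

Lemma path_prod_sym (c : {ffun 'I_n -> 'I_K}) u v :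
  path_prod [ffun i => c (tperm u v i)] = path_prod c.
Proof.
have cntE t : letter_count [ffun i => c (tperm u v i)] t = letter_count c t.
  rewrite /letter_count -[RHS](on_card_preimset (f := tperm u v)).
    by apply: eq_card => i; rewrite !inE ffunE.
  by apply: onW_bij; exists (tperm u v) => i; rewrite tpermK.
by apply: eq_bigr => t _; rewrite !cntE.
Qed.

(** If the letter counts are the column lengths of a diagram with row lengths [bs], the exponent of
    [P t.+1] is the number of rows of length [t.+1]. For other words the subtraction may be
    truncated, but the column sums give weight 0 to every word that is not good. *)
Lemma path_prodE (c : {ffun 'I_n -> 'I_K}) bs : 0%N \notin bs ->
    (forall t, letter_count c t = count (fun b => t < b)%N bs) ->
  path_prod c = \prod_(b <- bs) P b.
Proof.
move=> bs0 cnt; have bsK b : b \in bs -> (b <= K)%N.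
  move=> bbs; rewrite leqNgt; apply/negP => Kb.
  have : (0 < count (fun b => K < b)%N bs)%N by rewrite -has_count; apply/hasP; exists b.
  rewrite -cnt /letter_count (eq_card0 (_ : _ =i pred0)) // => i.
  by rewrite !inE; apply/negbTE; rewrite neq_ltn ltn_ord.
transitivity (\prod_(b <- bs) \prod_(t < K) P t.+1 ^+ (b == t.+1)).
  rewrite exchange_big /=; apply: eq_bigr => t _; rewrite prodrXr; congr (_ ^+ _).
  rewrite !cnt; have -> : count (fun b => t < b)%N bs =
      (count (fun b => t.+1 < b)%N bs + \sum_(b <- bs) (b == t.+1))%N.
    elim: (bs) => [|b bs' IH]; rewrite ?big_nil //= big_cons IH.
    rewrite leq_eqVlt [b == _]eq_sym; case: (t.+1 =P b) => [<-|_] /=; last by rewrite add0n addnA.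
    by rewrite ltnn add0n addnCA.
  by rewrite addKn.
apply: eq_big_seq => b bbs; have b_gt0 : (0 < b)%N.
  by rewrite lt0n; apply: contraNneq bs0 => <-.
have bK : (b.-1 < K)%N by rewrite prednK // bsK.
rewrite (bigD1 (Ordinal bK)) //= prednK // eqxx expr1 big1 ?mulr1 // => t tb.
case: eqP => // bt; case/eqP: tb; apply/val_inj; by rewrite /= bt.
Qed.
End PathProduct.

Section Cliques.
Variables (R : fieldType) (q : R).
Hypothesis q_neq0 : q != 0.
Hypothesis q_pow_neq1 : forall k, q ^+ k.+1 != 1.
Variables (A : comAlgType R) (K : nat) (X : nat -> A).

Definition path_poly b : A := qnum q b *: elsym K X b.

(** The list [bs] holds the sizes of the cliques. A clique of size [b] yields $[b]_q!\,e_b$: for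
    colorings by [csum_clique]; for columns, its vertices yield $[1]_q\cdots[b-1]_q$ and [path_poly]
    supplies $[b]_q e_b$. The last fact says that the only word of nonzero weight has row lengths
    [bs]. *)
Lemma clique_blocks n e : hess n e -> idempotent_on n e ->
  exists bs, [/\ 0%N \notin bs,
    csum q K X n e = \prod_(b <- bs) (qfact q b *: elsym K X b),
    (\prod_(j < n) col_num q (j - e j)%N) *: \prod_(b <- bs) path_poly b =
      \prod_(b <- bs) (qfact q b *: elsym K X b) &
    forall t, count (fun j => j - e j == t)%N (iota 0 n) =
              count (fun b => t < b)%N bs].
Proof.
have [m] := ubnP n; elim: m n => // m IH [|n] nm he idem.
  exists [::]; split=> //; rewrite ?big_nil ?big_ord0 ?scale1r //.
  rewrite /csum (eq_bigr (fun=> 1)) => [|c _].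
    by rewrite sumr_const card_ffun !card_ord expn0.
  by rewrite /weight /wmon !big_ord0 scale1r.
set p := e n; set k := (n.+1 - p)%N.
have pn : (p <= n)%N by apply: (proj1 he).
have nE : n.+1 = (p + k)%N by rewrite subnKC // leqW.
have k_gt0 : (0 < k)%N by rewrite subn_gt0 ltnS.
have ep j : (p <= j < p + k)%N -> e j = p.
  by rewrite -nE ltnS => /(idempotent_block he idem (ltnSn n)).
have hep : hess p e by apply: hessW he; exact: leqW.
have idp : idempotent_on p e by move=> j jp; apply: idem; apply: leq_trans jp _; exact: leqW.
have [|bs [bs0 cs col cnt]] := IH p _ hep idp; first lia.
rewrite nE in he *; exists (k :: bs); split.
- by rewrite inE negb_or bs0 andbT eq_sym -lt0n.
- by rewrite csum_clique // cs big_cons mulrC.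
- rewrite !big_cons -col big_split_ord /= -scalerAr -scalerAl -scalerAl !scalerA.
  rewrite -mulrA; congr ((_ * _) *: _).
  have -> : \prod_(i < k) col_num q (p + i - e (p + i))%N = \prod_(i < k) col_num q i.
    by apply: eq_bigr => i _; rewrite ep ?addKn //; have := ltn_ord i; lia.
  rewrite /qfact; case: (k) k_gt0 => // k' _.
  by rewrite big_ord_recl big_ord_recr /= /col_num eqxx mul1r.
- move=> t; rewrite iotaD count_cat cnt /= addnC; congr (_ + _)%N.
  rewrite add0n -[p in iota p k]addn0 iotaDl count_map.
  rewrite (eq_in_count (a2 := pred1 t)) => [|i]; last first.
    by rewrite mem_iota add0n /= => ik; rewrite ep ?addKn; lia.
  by rewrite count_uniq_mem ?iota_uniq // mem_iota.
Qed.

Lemma clique_column_sum n e : hess n e -> idempotent_on n e ->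
  wsum (column_weight q) (@path_prod A path_poly n n) e = csum q K X n e.
Proof.
move=> he idem; have [bs [bs0 -> <- cnt]] := clique_blocks he idem.
have jn (j : 'I_n) : (j - e j < n)%N by apply: leq_ltn_trans (ltn_ord j); exact: leq_subr.
pose c0 : {ffun 'I_n -> 'I_n} := [ffun j => Ordinal (jn j)].
have c0E j : (j < n)%N -> word c0 j = (j - e j)%N.
  by move=> ltj; rewrite (wordE c0 (Ordinal ltj)) ffunE.
rewrite /wsum (bigD1 c0) //= big1 ?addr0 => [|c cc0].
  rewrite (clique_column_weight q_neq0 q_pow_neq1 he idem c0E); congr (_ *: _).
  apply: path_prodE => // t; rewrite -cnt -val_enum_ord count_map.
  rewrite /letter_count -sum1dep_card -sum1_count big_enum_cond /=.
  by apply: eq_bigl => i; rewrite ffunE.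
have [->|wx] := eqVneq (weight (column_weight q) n e (word c)) 0; first by rewrite scale0r.
case/eqP: cc0; apply/ffunP => j; apply/ord_inj; rewrite -(wordE c) ffunE.
exact: (clique_column_unique q_neq0 q_pow_neq1 he idem wx).
Qed.

Lemma wmon_sym n (c : {ffun 'I_n -> 'I_K}) u v :
  wmon X n (word [ffun i => c (tperm u v i)]) = wmon X n (word c).
Proof.
have tK : {on predT, bijective (tperm u v)}.
  by apply: onW_bij; exists (tperm u v) => i; rewrite tpermK.
rewrite /wmon [RHS](reindex (tperm u v)) //; apply: eq_bigr => i _.
by rewrite !wordE ffunE.
Qed.

Hypothesis two_neq0 : 2 != 0 :> R.

(* Both sides satisfy the modular laws and agree on unions of cliques. *)
Theorem column_sum_csum n e : hess n e ->
  wsum (column_weight q) (@path_prod A path_poly n n) e = csum q K X n e.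
Proof.
move=> he; apply/eqP; rewrite -subr_eq0; apply/eqP.
pose Z1 := wsum (column_weight q) (@path_prod A path_poly n n).
pose Z2 := wsum (color_weight q) (fun c : {ffun 'I_n -> 'I_K} => wmon X n (word c)).
have A1 : modular_law_A q n Z1.
  apply: wsum_modular_A => //; [exact: column_weight_perm|exact: column_weight_mem|
    by move=> *; exact: column_weight_A|by move=> *; exact: path_prod_sym].
have B1 : modular_law_B q n Z1.
  apply: wsum_modular_B => //; [exact: column_weight_perm|exact: column_weight_mem|
    by move=> *; exact: column_weight_B|by move=> *; exact: path_prod_sym].
have A2 : modular_law_A q n Z2.
  apply: wsum_modular_A => //; [exact: color_weight_perm|exact: color_weight_mem|
    by move=> *; exact: color_weight_A|by move=> *; exact: wmon_sym].
have B2 : modular_law_B q n Z2.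
  apply: wsum_modular_B => //; [exact: color_weight_perm|exact: color_weight_mem|
    by move=> *; exact: color_weight_B|by move=> *; exact: wmon_sym].
apply: (@hess_vanish _ _ q n q_neq0 q_pow_neq1 (fun e => Z1 e - Z2 e)) he.
- by move=> e1 e2 ee; rewrite /Z1 /Z2 !(wsum_ext _ _ ee).
- move=> e' i a *; rewrite scalerBr A1 ?A2 // scalerBr opprD -!addrA; congr (_ + _).
  by rewrite addrCA.
- move=> e' u a *; rewrite scalerBr B1 ?B2 // scalerBr opprD -!addrA; congr (_ + _).
  by rewrite addrCA.
- move=> e' he' nb; apply/eqP; rewrite subr_eq0; apply/eqP.
  by apply: clique_column_sum => //; exact: not_bad_idempotent.
Qed.
End Cliques.

(** * Tableaux as words of columns *)

Section Tableau_words.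
Variables (n : nat) (e : 'I_n -> 'I_n).
Hypothesis he : reverse_hessenberg e.
Implicit Types (c : {ffun 'I_n -> 'I_n}) (T : {ffun 'I_n -> 'I_n * 'I_n}).

Definition proper_word c := [forall i, forall j, prec e i j ==> (c i != c j)].

Definition linked_word c :=
  [forall i, (0 < c i)%N ==> [exists j, (c i == (c j).+1 :> nat) && prec e j i]].

Definition good_word c := proper_word c && linked_word c.

Lemma precE i j : prec e i j = (e j <= i < j)%N.
Proof. by rewrite /prec !ltnS. Qed.

(** The entries preceding [k] are pairwise related by [prec]. This reduces the horizontal strip
    condition to a condition on pairs, [proper_word]. *)
Lemma prec_clique i j k : prec e i k -> prec e j k -> (i < j)%N -> prec e i j.
Proof.
rewrite !precE => /andP[ki ik] /andP[kj jk] ij; rewrite ij andbT.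
by apply: leq_trans ki; apply: (proj1 he); exact: ltnW.
Qed.

Definition count_before c (i t : nat) : nat := #|[set j : 'I_n | (j < i)%N & c j == t :> nat]|.

Lemma count_before_n c t : count_before c n t = letter_count c t.
Proof. by apply: eq_card => j; rewrite !inE ltn_ord. Qed.

Lemma count_before_mono c i i' t : (i <= i')%N -> (count_before c i t <= count_before c i' t)%N.
Proof.
move=> ii; apply: subset_leq_card; apply/fintype.subsetP => j; rewrite !inE => /andP[ji ->].
by rewrite (leq_trans ji).
Qed.

Lemma count_beforeS c (i : 'I_n) : count_before c i.+1 (c i) = (count_before c i (c i)).+1.
Proof.
rewrite /count_before (cardsD1 i) !inE ltnSn eqxx; congr (_.+1); apply: eq_card => j.
by rewrite !inE ltnS [in RHS]ltn_neqAle andbA.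
Qed.

(** Each entry of column [s.+1] is sent to an earlier entry of column [s] linked to it. Two entries
    [j < k] of one column cannot have the same image: it precedes [k] and is smaller than [j], so
    [prec e j k], against properness. *)
Lemma good_word_lattice c i t t' : good_word c -> (t <= t')%N ->
  (count_before c i t' <= count_before c i t)%N.
Proof.
case/andP=> /forallP prop /forallP link.
suff step s : (count_before c i s.+1 <= count_before c i s)%N.
  move=> tt; rewrite -(subnKC tt); elim: (t' - t)%N => [|k IH]; first by rewrite addn0.
  by rewrite addnS (leq_trans (step _)).
pose f (j : 'I_n) := odflt j [pick k | (c j == (c k).+1 :> nat) && prec e k j].
have fP (j : 'I_n) : c j = s.+1 :> nat -> c (f j) = s :> nat /\ prec e (f j) j.
  move=> cj; rewrite /f; case: pickP => [k /andP[/eqP ck kj]|no] /=.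
    by split=> //; move: ck; rewrite cj => -[].
  by have := link j; rewrite {1}cj => /existsP[k]; rewrite no.
rewrite /count_before -(card_in_imset (f := f)).
  apply: subset_leq_card; apply/fintype.subsetP => k /imsetP[j]; rewrite inE => /andP[ji /eqP cj] ->.
  have [fs fj] := fP j cj; rewrite inE fs eqxx andbT; apply: leq_ltn_trans ji; apply: ltnW.
  by move: fj; rewrite precE => /andP[].
suff inj (j k : 'I_n) : c j = s.+1 :> nat -> c k = s.+1 :> nat -> f j = f k -> ~~ (j < k)%N.
  move=> j k; rewrite !inE => /andP[_ /eqP cj] /andP[_ /eqP ck] fjk.
  apply/ord_inj; have [jk|kj|//] := ltngtP j k.
    by have := inj j k cj ck fjk; rewrite jk.
  by have := inj k j ck cj (esym fjk); rewrite kj.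
move=> cj ck fjk; apply/negP => jk.
have [_ fj] := fP j cj; have [_ fk] := fP k ck; rewrite -fjk in fk.
have : prec e j k.
  rewrite precE jk andbT; move: fj fk; rewrite !precE => /andP[_ lt] /andP[le _].
  by rewrite (leq_trans le) // ltnW.
by move/forallP: (prop j) => /(_ k)/implyP pj /pj/eqP[]; apply/ord_inj; rewrite cj ck.
Qed.

Lemma good_word_letter_count c t t' : good_word c -> (t <= t')%N ->
  (letter_count c t' <= letter_count c t)%N.
Proof. by move=> gc tt; rewrite -!count_before_n good_word_lattice. Qed.

Lemma card_ord_lt (k : nat) : (k <= n)%N -> #|[set i : 'I_n | (i < k)%N]| = k.
Proof.
by move=> kn; rewrite -sum1dep_card -(big_ord_widen n (fun=> 1%N)) // sum1_card card_ord.
Qed.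

Lemma card_downset (P : pred 'I_n) : (forall i j : 'I_n, (i <= j)%N -> P j -> P i) ->
  forall t : 'I_n, (t < #|[set i | P i]|)%N = P t.
Proof.
move=> down t; apply/idP/idP => [|Pt].
  apply: contraTT => nPt; rewrite -leqNgt -[X in (_ <= X)%N](card_ord_lt (ltnW (ltn_ord t))).
  apply: subset_leq_card; apply/fintype.subsetP => i; rewrite !inE ltnNge => Pi.
  by apply: contra nPt => ti; exact: down Pi.
rewrite -[X in (X <= _)%N](card_ord_lt (ltn_ord t)); apply: subset_leq_card.
by apply/fintype.subsetP => i; rewrite !inE ltnS => it; exact: down Pt.
Qed.

Lemma count_before_lt c (i : 'I_n) t : (count_before c i t < n)%N.
Proof.
apply: leq_ltn_trans (ltn_ord i); rewrite -[X in (_ <= X)%N](card_ord_lt (ltnW (ltn_ord i))).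
by apply: subset_leq_card; apply/fintype.subsetP => j; rewrite !inE => /andP[].
Qed.

(** Entries increase up each column, so the row of [i] has to be the number of smaller entries in
    its column. *)
Definition tableau c : {ffun 'I_n -> 'I_n * 'I_n} :=
  [ffun i => (Ordinal (count_before_lt c i (c i)), c i)].

(** The conjugate of the sequence of column lengths. *)
Definition shape c : seq nat :=
  [seq #|[set t : 'I_n | (r < letter_count c t)%N]| | r <- iota 0 (letter_count c 0)].

Definition columns T : {ffun 'I_n -> 'I_n} := [ffun i => (T i).2].

Lemma trow_tableau c i : trow (tableau c) i = count_before c i (c i).
Proof. by rewrite /trow ffunE. Qed.

Lemma tcol_tableau c i : tcol (tableau c) i = c i.
Proof. by rewrite /tcol ffunE. Qed.

Lemma columns_tableau c : columns (tableau c) = c.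
Proof. by apply/ffunP => i; rewrite !ffunE. Qed.

Lemma letter_count_le c t : (letter_count c t <= n)%N.
Proof. by rewrite -[X in (_ <= X)%N]card_ord max_card. Qed.

Lemma nth_shape c r (t : 'I_n) : good_word c ->
  (t < nth 0 (shape c) r)%N = (r < letter_count c t)%N.
Proof.
move=> gc; case: (ltnP r (letter_count c 0)) => r0; last first.
  rewrite nth_default ?size_map ?size_iota // ltn0; apply/esym/negbTE; rewrite -leqNgt.
  by apply: leq_trans r0; exact: good_word_letter_count.
rewrite (nth_map 0%N) ?size_iota // nth_iota // add0n.
apply: (card_downset (P := fun t : 'I_n => r < letter_count c t)%N) => i j ij.
by move/leq_trans; apply; exact: good_word_letter_count.
Qed.

Lemma sum_letter_count c : (\sum_(t < n) letter_count c t = n)%N.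
Proof.
rewrite -[RHS]card_ord -sum1_card [RHS](partition_big c predT) //=.
apply: eq_bigr => t _; rewrite /letter_count -sum1dep_card.
by apply: eq_bigl => i; rewrite val_eqE.
Qed.

Lemma shape_partition c : good_word c -> is_partition n (shape c).
Proof.
move=> gc; apply/and3P; split.
- apply/(sortedP 0%N) => r; rewrite size_map size_iota => r1.
  rewrite !(nth_map 0%N) ?size_iota ?(ltnW r1) // !nth_iota ?(ltnW r1) // !add0n.
  by apply: subset_leq_card; apply/fintype.subsetP => t; rewrite !inE => /ltnW.
- apply/mapP => -[r]; rewrite mem_iota add0n /= => r0.
  have n0 : (0 < n)%N by apply: leq_trans (letter_count_le c 0); exact: leq_ltn_trans r0.
  by move/esym/eqP; rewrite cards_eq0 => /eqP/setP/(_ (Ordinal n0)); rewrite !inE r0.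
- rewrite sumnE big_map; apply/eqP; rewrite -[RHS](sum_letter_count c).
  under eq_bigr do rewrite -sum1dep_card big_mkcond.
  rewrite exchange_big /=; apply: eq_bigr => t _.
  rewrite -big_mkcond -[letter_count c 0]subn0 -/(index_iota 0 _) big_mkord.
  rewrite -(big_ord_widen _ (fun=> 1%N)) ?sum1_card ?card_ord //.
  exact: good_word_letter_count.
Qed.

Lemma count_before_lt_row c (i j : 'I_n) : c i = c j -> (i < j)%N ->
  (count_before c i (c i) < count_before c j (c j))%N.
Proof. by move=> cij ij; rewrite -count_beforeS cij; exact: count_before_mono. Qed.

Lemma tableau_inj c : injective (tableau c).
Proof.
move=> i j /[dup] /(congr1 (fun x => val x.1)) + /(congr1 snd); rewrite !ffunE /= => rij cij.
apply/ord_inj; have [ij|ji|//] := ltngtP i j.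
  by have := count_before_lt_row cij ij; rewrite rij ltnn.
by have := count_before_lt_row (esym cij) ji; rewrite rij ltnn.
Qed.

Lemma tableau_filling c : good_word c -> is_filling (tableau c) (shape c).
Proof.
move=> gc; apply/andP; split; first by apply/injectiveP; exact: tableau_inj.
apply/forallP => -[r t] /=; rewrite nth_shape //; apply/eqP; apply/idP/idP.
  case/codomP => i; rewrite ffunE => -[-> ->] /=.
  by rewrite -count_beforeS -count_before_n count_before_mono.
move=> rt; pose S := [set i | c i == t]; pose row i := (tableau c i).1.
(* The entries of column [t] have distinct rows, all below the length of the column, and there are
   as many entries as rows; hence every such row is filled. *)
have rowS : row @: S = [set k : 'I_n | (k < letter_count c t)%N].
  apply/eqP; rewrite eqEcard; apply/andP; split.
    apply/fintype.subsetP => k /imsetP[i]; rewrite !inE => /eqP <- ->.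
    by rewrite /row ffunE /= -count_beforeS -count_before_n count_before_mono.
  rewrite card_ord_lt ?letter_count_le // card_in_imset => [|i j].
    by rewrite leq_eqVlt; apply/orP; left; apply/eqP; apply: eq_card => i; rewrite !inE; apply: val_eqE.
  rewrite !inE => /eqP ci /eqP cj rij; apply: (@tableau_inj c).
  by move: rij; rewrite /row !ffunE /= => ->; rewrite ci cj.
have : r \in row @: S by rewrite rowS inE.
case/imsetP => i; rewrite inE => /eqP ci ri; apply/codomP; exists i.
by rewrite ri /row ffunE /= ci.
Qed.

(** For rows: if, of two entries in one row, the one further right came first, then just after it
    its column would be longer than that of the other, against [good_word_lattice]. *)
Lemma tableau_SYT c : good_word c -> is_SYT (tableau c) (shape c).
Proof.
move=> gc; apply/and3P; split; first exact: tableau_filling.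
  apply/forallP => i; apply/forallP => j; apply/implyP.
  rewrite !trow_tableau !tcol_tableau => /andP[/eqP rij cij].
  rewrite ltnNge leq_eqVlt; apply/negP => /orP[/eqP/ord_inj ij|ji].
    by rewrite ij ltnn in cij.
  have := good_word_lattice j.+1 gc (ltnW cij); rewrite count_beforeS -rij ltnNge.
  by rewrite count_before_mono.
apply/forallP => i; apply/forallP => j; apply/implyP.
rewrite !trow_tableau !tcol_tableau => /andP[/eqP/ord_inj cij rij].
rewrite ltnNge leq_eqVlt; apply/negP => /orP[/eqP/ord_inj ij|ji].
  by rewrite ij ltnn in rij.
have := count_before_lt_row (esym cij) ji; move: rij; lia.
Qed.

Lemma tableau_SYTe_bar c : good_word c -> is_SYTe_bar (tableau c) e (shape c).
Proof.
move=> gc; have /andP[/forallP prop /forallP link] := gc.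
have {}prop i j : prec e i j -> c i != c j.
  by move=> ij; have /forallP/(_ j)/implyP := prop i; apply.
apply/andP; split; first (apply/andP; split; first exact: tableau_SYT).
  apply/forallP => i; apply/forallP => j; apply/forallP => k; apply/implyP.
  rewrite !tcol_tableau val_eqE => /and3P[/orP[ji|/eqP->] /orP[ki|/eqP->] jk].
  - have [jk'|kj|/ord_inj jk'] := ltngtP j k; last by rewrite jk' eqxx in jk.
      by apply: prop; exact: prec_clique ji ki jk'.
    by rewrite eq_sym; apply: prop; exact: prec_clique ki ji kj.
  - exact: prop.
  - by rewrite eq_sym; exact: prop.
  - by rewrite eqxx in jk.
apply/forallP => i; apply/implyP; rewrite tcol_tableau => ci.
have /implyP/(_ ci)/existsP[j cj] := link i.
by apply/existsP; exists j; rewrite !tcol_tableau.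
Qed.

Lemma nth_partition_mono lam r r' : sorted geq lam -> (r <= r')%N ->
  (nth 0 lam r' <= nth 0 lam r)%N.
Proof.
move=> so rr; case: (ltnP r' (size lam)) => r's; last by rewrite nth_default.
have tr : transitive geq by move=> x y z /= yx zy; exact: leq_trans zy yx.
by apply: (sorted_leq_nth tr leqnn 0%N so); rewrite ?inE ?(leq_ltn_trans rr).
Qed.

Lemma count_partition lam r t : sorted geq lam ->
  (r < count (fun b => t < b)%N lam)%N = (t < nth 0 lam r)%N.
Proof.
elim: lam r => [|b lam IH] r so /=; first by rewrite nth_nil !ltn0.
have so' : sorted geq lam by move: so => /path_sorted.
case: (ltnP t b) => tb; first by case: r => [|r]; rewrite ?add1n ?ltnS ?IH //= tb.
have nthb k : (nth 0 (b :: lam) k <= b)%N := nth_partition_mono so (leq0n k).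
rewrite add0n (_ : count _ _ = 0%N).
  by rewrite ltn0; apply/esym/negbTE; rewrite -leqNgt (leq_trans (nthb r)).
apply/eqP; rewrite -leqn0 leqNgt -has_count; apply/hasPn => x /(nthP 0%N)[k ks <-].
by rewrite -leqNgt (leq_trans (nthb k.+1)).
Qed.

Lemma leq_sumn (x : nat) (s : seq nat) : x \in s -> (x <= sumn s)%N.
Proof.
elim: s => //= y s IH; rewrite inE => /orP[/eqP->|/IH]; first exact: leq_addr.
by move/leq_trans; apply; exact: leq_addl.
Qed.

Lemma nth_partition_le lam r : is_partition n lam -> (nth 0 lam r <= n)%N.
Proof.
case/and3P => _ _ /eqP <-; case: (ltnP r (size lam)) => rs; last by rewrite nth_default.
by rewrite leq_sumn ?mem_nth.
Qed.

Lemma size_partition_le lam : is_partition n lam -> (size lam <= n)%N.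
Proof.
case/and3P => _ + /eqP <-; elim: lam => //= b lam IH; rewrite inE negb_or.
by case: b => //= b /IH lamn; rewrite addSn ltnS (leq_trans lamn) // leq_addl.
Qed.

Section From_tableau.
Variables (lam : seq nat) (T : {ffun 'I_n -> 'I_n * 'I_n}).
Hypotheses (lamP : is_partition n lam) (TP : is_SYTe_bar T e lam).

Let c := columns T.

Lemma tcol_columns i : tcol T i = c i.
Proof. by rewrite /tcol ffunE. Qed.

Lemma columns_good : good_word c.
Proof.
case/andP: TP => /andP[_ /forallP strip] /forallP bar; apply/andP; split.
  apply/forallP => i; apply/forallP => j; apply/implyP => ij.
  have /forallP/(_ i)/forallP/(_ j) := strip j.
  rewrite !tcol_columns /preceq ij eqxx orbT val_eqE /=.
  have -> /= : i != j by apply: contraTneq ij => ->; rewrite precE ltnn andbF.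
  by [].
apply/forallP => i; apply/implyP => ci.
have := bar i; rewrite tcol_columns ci => /existsP[j cj].
by apply/existsP; exists j; rewrite !tcol_columns in cj.
Qed.

Lemma columns_letter_count t : letter_count c t = count (fun b => t < b)%N lam.
Proof.
have /and3P[so lam0 /eqP sumlam] := lamP.
case/andP: TP => /andP[/andP[/andP[/injectiveP Tinj /forallP cod] _] _] _.
case: (ltnP t n) => tn; last first.
  rewrite /letter_count eq_card0 => [|i].
    apply/esym/eqP; rewrite -leqn0 leqNgt -has_count; apply/hasPn => b blam.
    by rewrite -leqNgt (leq_trans _ tn) // -sumlam leq_sumn.
  by rewrite !inE; apply/negbTE; rewrite neq_ltn (leq_trans (ltn_ord _)).
have cn : (count (fun b => t < b)%N lam <= n)%N.
  by rewrite (leq_trans (count_size _ _)) // size_partition_le.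
rewrite -(card_ord_lt cn) /letter_count -(card_in_imset (f := fun i => (T i).1)).
  apply: eq_card => r; rewrite inE count_partition //; apply/imsetP/idP => [[i]|tr].
    rewrite inE => /eqP ci ->; have /eqP := cod (T i); rewrite codom_f -ci ffunE.
    by move/esym.
  have /eqP := cod (r, Ordinal tn); rewrite /= tr => /codomP[i Ti].
  by exists i; rewrite ?inE ?ffunE -Ti.
move=> i j; rewrite !inE => /eqP ci /eqP cj rij; apply: Tinj.
rewrite [T i]surjective_pairing [T j]surjective_pairing rij; congr (_, _).
by apply/ord_inj; move: ci cj; rewrite !ffunE => -> ->.
Qed.

Lemma shape_columns : shape c = lam.
Proof.
have /and3P[so lam0 /eqP sumlam] := lamP.
have size0 : letter_count c 0 = size lam.
  rewrite columns_letter_count; apply/eqP; rewrite -all_count; apply/allP => b.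
  by rewrite lt0n; apply: contraTneq => ->.
apply: (@eq_from_nth _ 0%N); rewrite size_map size_iota // => r rs.
rewrite (nth_map 0%N) ?size_iota // nth_iota // add0n.
rewrite -[RHS]card_ord_lt ?nth_partition_le //; apply: eq_card => t.
by rewrite !inE columns_letter_count count_partition.
Qed.

Lemma tableau_columns : tableau c = T.
Proof.
have /and3P[so lam0 /eqP sumlam] := lamP.
case/andP: TP => /andP[/and3P[/andP[/injectiveP Tinj /forallP cod] rows cols] _] _.
have {}cols i j : c i = c j -> (trow T i < trow T j)%N -> (i < j)%N.
  move=> cij rij; have /forallP/(_ i)/forallP/(_ j)/implyP := cols; apply.
  by rewrite rij andbT !tcol_columns cij.
have inj i j : c i = c j -> trow T i = trow T j -> i = j.
  move=> cij rij; apply: Tinj; rewrite [T i]surjective_pairing [T j]surjective_pairing.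
  by congr (_, _); [exact: ord_inj|move: cij; rewrite !ffunE].
apply/ffunP => i; rewrite ffunE [T i]surjective_pairing; congr (_, _); last by rewrite ffunE.
apply/ord_inj; rewrite /= /count_before -[RHS](card_ord_lt (ltnW (ltn_ord _))).
rewrite -(card_in_imset (f := fun i => (T i).1)) => [|j k].
  apply: eq_card => r; rewrite inE; apply/imsetP/idP => [[j]|ri].
    rewrite inE => /andP[ji /eqP/ord_inj cj] ->; rewrite ltnNge leq_eqVlt.
    apply/negP => /orP[/eqP rij|rij].
      by move: ji; rewrite (inj i j) ?ltnn.
    by have := cols i j (esym cj) rij; rewrite ltnNge ltnW.
  have ri' : ((T i).2 < nth 0 lam r)%N.
    have /eqP := cod (T i); rewrite codom_f => /esym/leq_trans; apply.
    by apply: nth_partition_mono => //; exact: ltnW.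
  have /eqP := cod (r, (T i).2); rewrite /= ri' => /codomP[j Tj].
  exists j; last by rewrite -Tj.
  have cij : c j = c i by rewrite !ffunE -Tj.
  by rewrite inE cij eqxx andbT; apply: cols => //; rewrite /trow -Tj.
rewrite !inE => /andP[_ /eqP cj] /andP[_ /eqP ck] rjk; apply: inj; last by rewrite /trow rjk.
by apply/ord_inj; rewrite cj ck.
Qed.
End From_tableau.

Lemma sum_tableaux (V : nmodType) lam (G : ('I_n -> nat) -> V) : is_partition n lam ->
  \sum_(T : {ffun 'I_n -> 'I_n * 'I_n} | is_SYTe_bar T e lam) G (tcol T) =
  \sum_(c | good_word c && (shape c == lam)) G (fun i => c i).
Proof.
move=> lamP; rewrite (reindex_onto tableau columns) => [|T TP]; last exact: tableau_columns TP.
apply: eq_big => [c|c _].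
  rewrite columns_tableau eqxx andbT; apply/idP/andP => [cP|[gc /eqP <-]].
    have := columns_good cP; have := shape_columns lamP cP.
    by rewrite columns_tableau => -> ->; rewrite eqxx.
  exact: tableau_SYTe_bar.
by congr G; apply/funext => i; rewrite tcol_tableau.
Qed.
End Tableau_words.

(** * Formal series as polynomials in finitely many variables *)

Lemma fsbig_fin_image (R : nmodType) (I : finType) (J : choiceType) (P : pred I)
    (h : I -> J) (B : set J) (f : J -> R) : injective h ->
    (forall i, P i -> B (h i)) -> (forall j, B j -> exists2 i, P i & h i = j) ->
  \sum_(j \in B) f j = \sum_(i | P i) f (h i).
Proof.
move=> hinj hB Bh; rewrite (@fsbigE _ _ _ _ B [seq h i | i <- enum P]); first last.
- by move=> j /Bh[i Pi <-]; rewrite map_f // mem_enum.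
- by move=> j /mapP[i]; rewrite mem_enum => Pi ->; exact: hB.
- by rewrite map_inj_uniq ?enum_uniq.
rewrite big_map big_enum_cond /=; apply: eq_bigl => i; rewrite andb_idr // => Pi.
by apply/mem_set/hB.
Qed.

Definition lift_coloring (V : finType) K (k : {ffun V -> 'I_K}) : {ffun V -> nat} :=
  [ffun v => k v : nat].

Lemma coloring_monomialE (V : finType) (k : {ffun V -> nat}) i :
  coloring_monomial k i = #|[set v | k v == i]|.
Proof.
rewrite /coloring_monomial (big_morph (fun m : {cmonom nat} => m i) (cmM i) (cm1 i)).
by rewrite -sum1dep_card [RHS]big_mkcond; apply: eq_bigr => v _; rewrite cmU; case: eqP.
Qed.

(** Identities of series are checked one coefficient at a time, and the coefficient of [m] only
    involves the variables of [m]. This allows polynomials in [K] variables, with [K] depending on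
    [m]. *)
Definition in_vars K (m : {cmonom nat}) := forall i, m i != 0%N -> (i < K)%N.

Lemma in_vars_ex m : exists K, in_vars K m.
Proof.
exists (\max_(i <- finsupp m) i).+1 => i; rewrite cmE_neq0 => im.
by rewrite ltnS (big_rem i) //= leq_maxl.
Qed.

Lemma chromatic_fin (V : finType) (E lt : rel V) (R : comNzRingType) (q : R) K m :
    in_vars K m ->
  chromatic E lt q m =
  \sum_(k : {ffun V -> 'I_K} | proper_coloring E (lift_coloring k) &&
                               (coloring_monomial (lift_coloring k) == m))
     q ^+ asc E lt (lift_coloring k).
Proof.
move=> mK; apply: fsbig_fin_image => [k k' kk|k /andP[pk /eqP]|k [pk mk]] //.
  by apply/ffunP => v; apply/ord_inj; have /ffunP/(_ v) := kk; rewrite !ffunE.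
have kK v : (k v < K)%N.
  apply: mK; rewrite -mk coloring_monomialE cards_eq0; apply/set0Pn.
  by exists v; rewrite inE.
exists [ffun v => Ordinal (kK v)].
  have -> : lift_coloring [ffun v => Ordinal (kK v)] = k by apply/ffunP => v; rewrite !ffunE.
  by rewrite pk mk eqxx.
by apply/ffunP => v; rewrite !ffunE.
Qed.

Section Malg.
Variable R : fieldType.
Local Notation A := {malg R[{cmonom nat}]}.

Definition cvar (i : nat) : A := << ucm i >>.

Lemma cvar_prod (I : Type) (r : seq I) (P : pred I) (f : I -> nat) :
  \prod_(i <- r | P i) cvar (f i) = << \big[mmul/mone]_(i <- r | P i) ucm (f i) >>.
Proof.
elim/big_rec2: _ => [|i m x _ ->]; first by rewrite mpolyC1E.
by rewrite malgM_def fgmulUU mulr1.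
Qed.

Lemma mcoeffM_factorizations (a b : A) m :
  (a * b)@_m = \sum_(p \in factorizations m) a@_p.1 * b@_p.2.
Proof.
rewrite (mcoeffMlw m (fsubset_refl _) (fsubset_refl _)).
pose r := [seq p <- [seq (x, y) | x <- msupp a, y <- msupp b] | mmul p.1 p.2 == m].
rewrite (@fsbigE _ _ _ _ (factorizations m) r); first last.
- move=> [x y] /= xym; rewrite mem_filter /= xym eqxx /= => xyr.
  have [xa|xa] := boolP (x \in msupp a); last by rewrite mcoeff_outdom ?mul0r.
  have [yb|yb] := boolP (y \in msupp b); last by rewrite [X in _ * X]mcoeff_outdom ?mulr0.
  by rewrite allpairs_f in xyr.
- by move=> p; rewrite /= mem_filter => /andP[/eqP pm _].
- rewrite filter_uniq // allpairs_uniq ?fset_uniq //.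
  by move=> [x y] [x' y'].
rewrite big_filter_cond [RHS]big_mkcond big_allpairs_dep /=.
apply: eq_bigr => x _; apply: eq_bigr => y _ /=.
have -> : ((x, y) \in factorizations m) = (mmul x y == m).
  by apply/idP/eqP; rewrite in_setE.
by rewrite andbb; case: eqP.
Qed.

Definition subset_monomial K (S : {set 'I_K}) : {cmonom nat} :=
  \big[mmul/mone]_(i in S) ucm (i : nat).

Lemma subset_monomialE K (S : {set 'I_K}) (i : 'I_K) : subset_monomial S i = (i \in S).
Proof.
rewrite /subset_monomial (big_morph (fun m : {cmonom nat} => m i) (cmM (i : nat)) (cm1 (i : nat))).
rewrite (eq_bigr (fun j : 'I_K => (j == i : nat))) => [|j _]; last by rewrite cmU.
have [iS|iS] := boolP (i \in S).
  rewrite (bigD1 i) //= eqxx big1 ?addn0 // => j /andP[_ /negPf->] //.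
by rewrite big1 // => j jS; case: eqP => // ji; rewrite -ji jS in iS.
Qed.

Lemma subset_monomial_out K (S : {set 'I_K}) i : (K <= i)%N -> subset_monomial S i = 0%N.
Proof.
move=> Ki.
rewrite /subset_monomial (big_morph (fun m : {cmonom nat} => m i) (cmM i) (cm1 i)).
by rewrite big1 // => j _; rewrite cmU ltn_eqF // (leq_trans (ltn_ord j)).
Qed.

Lemma mdeg_subset_monomial K (S : {set 'I_K}) : mdeg (subset_monomial S) = #|S|.
Proof.
rewrite /subset_monomial mdeg_prod -sum1_card; apply: eq_bigr => i _; exact: mdegU.
Qed.

Lemma mcoeff_elsym K k m : in_vars K m -> (elsym K cvar k)@_m = elementary R k m.
Proof.
move=> mK; rewrite /elsym raddf_sum /=.
rewrite (eq_bigr (fun S => (subset_monomial S == m)%:R)) => [|S _]; last first.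
  by rewrite (cvar_prod _ _ (fun i : 'I_K => i : nat)) mcoeffU1.
have [sqf|nsqf] := boolP (all (fun i => m i <= 1)%N (finsupp m)); last first.
  rewrite /elementary (negPf nsqf) andbF big1 // => S _; case: eqP => // Sm.
  case/negP: nsqf; apply/allP => i _; rewrite -Sm.
  case: (ltnP i K) => iK; last by rewrite subset_monomial_out.
  by rewrite (subset_monomialE S (Ordinal iK)) leq_b1.
pose S0 := [set i : 'I_K | m i != 0%N].
have S0m : subset_monomial S0 = m.
  apply/eqP/cmP => i; case: (ltnP i K) => iK; last first.
    rewrite subset_monomial_out //; apply/esym/eqP; apply: contraTT iK => /mK.
    by rewrite -ltnNge.
  rewrite (subset_monomialE S0 (Ordinal iK)) inE /=.
  have := allP sqf i; rewrite -cmE_neq0; case: (m i) => [|[|k']] // /(_ isT).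
  by [].
have inj (S : {set 'I_K}) : (subset_monomial S == m) = (S == S0).
  apply/eqP/eqP => [Sm|->] //; apply/setP => i; rewrite inE -Sm subset_monomialE.
  by case: (i \in S).
rewrite /elementary sqf andbT -S0m mdeg_subset_monomial S0m.
rewrite (eq_bigr (fun S => (S == S0)%:R)) => [|S _]; last by rewrite inj.
have [S0k|S0k] := boolP (#|S0| == k).
  by rewrite (bigD1 S0) //= eqxx big1 ?addr0 // => S /andP[_ /negPf->].
by rewrite big1 // => S /eqP Sk; case: eqP => // SS0; rewrite -SS0 Sk eqxx in S0k.
Qed.

Lemma mcoeff_elementary_part K lam m : in_vars K m ->
  elementary_part R lam m = (\prod_(k <- lam) elsym K cvar k)@_m.
Proof.
elim: lam m => [|k lam IH] m mK; rewrite /elementary_part ?big_nil ?big_cons.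
  by rewrite mcoeff1.
rewrite mcoeffM_factorizations; apply: eq_fsbigr => -[a b]; rewrite in_setE /= => abm.
have [aK bK] : in_vars K a /\ in_vars K b.
  by split=> i i0; apply: mK; rewrite -abm cmM addn_eq0 negb_and i0 ?orbT.
by rewrite mcoeff_elsym // -IH.
Qed.
End Malg.

(** * The expansion of the chromatic quasisymmetric function *)

Definition hfun n (e : 'I_n -> 'I_n) : nat -> nat := word [ffun i => e i].

Section Hessenberg_weights.
Variables (n : nat) (e : 'I_n -> 'I_n).
Hypothesis he : reverse_hessenberg e.

Lemma hfunE (j : 'I_n) : hfun e j = e j.
Proof. by rewrite /hfun wordE ffunE. Qed.

Lemma hess_hfun : hess n (hfun e).
Proof.
split=> [j jn|i j ij jn]; first by rewrite (hfunE (Ordinal jn)) -ltnS (proj2 he).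
rewrite (hfunE (Ordinal jn)) (hfunE (Ordinal (leq_ltn_trans ij jn))).
exact: (proj1 he).
Qed.

Lemma mem_lower K (c : {ffun 'I_n -> 'I_K}) (j : 'I_n) x :
  (x \in lower (hfun e) (word c) j) = [exists i, prec e i j && (c i == x :> nat)].
Proof.
apply/mapP/existsP => [[i]|[i /andP[ij /eqP <-]]].
  rewrite mem_index_iota hfunE => ij ->.
  have i_n : (i < n)%N by case/andP: ij => _ /ltn_trans; apply.
  by exists (Ordinal i_n); rewrite precE /= ij /= (wordE c (Ordinal i_n)).
by exists (i : nat); rewrite ?wordE // mem_index_iota hfunE -precE.
Qed.

Lemma prod_lower (R : comPzRingType) K (c : {ffun 'I_n -> 'I_K}) (j : 'I_n) (f : nat -> R) :
  \prod_(x <- lower (hfun e) (word c) j) f x = \prod_(i | prec e i j) f (c i).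
Proof.
rewrite /lower big_map.
rewrite [RHS](eq_bigr (fun i : 'I_n => f (word c i))) => [|i _]; last by rewrite wordE.
rewrite (eq_bigl (fun i : 'I_n => hfun e j <= i < j)%N) => [|i]; last by rewrite precE hfunE.
rewrite -(big_mkord (fun i => hfun e j <= i < j)%N (fun i => f (word c i))) -[RHS]big_filter.
apply: perm_big; apply: uniq_perm; rewrite ?filter_uniq ?iota_uniq // => i.
rewrite mem_filter !mem_index_iota /=; have := ltn_ord j; lia.
Qed.

Lemma prodb (R : comPzRingType) (I : finType) (b : I -> bool) :
  \prod_i ((b i)%:R : R) = [forall i, b i]%:R.
Proof.
have [/forallP ball|] := boolP [forall i, b i]; first by rewrite big1 // => i _; rewrite ball.
rewrite negb_forall => /existsP[i nbi]; rewrite (bigD1 i) //= (negPf nbi); exact: mul0r.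
Qed.

Lemma prod_prec (R : comPzRingType) (f : 'I_n -> 'I_n -> R) :
  \prod_j \prod_(i | prec e i j) f i j = \prod_(p : 'I_n * 'I_n | prec e p.1 p.2) f p.1 p.2.
Proof. by rewrite (exchange_big_dep predT) //= pair_big_dep. Qed.

Lemma weight_column (R : fieldType) (q : R) (c : {ffun 'I_n -> 'I_n}) :
  weight (column_weight q) n (hfun e) (word c) = (linked_word e c)%:R *
    \prod_(p : 'I_n * 'I_n | prec e p.1 p.2) column_factor q (c p.2) (c p.1).
Proof.
rewrite /weight /column_weight big_split /= prodb; congr ((nat_of_bool _)%:R * _).
  apply: eq_forallb => j; rewrite wordE /reachable mem_lower.
  case: (c j : nat) => //= k; apply: eq_existsb => i.
  by rewrite andbC eqSS eq_sym.
rewrite -(prod_prec (fun i j => column_factor q (c j) (c i))).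
by apply: eq_bigr => j _; rewrite prod_lower wordE.
Qed.

Definition links (c : {ffun 'I_n -> 'I_n}) : {set 'I_n * 'I_n} :=
  [set p | prec e p.1 p.2 && (c p.2 == (c p.1).+1 :> nat)].

Definition nonlinks (c : {ffun 'I_n -> 'I_n}) : {set 'I_n * 'I_n} :=
  [set p | prec e p.1 p.2 && (c p.2 != (c p.1).+1 :> nat)].

Lemma weight_column_nonlinks (R : fieldType) (q : R) (c : {ffun 'I_n -> 'I_n}) :
  weight (column_weight q) n (hfun e) (word c) = (linked_word e c)%:R *
    (q ^+ #|nonlinks c| *
     \prod_(p : 'I_n * 'I_n | prec e p.1 p.2 && (c p.2 != (c p.1).+1 :> nat))
       ((q ^+ c p.2 - q ^+ c p.1) / (q ^+ c p.2 - q ^+ (c p.1).+1))).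
Proof.
rewrite weight_column (bigID (fun p : 'I_n * 'I_n => c p.2 == (c p.1).+1 :> nat)) /=.
rewrite big1 ?mul1r => [|p /andP[_ /eqP->]]; last exact: column_factorS.
congr (_ * _); rewrite -prodr_const.
rewrite (eq_bigl (fun p : 'I_n * 'I_n => p \in nonlinks c)) => [|p]; last by rewrite inE.
rewrite [X in _ = _ * X](eq_bigl (fun p : 'I_n * 'I_n => p \in nonlinks c)) => [|p]; last by rewrite inE.
rewrite -big_split /=; apply: eq_bigr => p; rewrite inE => /andP[_ /negPf pl].
by rewrite /column_factor pl mulrA.
Qed.

Lemma weight_column_good (R : fieldType) (q : R) (c : {ffun 'I_n -> 'I_n}) :
  ~~ good_word e c -> weight (column_weight q) n (hfun e) (word c) = 0.
Proof.
rewrite negb_and => /orP[|/negPf lk]; last by rewrite weight_column lk mul0r.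
rewrite negb_forall => /existsP[i]; rewrite negb_forall => /existsP[j].
rewrite negb_imply negbK => /andP[ij /eqP cij]; rewrite weight_column.
by rewrite (bigD1 (i, j)) ?ij //= cij column_factorD mul0r mulr0.
Qed.

(** Every entry outside the first column ends exactly one link: at least one as the word is linked,
    and not two, because two entries preceding the same one are related by [prec] and so lie in
    different columns. *)
Lemma card_links c : good_word e c -> (#|links c| + letter_count c 0 = n)%N.
Proof.
case/andP=> /forallP prop /forallP lk.
rewrite -[RHS]card_ord -[in RHS]cardsT -(cardsID [set i | (0 < c i)%N] [set: 'I_n]).
congr (_ + _)%N; last first.
  by apply: eq_card => i; rewrite !inE andbT lt0n negbK.
rewrite -(card_in_imset (f := snd)).
  apply: eq_card => j; rewrite !inE; apply/imsetP/idP => [[[i j'] ]|/= cj].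
    by rewrite inE /= => /andP[_ /eqP cj] ->; rewrite cj.
  have := lk j; rewrite cj => /existsP[i /andP[ci ij]].
  by exists (i, j); rewrite // inE /= ij ci.
suff inj (i k j : 'I_n) : (i, j) \in links c -> (k, j) \in links c -> ~~ (i < k)%N.
  move=> [i j] [k j'] ij kj /= jj; rewrite -jj in kj *; congr (_, _).
  have [ik|ki|/ord_inj//] := ltngtP i k.
    by have := inj i k j ij kj; rewrite ik.
  by have := inj k i j kj ij; rewrite ki.
rewrite !inE /= => /andP[ij /eqP cij] /andP[kj /eqP ckj]; apply/negP => ik.
have /forallP/(_ k)/implyP := prop i => /(_ (prec_clique he ij kj ik)).
by case/eqP; apply/ord_inj; move: ckj; rewrite cij => -[].
Qed.

Lemma card_prec : (#|[set p : 'I_n * 'I_n | prec e p.1 p.2]| + hess_weight e = 'C(n, 2))%N.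
Proof.
have -> : #|[set p : 'I_n * 'I_n | prec e p.1 p.2]| = (\sum_j \sum_(i | prec e i j) 1)%N.
  by rewrite -sum1dep_card (exchange_big_dep predT) //= pair_big_dep.
rewrite -bin2_sum big_mkord -big_split; apply: eq_bigr => j _ /=.
have ej : (e j <= j)%N by rewrite -ltnS (proj2 he).
rewrite sum1dep_card -[RHS](card_ord_lt (ltnW (ltn_ord j))) -[X in (_ + X)%N](card_ord_lt (ltnW (ltn_ord (e j)))).
rewrite -[RHS](cardsID [set i : 'I_n | (i < e j)%N]) addnC; congr (_ + _)%N.
  apply: eq_card => i; rewrite !inE andb_idl // => ie; exact: leq_trans ej.
by apply: eq_card => i; rewrite !inE precE leqNgt.
Qed.

(** This counts the factors [q] in the column weight. As [letter_count c 0] is the number of rows,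
    the count is the exponent $\binom n2-n-|\mathbf e|+\ell(\lambda)$. *)
Lemma card_nonlinks c : good_word e c ->
  (#|nonlinks c| + n + hess_weight e = 'C(n, 2) + letter_count c 0)%N.
Proof.
move=> gc; have := card_links gc; have := card_prec.
rewrite -(cardsID (links c) [set p : 'I_n * 'I_n | prec e p.1 p.2]).
have -> : #|[set p : 'I_n * 'I_n | prec e p.1 p.2] :&: links c| = #|links c|.
  by apply: eq_card => p; rewrite !inE; case: prec.
have -> : #|[set p : 'I_n * 'I_n | prec e p.1 p.2] :\: links c| = #|nonlinks c|.
  by apply: eq_card => p; rewrite !inE; case: prec; rewrite ?andbT ?andbF.
lia.
Qed.

Lemma letter_count_shape c t : good_word e c ->
  letter_count c t = count (fun b => t < b)%N (shape c).
Proof.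
move=> gc; have := columns_letter_count (shape_partition gc) (tableau_SYTe_bar he gc) t.
by rewrite columns_tableau.
Qed.

Lemma path_prod_shape (A : comPzRingType) (P : nat -> A) c : good_word e c ->
  path_prod P c = \prod_(b <- shape c) P b.
Proof.
move=> gc; apply: path_prodE => [|t]; last exact: letter_count_shape.
by case/and3P: (shape_partition gc).
Qed.
End Hessenberg_weights.

Section Main_identity.
Variables (F : fieldType) (q : F).
Hypothesis q_neq0 : q != 0.
Hypothesis q_pow_neq1 : forall k, q ^+ k.+1 != 1.
Hypothesis two_neq0 : 2 != 0 :> F.
Variables (n : nat) (e : 'I_n -> 'I_n).
Hypothesis he : reverse_hessenberg e.

Lemma chi_csum K m : in_vars K m ->
  chi e q m = (csum q K (cvar F) n (hfun e))@_m.
Proof.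
move=> mK; rewrite /chi (chromatic_fin _ _ _ mK) /csum raddf_sum big_mkcond /=.
apply: eq_bigr => c _; rewrite mcoeffZ /wmon.
rewrite (eq_bigr (fun i : 'I_n => cvar F (lift_coloring c i))) => [|i _]; last first.
  by rewrite wordE ffunE.
rewrite cvar_prod mcoeffU1 -/(coloring_monomial (lift_coloring c)).
case: eqP => [_|_]; last by rewrite andbF mulr0.
rewrite andbT mulr1.
have -> : weight (color_weight q) n (hfun e) (word c) =
    \prod_(p : 'I_n * 'I_n | prec e p.1 p.2) edge_weight q (c p.1) (c p.2).
  rewrite -(prod_prec e (fun i j => edge_weight q (c i) (c j))).
  by apply: eq_bigr => j _; rewrite /color_weight wordE (prod_lower e c j (fun x => edge_weight q x (c j))).
case: ifP => [/forallP prop|/negbT].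
  have pc (i j : 'I_n) : prec e i j -> c i != c j :> nat.
    move=> ij; have /forallP/(_ j)/implyP := prop i.
    by rewrite /unit_interval_graph ij !ffunE; apply.
  rewrite (bigID (fun p : 'I_n * 'I_n => c p.1 < c p.2)%N) /= [X in _ * X]big1 ?mulr1; last first.
    by move=> p /andP[/pc/negPf cp /negPf lp]; rewrite /edge_weight cp lp.
  rewrite (eq_bigr (fun=> q)) => [|p /andP[/pc/negPf cp lp]]; last by rewrite /edge_weight cp lp.
  rewrite prodr_const; congr (_ ^+ _); rewrite /asc; apply: eq_card => p; rewrite !inE !ffunE [RHS]unfold_in /=.
  rewrite /unit_interval_graph !precE; by case: ltngtP => //; rewrite ?andbT ?andbF // orbF.
rewrite /proper_coloring negb_forall => /existsP[i]; rewrite negb_forall => /existsP[j].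
rewrite negb_imply negbK !ffunE => /andP[/orP[ij|ij] /eqP cij].
  by rewrite (bigD1 (i, j)) ?ij //= /edge_weight cij eqxx mul0r.
by rewrite (bigD1 (j, i)) ?ij //= /edge_weight cij eqxx mul0r.
Qed.

Lemma e_coef_words lam : is_partition n lam ->
  q ^ (q_exponent e) * e_coef q e lam =
  \sum_(c | good_word e c && (shape c == lam))
    weight (column_weight q) n (hfun e) (word c) * \prod_(k <- lam) qnum q k.
Proof.
move=> lamP; rewrite /e_coef.
pose G (x : 'I_n -> nat) : F := \prod_(p : 'I_n * 'I_n | prec e p.1 p.2 && (x p.2 != (x p.1).+1))
      ((q ^+ x p.2 - q ^+ x p.1) / (q ^+ x p.2 - q ^+ (x p.1).+1)).
rewrite (sum_tableaux he G lamP) mulrA mulr_sumr; apply: eq_bigr => c /andP[gc /eqP clam].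
rewrite weight_column_nonlinks; have /andP[_ ->] := gc; rewrite mul1r.
have -> : \prod_(k <- lam) qint q k = \prod_(k <- lam) qnum q k.
  by apply: eq_bigr => k _; rewrite qnumE //; exact: (q_pow_neq1 0).
rewrite [RHS]mulrAC (mulrA (q ^ _)); congr (_ * _ * _).
rewrite 2!exprnP -expfzDr // /q_exponent.
congr (q ^ _); have := card_nonlinks he gc.
have -> : letter_count c 0 = size lam by rewrite -clam size_map size_iota.
lia.
Qed.

Theorem chi_expansion m :
  chi e q m = q ^ (q_exponent e) *
    \sum_(lam \in partitions n) e_coef q e lam * elementary_part F lam m.
Proof.
have [K mK] := in_vars_ex m; rewrite (chi_csum mK).
rewrite -(column_sum_csum q_neq0 q_pow_neq1 K (cvar F) two_neq0 (hess_hfun he)).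
rewrite mulr_fsumr (fsbig_finite _ _ (partitions_finite n)) /=.
rewrite big_seq (eq_bigr (fun lam => \sum_(c | good_word e c && (shape c == lam))
   (weight (column_weight q) n (hfun e) (word c) *: path_prod (path_poly q K (cvar F)) c)@_m)); last first.
  move=> lam; rewrite in_fset_set ?in_setE; last exact: partitions_finite.
  move=> /= lamP; rewrite mulrA e_coef_words // mulr_suml; apply: eq_bigr => c /andP[gc /eqP clam].
  rewrite mcoeffZ -mulrA; congr (_ * _); rewrite (path_prod_shape he) // clam /path_poly.
  by rewrite scaler_prod mcoeffZ -mcoeff_elementary_part.
rewrite -big_seq (exchange_big_dep (good_word e)) /=; last by move=> ? ? _ /andP[].
rewrite /wsum raddf_sum /= [RHS]big_mkcond; apply: eq_bigr => c _.
case: ifP => [gc|/negbT gc]; last by rewrite weight_column_good // scale0r mcoeff0.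
(* A good word has a single shape, so for each word only one partition remains in the exchanged
   sum. *)
rewrite -big_filter (_ : [seq _ <- _ | _] = [:: shape c]) ?big_seq1 //.
apply: perm_small_eq => //; apply: uniq_perm; rewrite ?filter_uniq ?fset_uniq // => lam.
rewrite mem_filter gc /= in_fset_set ?inE; last exact: partitions_finite.
by rewrite eq_sym andb_idr // => /eqP ->; rewrite in_setE; exact: (shape_partition gc).
Qed.
End Main_identity.

(** * Values at q = 1 *)

Section Values.
Variable a : rat.

Lemma tofrac_neq0 (p : {poly rat}) : p.[a] != 0 -> tofrac p != 0.
Proof. by move=> pa; rewrite tofrac_eq0; apply: contraNneq pa => ->; rewrite horner0. Qed.

Lemma has_value_poly (p : {poly rat}) : has_value_at (tofrac p) a p.[a].
Proof. by exists p, 1; rewrite hornerC oner_neq0 rmorph1 !divr1. Qed.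

Lemma has_value_unique f v v' : has_value_at f a v -> has_value_at f a v' -> v = v'.
Proof.
move=> [p [s [s0 -> ->]]] [p' [s' [s'0 E ->]]]; move/eqP: E.
rewrite eqr_div ?tofrac_neq0 // -!rmorphM tofrac_eq => /eqP/(congr1 (fun r => r.[a])).
by rewrite !hornerM => E; apply/eqP; rewrite eqr_div // E.
Qed.

Lemma has_valueD f g v w : has_value_at f a v -> has_value_at g a w ->
  has_value_at (f + g) a (v + w).
Proof.
move=> [p [s [s0 -> ->]]] [p' [s' [s'0 -> ->]]].
exists (p * s' + p' * s), (s * s'); rewrite hornerD !hornerM mulf_neq0 //; split=> //.
  by rewrite tofracD !tofracM addf_div // tofrac_neq0.
by rewrite addf_div.
Qed.

Lemma has_valueM f g v w : has_value_at f a v -> has_value_at g a w ->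
  has_value_at (f * g) a (v * w).
Proof.
move=> [p [s [s0 -> ->]]] [p' [s' [s'0 -> ->]]].
exists (p * p'), (s * s'); rewrite !hornerM mulf_neq0 //; split=> //.
  by rewrite !tofracM mulf_div.
by rewrite mulf_div.
Qed.

Lemma has_valueV f v : v != 0 -> has_value_at f a v -> has_value_at f^-1 a v^-1.
Proof.
move=> v0 [p [s [s0 -> vE]]]; exists s, p; rewrite vE !invf_div; split=> //.
by apply: contraNneq v0 => p0; rewrite vE p0 mul0r.
Qed.

Lemma has_value_nat n : has_value_at n%:R a n%:R.
Proof.
by have := has_value_poly n%:R; rewrite rmorph_nat hornerMn hornerC.
Qed.

Lemma has_valueN f v : has_value_at f a v -> has_value_at (- f) a (- v).
Proof.
move=> [p [s [s0 -> ->]]]; exists (- p), s.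
by rewrite tofracN hornerN !mulNr.
Qed.

Lemma has_value_sum (I : Type) (r : seq I) (P : pred I) (f : I -> ratfun) v :
  (forall i, P i -> has_value_at (f i) a (v i)) ->
  has_value_at (\sum_(i <- r | P i) f i) a (\sum_(i <- r | P i) v i).
Proof.
move=> fv; elim/big_rec2: _ => [|i x y /fv]; first exact: (has_value_nat 0).
by move=> hi hx; exact: has_valueD.
Qed.

Lemma has_value_prod (I : Type) (r : seq I) (P : pred I) (f : I -> ratfun) v :
  (forall i, P i -> has_value_at (f i) a (v i)) ->
  has_value_at (\prod_(i <- r | P i) f i) a (\prod_(i <- r | P i) v i).
Proof.
move=> fv; elim/big_rec2: _ => [|i x y /fv]; first exact: (has_value_nat 1).
by move=> hi hx; exact: has_valueM.
Qed.
End Values.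

Lemma qvar_neq0 : qvar != 0.
Proof. by rewrite tofrac_eq0 polyX_eq0. Qed.

Lemma qvar_pow_neq1 k : qvar ^+ k.+1 != 1.
Proof.
rewrite /qvar -rmorphXn -(rmorph1 (@tofrac {poly rat})) tofrac_eq.
apply/eqP => /(congr1 (fun p : {poly rat} => size p)).
by rewrite size_polyXn size_poly1.
Qed.

Lemma two_neq0_ratfun : 2 != 0 :> ratfun.
Proof.
rewrite -(rmorph_nat (@tofrac {poly rat})) tofrac_eq0 -polyC_natr polyC_eq0.
by rewrite pnatr_eq0.
Qed.

Lemma has_value_qvarX k : has_value_at (qvar ^+ k) 1 1.
Proof.
have := has_value_poly 1 'X^k; rewrite rmorphXn hornerXn expr1n.
by [].
Qed.

Lemma has_value_qvarXz z : has_value_at (qvar ^ z) 1 1.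
Proof.
case: z => k; first exact: has_value_qvarX.
have := has_valueV (oner_neq0 _) (has_value_qvarX k.+1); rewrite invr1.
by [].
Qed.

Lemma has_value_qnum k : has_value_at (qnum qvar k) 1 k%:R.
Proof.
rewrite -[k in k%:R]card_ord -sumr_const; apply: has_value_sum => i _.
exact: has_value_qvarX.
Qed.

(** Taking [qvar - 1] out of each difference lets it cancel from the quotients, whose numerators and
    denominators all vanish at 1. *)
Lemma qvar_sub a b : exists2 g, qvar ^+ a - qvar ^+ b = (qvar - 1) * g &
  has_value_at g 1 (a%:R - b%:R).
Proof.
wlog ba : a b / (b <= a)%N => [hw|].
  case: (leqP b a) => [|/ltnW] /hw // [g gE gv]; exists (- g).
    by rewrite mulrN -gE opprB.
  by rewrite -opprB; exact: has_valueN.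
exists (qvar ^+ b * qnum qvar (a - b)).
  by rewrite mulrCA -subrX1 mulrBr mulr1 -exprD subnKC.
rewrite -natrB // -[X in has_value_at _ _ X]mul1r.
by apply: has_valueM; [exact: has_value_qvarX|exact: has_value_qnum].
Qed.

(** For integers with $a\ne b+1$, the numbers $a-b$ and $a-b-1$ never have opposite signs, so the
    absolute values leave the quotient unchanged. *)
Lemma has_value_factor a b : a != b.+1 ->
  has_value_at ((qvar ^+ a - qvar ^+ b) / (qvar ^+ a - qvar ^+ b.+1)) 1
    (`|a%:R - b%:R| / `|a%:R - b%:R - 1|).
Proof.
move=> ab; have [g -> gv] := qvar_sub a b; have [g' gE' gv'] := qvar_sub a b.+1.
have q1 : qvar - 1 != 0 by rewrite subr_eq0; exact: (qvar_pow_neq1 0).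
rewrite gE' -mulf_div divff // mul1r.
have -> : `|a%:R - b%:R| / `|a%:R - b%:R - 1| = (a%:R - b%:R) / (a%:R - b.+1%:R) :> rat.
  rewrite -natr1 opprD addrA; case: (ltngtP a b) => [lt|gt|->]; last by rewrite subrr normr0 !mul0r.
    rewrite !ler0_norm ?subr_le0 ?ler_nat ?(ltnW lt) //.
      by rewrite invrN mulrN mulNr opprK.
    apply: le_trans _ ler01; rewrite subr_le0 ler_nat; exact: ltnW.
  have gt' : (b.+1 < a)%N by rewrite ltn_neqAle eq_sym ab.
  rewrite !ger0_norm // -?addrA -?opprD ?natr1 ?subr_ge0 ?ler_nat //; lia.
apply: has_valueM => //; apply: has_valueV => //.
by rewrite subr_eq0 eqr_nat.
Qed.

Section At_one.
Variables (n : nat) (e : 'I_n -> 'I_n).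
Hypothesis he : reverse_hessenberg e.

Lemma chi_value1 m : has_value_at (chi e qvar m) 1 (chi e (1 : rat) m).
Proof.
have [K mK] := in_vars_ex m; rewrite /chi !(chromatic_fin _ _ _ mK).
by apply: has_value_sum => k _; rewrite expr1n; exact: has_value_qvarX.
Qed.

Lemma e_coef_value1 lam :
  has_value_at (qvar ^ (q_exponent e) * e_coef qvar e lam) 1 (e_coef_at1 e lam).
Proof.
rewrite -[e_coef_at1 e lam]mul1r; apply: has_valueM; first exact: has_value_qvarXz.
rewrite /e_coef_at1 -[X in X * _]mul1r; apply: has_valueM; first apply: has_valueM.
- exact: has_value_qvarX.
- apply: has_value_prod => k _; rewrite qnumE; first exact: has_value_qnum.
  exact: (qvar_pow_neq1 0).
- apply: has_value_sum => T _; apply: has_value_prod => p /andP[_ pl].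
  exact: has_value_factor.
Qed.

(** Serves to see the coefficients of $e_\lambda$ over the rational functions as constants, with the
    rational coefficients as their values at 1. *)
Lemma elementary_part_morph (R S : comNzRingType) (f : {rmorphism R -> S}) lam m :
  elementary_part S lam m = f (elementary_part R lam m).
Proof.
elim: lam m => [|k lam IH] m; rewrite /elementary_part ?big_nil ?big_cons.
  by rewrite /series_one rmorph_nat.
rewrite /series_mul !(fsbig_finite _ _ (factorizations_finite m)) /= rmorph_sum.
by apply: eq_bigr => p _; rewrite rmorphM -IH /elementary rmorph_nat.
Qed.

(** Both sides are values at 1 of the same rational function, by the expansion over [ratfun]; such a
    value is unique. *)
Lemma chi1_expansion m : chi e (1 : rat) m =
  \sum_(lam \in partitions n) e_coef_at1 e lam * elementary_part rat lam m.
Proof.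
apply: has_value_unique (chi_value1 m) _.
rewrite (chi_expansion qvar_neq0 qvar_pow_neq1 two_neq0_ratfun he) mulr_fsumr.
rewrite !(fsbig_finite _ _ (partitions_finite n)) /=; apply: has_value_sum => lam _.
rewrite mulrA; apply: has_valueM; first exact: e_coef_value1.
rewrite (elementary_part_morph (@tofrac {poly rat} \o @polyC rat)) /= -[X in has_value_at _ _ X](hornerC _ 1).
exact: has_value_poly.
Qed.

Lemma e_coef_at1_ge0 lam : 0 <= e_coef_at1 e lam.
Proof.
rewrite /e_coef_at1 mulr_ge0 ?prodr_ge0 // sumr_ge0 // => T _.
by apply: prodr_ge0 => p _; rewrite divr_ge0 ?normr_ge0.
Qed.
End At_one.

(** * (3+1)-free orders *)

Section Strict_orders.
Variable T : finType.
Implicit Types (lt : rel T) (L C H : {set T}).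

Definition strict_order lt := irreflexive lt /\ transitive lt.

Definition dual_rel lt : rel T := fun x y => lt y x.

Definition incomp lt : rel T := fun x y => [&& x != y, ~~ lt x y & ~~ lt y x].

Definition free31 lt := forall a b c x, lt a b -> lt b c ->
  incomp lt x a -> incomp lt x b -> incomp lt x c -> False.

(** In a strict order this is an induced 2+2 with chains [a < x] and [b < y]: transitivity rules out
    the other equalities and comparabilities. *)
Definition quad lt a x b y := [&& lt a x, lt b y, ~~ lt a y & ~~ lt b x].

Definition quads lt : {set T * T * (T * T)} :=
  [set p | quad lt p.1.1 p.1.2 p.2.1 p.2.2].

Lemma strict_order_dual lt : strict_order lt -> strict_order (dual_rel lt).
Proof. by move=> [ir tr]; split=> [x|y x z /= yx zy]; [apply: ir|apply: tr zy yx]. Qed.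

Lemma incomp_dual lt : incomp (dual_rel lt) =2 incomp lt.
Proof. by move=> x y; rewrite /incomp /dual_rel [X in _ && X]andbC. Qed.

Lemma incomp_sym lt x y : incomp lt x y = incomp lt y x.
Proof. by rewrite /incomp eq_sym [X in _ && X]andbC. Qed.

Lemma free31_dual lt : free31 lt -> free31 (dual_rel lt).
Proof.
move=> fr a b c x ab bc; rewrite !(incomp_dual lt) => xa xb xc; exact: (fr c b a x).
Qed.

Lemma quad_dual lt a x b y : quad (dual_rel lt) x a y b = quad lt a x b y.
Proof. by rewrite /quad /dual_rel [X in _ && (_ && X)]andbC. Qed.

Lemma quad_sym lt a x b y : quad lt a x b y = quad lt b y a x.
Proof.
by rewrite /quad; case: (lt a x); case: (lt b y); case: (lt a y); case: (lt b x).
Qed.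

Lemma card_quads_dual lt : #|quads (dual_rel lt)| = #|quads lt|.
Proof.
pose f (p : T * T * (T * T)) := ((p.1.2, p.1.1), (p.2.2, p.2.1)).
have fK : involutive f by move=> [[a x] [b y]].
rewrite -(card_imset _ (inv_inj fK)); apply: eq_card => -[[a x] [b y]].
apply/imsetP/idP => [[[[a' x'] [b' y']]]|]; rewrite !inE /=.
  by rewrite (quad_dual lt) => q [-> -> -> ->].
by move=> q; exists ((x, a), (y, b)); rewrite // inE /= quad_dual.
Qed.

(** If [z] were above [x] but not above [y], the chain [a < x < z] and the point [y] would form a
    3+1. *)
Lemma quad_up lt a x b y z : strict_order lt -> free31 lt -> quad lt a x b y ->
  lt x z = lt y z.
Proof.
move=> [ir tr] fr; wlog suff : a x b y / quad lt a x b y -> lt x z -> lt y z.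
  move=> hw q; apply/idP/idP; first exact: hw q.
  by move: q; rewrite quad_sym; exact: hw.
case/and4P => ax by_ nay nbx xz; apply: contraT => nyz.
case: (fr a x z y ax xz); rewrite /incomp.
- apply/and3P; split=> //; first by apply: contraNneq nbx => ya; apply: tr by_ _; rewrite ya.
  by apply: contra nbx => ya; apply: tr by_ (tr _ _ _ ya ax).
- apply/and3P; split; first by apply: contraNneq nay => ->.
    by apply: contra nbx => yx; exact: tr by_ yx.
  by apply: contra nay => xy; exact: tr ax xy.
- apply/and3P; split=> //; first by apply: contraNneq nay => ->; exact: tr ax xz.
  by apply: contra nay => zy; apply: tr ax (tr _ _ _ xz zy).
Qed.

Lemma quad_down lt a x b y z : strict_order lt -> free31 lt -> quad lt a x b y ->
  lt z a = lt z b.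
Proof.
move=> so fr q; have := @quad_up (dual_rel lt) x a y b z (strict_order_dual so) (free31_dual fr).
by rewrite (quad_dual lt); apply.
Qed.

(* [L] and [C] are antichains whose elements the rest of the order cannot tell
   apart, and no induced 2+2 meets [L] or [C] in only one of its two chains. *)
Record tangle lt L C : Prop := Tangle {
  tangle_disj : forall z, z \in L -> z \in C -> False;
  tangle_C_below : forall x y z, x \in C -> y \in C -> z \notin L -> lt z x = lt z y;
  tangle_C_above : forall x y z, x \in C -> y \in C -> lt x z = lt y z;
  tangle_L_above : forall a b z, a \in L -> b \in L -> z \notin C -> lt a z = lt b z;
  tangle_L_below : forall a b z, a \in L -> b \in L -> lt z a = lt z b;
  tangle_quad : exists a x b y, [/\ a \in L, x \in C, b \in L, y \in C & quad lt a x b y];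
  tangle_C_closed : forall a x b y, quad lt a x b y -> x \in C -> y \in C;
  tangle_L_closed : forall a x b y, quad lt a x b y -> a \in L -> b \in L }.

Lemma tangle_dual lt L C : tangle lt L C -> tangle (dual_rel lt) C L.
Proof.
case=> dis cb ca la lb [a [x [b [y [aL xC bL yC q]]]]] cc lc; split.
- by move=> z zC zL; exact: dis zL zC.
- by move=> x' y' z *; exact: la.
- by move=> x' y' z *; exact: lb.
- by move=> x' y' z *; exact: cb.
- by move=> x' y' z *; exact: ca.
- by exists x, a, y, b; rewrite (quad_dual lt).
- by move=> a' x' b' y'; rewrite (quad_dual lt); exact: lc.
- by move=> a' x' b' y'; rewrite (quad_dual lt); exact: cc.
Qed.

Section Tangle_exists.
Variable lt : rel T.
Hypotheses (so : strict_order lt) (fr : free31 lt).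
Variables (a0 x0 b0 x1 : T).
Hypothesis q0 : quad lt a0 x0 b0 x1.

Let sim : rel T := fun x y => [exists a, exists b, quad lt a x b y].

Let simP x y : reflect (exists a b, quad lt a x b y) (sim x y).
Proof.
apply: (iffP existsP) => [[a /existsP[b q]]|[a [b q]]]; first by exists a, b.
by exists a; apply/existsP; exists b.
Qed.

Let C := [set y | connect sim x0 y].
Let L := [set a | [exists x in C, lt a x] && [exists y in C, ~~ lt a y]].

Let C_closed a x b y : quad lt a x b y -> x \in C -> y \in C.
Proof.
move=> q; rewrite !inE => xx; apply: connect_trans xx (connect1 _).
by apply/simP; exists a, b.
Qed.

Let C_inv (U : eqType) (f : T -> U) :
  (forall x y, x \in C -> sim x y -> f x = f y) -> forall x, x \in C -> f x = f x0.
Proof.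
move=> inv x; rewrite inE => /connectP[p].
have : x0 \in C by rewrite inE connect0.
elim: p {1 2 3 4}x0 => [|y p IH] z zC /=; first by move=> _ ->.
move=> /andP[zy yp] xl; rewrite (inv z y) //; apply: IH => //.
by case/simP: (zy) => a [b q]; exact: C_closed q zC.
Qed.

Let C_above x y z : x \in C -> y \in C -> lt x z = lt y z.
Proof.
have inv : forall x y, x \in C -> sim x y -> lt x z = lt y z.
  by move=> x' y' _ /simP[a [b q]]; exact: quad_up q.
by move=> xC yC; rewrite (C_inv inv xC) (C_inv inv yC).
Qed.

Let C_anti x y : x \in C -> y \in C -> lt x y = false.
Proof. by move=> xC yC; rewrite (C_above y xC yC); apply: so.1. Qed.

Let LP a : reflect ((exists2 x, x \in C & lt a x) /\ (exists2 y, y \in C & ~~ lt a y)) (a \in L).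
Proof.
rewrite inE; apply: (iffP andP) => [[/existsP[x /andP[xC ax]] /existsP[y /andP[yC ay]]]|].
  by split; [exists x|exists y].
move=> [[x xC ax] [y yC ay]].
by split; apply/existsP; [exists x|exists y]; apply/andP.
Qed.

(** If [a < z] but not [b < z], a 2+2 with top [z] and its other top in [C] appears, so [z] is in
    [C]. It is found with the predicate [up w], that everything below [w] is below [z]. If [up]
    changes along an edge of [sim] in [C], the edge gives the 2+2. Otherwise [up] is constant on
    [C]: being true contradicts that [b] is below some element of [C], and being false gives a 2+2
    with an element of [C] not above [a]. *)
Let L_above a b z : a \in L -> b \in L -> z \notin C -> lt a z = lt b z.
Proof.
wlog suff : a b / a \in L -> b \in L -> z \notin C -> lt a z -> lt b z.
  by move=> hw aL bL zC; apply/idP/idP; exact: hw.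
move=> aL bL zC az; apply: contraNT zC => nbz.
pose up w := [forall c, lt c w ==> lt c z].
have [[w [w' [wC ww upw nup]]]|noedge] :=
    pselect (exists w w', [/\ w \in C, sim w w', up w & ~~ up w']).
  case/simP: ww => c [d q]; have /and4P[cw dw' ncw' ndw] := q.
  move: nup; rewrite negb_forall => /existsP[c']; rewrite negb_imply => /andP[cw'' nc'z].
  have cz : lt c z by have /forallP/(_ c) := upw; rewrite cw.
  apply: (@C_closed c' w' c z); last exact: C_closed q wC.
  by rewrite /quad cw'' cz nc'z ncw'.
have inv : forall x y, x \in C -> sim x y -> up x = up y.
  move=> x y xC xy; have yC : y \in C by case/simP: (xy) => c [d q]; exact: C_closed q xC.
  have yx : sim y x by case/simP: xy => c [d q]; apply/simP; exists d, c; rewrite quad_sym.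
  apply/idP/idP => ux; apply: contraT => nu; case: noedge; first by exists x, y.
  by exists y, x.
have [[x xC bx] _] := LP _ bL; have [_ [y yC nay]] := LP _ aL.
have := C_inv inv xC; rewrite -(C_inv inv yC) => upxy.
have [upx|nupx] := boolP (up x).
  by have /forallP/(_ b) := upx; rewrite bx (negPf nbz).
move: nupx; rewrite upxy negb_forall => /existsP[c]; rewrite negb_imply => /andP[cy ncz].
apply: (@C_closed c y a z) => //.
by rewrite /quad cy az ncz nay.
Qed.

(** If the tops are in [C], they witness that [b] is below some but not all of [C]. If they are not,
    a failure to compare [b] with [C] as [a] is compared would form a 2+2 joining one of them to
    [C]. *)
Let L_closed a x b y : quad lt a x b y -> a \in L -> b \in L.
Proof.
move=> q aL; have /and4P[ax by_ nay nbx] := q.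
have [xC|xC] := boolP (x \in C).
  by apply/LP; split; [exists y => //; exact: C_closed q xC|exists x].
have yC : y \notin C.
  by apply: contra xC => yC; rewrite quad_sym in q; exact: C_closed q yC.
have [[w wC aw] [w' w'C naw']] := LP _ aL; apply/LP; split.
  exists w => //; apply: contraNT yC => nbw; apply: (@C_closed a w b y) => //.
  by rewrite /quad aw by_ nay nbw.
exists w' => //; apply: contra xC => bw'; apply: (@C_closed b w' a x) => //.
by rewrite /quad bw' ax nbx naw'.
Qed.

Let down a := [set z | lt z a].

Let quad_down_set a x b y : quad lt a x b y -> down a = down b.
Proof. by move=> q; apply/setP => z; rewrite !inE; exact: quad_down q. Qed.

(** The bottoms of a 2+2 have the same lower set. If [c] is not below [w], then [a] and [c] form one
    directly; otherwise [c] is linked to [b], possibly through the bottom [d] of the next edge. *)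
Let edge_step a w b w' w'' c : quad lt a w b w' -> sim w' w'' ->
  lt c w' -> ~~ lt c w'' -> down c = down a.
Proof.
move=> q /simP[c' [d q']] cw' ncw''; have /and4P[aw bw' naw' nbw] := q.
have /and4P[_ dw'' _ ndw'] := q'.
have qc : quad lt c w' d w'' by rewrite /quad cw' dw'' ncw''.
have [cw|ncw] := boolP (lt c w); last first.
  by apply/esym; apply: (@quad_down_set a w c w'); rewrite /quad aw cw' naw'.
rewrite (quad_down_set q); have [bw''|nbw''] := boolP (lt b w'').
  by apply/esym; apply: (@quad_down_set b w'' c w); rewrite /quad bw'' cw nbw.
rewrite (quad_down_set qc); apply/esym; apply: (@quad_down_set b w' d w'').
by rewrite /quad bw' dw'' nbw''.
Qed.

(** An element of [L] is below some but not all of [C], which is connected, so it separates the ends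
    of some edge of [sim]. The predicate [P] fixes the lower set of every element separating an edge
    at [w], and [edge_step] carries [P] along [C] from [x0]. *)
Let L_down a : a \in L -> down a = down a0.
Proof.
pose P w := [forall w', forall c, sim w w' && lt c w && ~~ lt c w' ==> (down c == down a0)].
have PE w : reflect (forall w' c, sim w w' -> lt c w -> ~~ lt c w' -> down c = down a0) (P w).
  apply: (iffP forallP) => [h w' c ww cw ncw|h w'].
    by have /forallP/(_ c)/implyP := h w'; rewrite ww cw ncw => /(_ isT)/eqP.
  by apply/forallP => c; apply/implyP => /andP[/andP[ww cw] ncw]; rewrite (h w').
have P0 : P x0.
  apply/PE => w' c ww cw ncw; rewrite (quad_down_set q0).
  by have q0' := q0; rewrite quad_sym in q0'; exact: (edge_step q0' ww).
have inv : forall x y, x \in C -> sim x y -> P x = P y.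
  suff step x y : sim x y -> P x -> P y.
    move=> x y _ xy; apply/idP/idP; first exact: step.
    by apply: step; case/simP: xy => c [d q]; apply/simP; exists d, c; rewrite quad_sym.
  move=> xy /PE Px; apply/PE => w' c yw cy ncw.
  case/simP: (xy) => d [d' q]; rewrite (edge_step q yw cy ncw).
  by apply: Px xy _ _; case/and4P: q.
have PC w : w \in C -> P w by move=> wC; rewrite (C_inv inv wC).
move=> aL; have [[x xC ax] [y yC nay]] := LP _ aL.
have [[w [w' [wC ww aw naw]]]|noedge] :=
    pselect (exists w w', [/\ w \in C, sim w w', lt a w & ~~ lt a w']).
  by have /PE Pw := PC _ wC; exact: Pw ww aw naw.
have inv' : forall x y, x \in C -> sim x y -> lt a x = lt a y.
  move=> v v' vC vv; have v'C : v' \in C by case/simP: (vv) => c [d q]; exact: C_closed q vC.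
  have v'v : sim v' v by case/simP: vv => c [d q]; apply/simP; exists d, c; rewrite quad_sym.
  apply/idP/idP => av; apply: contraT => nu; case: noedge; first by exists v, v'.
  by exists v', v.
by move: nay; rewrite (C_inv inv' yC) -(C_inv inv' xC) ax.
Qed.

Lemma tangle_ex : exists L' C', tangle lt L' C'.
Proof.
have x0C : x0 \in C by rewrite inE connect0.
have x1C : x1 \in C := C_closed q0 x0C.
have /and4P[a0x0 b0x1 na0x1 nb0x0] := q0.
exists L, C; split=> //.
- by move=> z /LP[[x xC zx] _] zC; rewrite C_anti in zx.
- move=> x y z xC yC zL; apply/idP/idP => zx; apply: contraNT zL => nz; apply/LP; split.
  + by exists x.
  + by exists y.
  + by exists y.
  + by exists x.
- move=> a b z aL bL; have /setP/(_ z) : down a = down b by rewrite !L_down.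
  by rewrite !inE.
- exists a0, x0, b0, x1; split=> //; apply/LP; split.
  + by exists x0.
  + by exists x1.
  + by exists x1.
  + by exists x0.
Qed.
End Tangle_exists.
End Strict_orders.

(** * Resolving a tangle *)

Section Untangle.
Variables (T : finType) (lt : rel T) (L C : {set T}).
Hypotheses (so : strict_order lt) (fr : free31 lt) (tg : tangle lt L C).

Definition untangle (H : {set T}) : rel T :=
  fun x y => if (x \in L) && (y \in C) then x \in H else lt x y.

Let ir := proj1 so.
Let tr := proj2 so.

Lemma tangle_C_anti x y : x \in C -> y \in C -> lt x y = false.
Proof. by move=> xC yC; rewrite (tangle_C_above tg y xC yC) ir. Qed.

Lemma tangle_L_anti x y : x \in L -> y \in L -> lt x y = false.
Proof. by move=> xL yL; rewrite (tangle_L_below tg x yL xL) ir. Qed.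

Lemma tangle_LC x : x \in L -> x \in C = false.
Proof. by move=> xL; apply/negP; exact: (tangle_disj tg). Qed.

Lemma tangle_CL x : x \in C -> x \in L = false.
Proof. by move=> xC; apply/negP => xL; exact: (tangle_disj tg) xL xC. Qed.

(** Both truth values occur between [L] and [C] in the old order. A configuration of the new order
    with at most one point in each set can thus be copied into the old one. *)
Lemma tangle_mixed b : exists a x, [/\ a \in L, x \in C & lt a x = b].
Proof.
have [a [x [b' [y [aL xC bL yC /and4P[ax _ /negPf nay _]]]]]] := tangle_quad tg.
by case: b; [exists a, x|exists a, y].
Qed.

(** Such a [z] would lie above every element of [L] and below every element of [C], forcing all of
    [L] below all of [C]. *)
Lemma tangle_between l z c : l \in L -> c \in C -> lt l z -> lt z c -> False.
Proof.
move=> lL cC lz zc; have [a [x [aL xC ax]]] := tangle_mixed false.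
have zL : z \notin L by apply: contraTN lz => zL; rewrite tangle_L_anti.
have zC : z \notin C by apply: contraTN zc => zC; rewrite tangle_C_anti.
move: lz; rewrite (tangle_L_above tg lL aL zC) => az.
move: zc; rewrite (tangle_C_below tg cC xC zL) => zx.
by rewrite (tr az zx) in ax.
Qed.

Lemma tangle_down l c : l \in L -> c \in C -> lt c l = false.
Proof.
move=> lL cC; apply/negP => cl; have [a [x [aL xC ax]]] := tangle_mixed true.
have := tangle_L_below tg a aL lL; rewrite ir; move/esym/negP; apply.
by apply: tr ax _; rewrite (tangle_C_above tg _ xC cC).
Qed.

Lemma untangle_strict H : strict_order (untangle H).
Proof.
split=> [x|q p r]; rewrite /untangle.
  by case: ifP => [/andP[xL]|_]; rewrite ?tangle_LC ?ir.
have [a [x [aL xC ax]]] := tangle_mixed true.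
have [/andP[pL qC]|_] := boolP ((p \in L) && (q \in C)).
  rewrite (tangle_CL qC) /= => _ qr.
  have rC : r \notin C by apply: contraTN qr => rC; rewrite tangle_C_anti.
  rewrite (negPf rC) andbF (tangle_L_above tg pL aL rC); apply: tr ax _.
  by rewrite (tangle_C_above tg _ xC qC).
have [/andP[qL rC]|_] := boolP ((q \in L) && (r \in C)).
  move=> pq _; have pL : p \notin L by apply: contraTN pq => pL; rewrite tangle_L_anti.
  rewrite (negPf pL) /= (tangle_C_below tg rC xC pL); apply: tr _ ax.
  by rewrite (tangle_L_below tg _ aL qL).
move=> pq qr; case: ifP => [/andP[pL rC]|_]; last exact: tr pq qr.
by case: (tangle_between pL rC pq qr).
Qed.

Let sep u v := ~~ ((u \in L) && (v \in L)) && ~~ ((u \in C) && (v \in C)).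

Let cmp (r : rel T) u v := r u v || r v u.

Let sep_cmp H u v : cmp (untangle H) u v -> sep u v.
Proof.
move=> uv; apply/andP; split; apply: contraTN uv => /andP[uX vX]; rewrite /cmp /untangle.
  by rewrite !tangle_LC ?andbF ?tangle_L_anti.
by rewrite !tangle_CL ?tangle_C_anti.
Qed.

(** If [y] or [z] lies outside [L] and [C], it is comparable to [x] but not to [s], so [x] and [s]
    are not in the same one of the two sets. Otherwise one of them is in [L] and the other in [C];
    being comparable to both, [x] is in neither. *)
Let sep_incomp H x y z s : cmp (untangle H) x y -> cmp (untangle H) x z ->
  cmp (untangle H) y z -> incomp (untangle H) s y -> incomp (untangle H) s z -> sep s x.
Proof.
move=> xy xz yz sy sz; have [xyL xyC] := andP (sep_cmp xy).
have [xzL xzC] := andP (sep_cmp xz); have [yzL yzC] := andP (sep_cmp yz).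
suff out t : cmp (untangle H) x t -> incomp (untangle H) s t -> t \notin L -> t \notin C -> sep s x.
  have [yL|yL] := boolP (y \in L).
    rewrite yL /= in xyL yzL; rewrite !andbT in xyL.
    have [zC|zC] := boolP (z \in C); last exact: (out z).
    by rewrite zC !andbT in xzC yzC; rewrite /sep (negPf xyL) (negPf xzC) !andbF.
  have [yC|yC] := boolP (y \in C); last exact: (out y).
  rewrite yC /= !andbT in xyC yzC.
  have [zL|zL] := boolP (z \in L); last exact: (out z).
  by rewrite zL !andbT in xzL yzL; rewrite /sep (negPf xyC) (negPf xzL) !andbF.
move=> xt /and3P[_ nst nts] tL tC; rewrite /cmp /untangle (negPf tL) (negPf tC) !andbF /= in xt nst nts.
apply/andP; split; apply: contraTN xt => /andP[sX xX]; rewrite negb_or.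
  by rewrite (tangle_L_above tg xX sX tC) (tangle_L_below tg t xX sX) nst.
by rewrite (tangle_C_above tg t xX sX) (tangle_C_below tg xX sX tL) nst.
Qed.

(** The points of a 3+1 of the new order are pairwise separated by [sep]: at most one is in [L] and
    at most one in [C]. Moving these to [a] and [x], whose comparison in [lt] is the one prescribed
    by [H], gives a 3+1 of [lt]. *)
Lemma untangle_free31 H : free31 (untangle H).
Proof.
have [ir' tr'] := untangle_strict H.
move=> p q r s pq qr sp sq sr.
have pr := tr' _ _ _ pq qr.
have cpq : cmp (untangle H) p q by rewrite /cmp pq.
have cpr : cmp (untangle H) p r by rewrite /cmp pr.
have cqr : cmp (untangle H) q r by rewrite /cmp qr.
have cC u v : cmp (untangle H) u v -> cmp (untangle H) v u by rewrite /cmp orbC.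
have spp := sep_incomp cpq cpr cqr sq sr.
have sqq := sep_incomp (cC _ _ cpq) cqr cpr sp sr.
have srr := sep_incomp (cC _ _ cpr) (cC _ _ cqr) cpq sp sq.
have sepC u v : sep u v -> sep v u by rewrite /sep [(u \in L) && _]andbC [(u \in C) && _]andbC.
have pqq := sep_cmp cpq; have prr := sep_cmp cpr; have qrr := sep_cmp cqr.
pose b := has (fun l => (l \in L) && (l \in H)) [:: p; q; r; s].
have [a [x [aL xC ax]]] := tangle_mixed b.
pose phi z := if z \in L then a else if z \in C then x else z.
have phiE u v : sep u v -> (u \in L -> (u \in H) = b) -> lt (phi u) (phi v) = untangle H u v.
  move=> /andP[uvL uvC] ub; rewrite /phi /untangle.
  case: (boolP (u \in L)) uvL ub => [uL|uL] /= uvL ub.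
    rewrite (negPf uvL); case: (boolP (v \in C)) => vC; first by rewrite ub.
    by rewrite (tangle_L_above tg uL aL vC).
  case: (boolP (u \in C)) uvC => [uC|uC] /= uvC.
    rewrite (negPf uvC); case: (boolP (v \in L)) => vL; first by rewrite !tangle_down.
    by rewrite (tangle_C_above tg v uC xC).
  case: (boolP (v \in L)) => vL; first by rewrite (tangle_L_below tg u vL aL).
  by case: (boolP (v \in C)) => vC //; rewrite (tangle_C_below tg vC xC uL).
have phi_neq u v : sep u v -> u != v -> phi u != phi v.
  move=> /andP[uvL uvC]; apply: contraNneq; rewrite /phi.
  case: (boolP (u \in L)) uvL => [uL|uL] /= uvL.
    rewrite (negPf uvL); case: (boolP (v \in C)) => vC ae; last by case/negP: uvL; rewrite -ae.
    by case: (tangle_disj tg aL); rewrite ae.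
  case: (boolP (u \in C)) uvC => [uC|uC] /= uvC.
    rewrite (negPf uvC); case: (boolP (v \in L)) => vL xe; last by case/negP: uvC; rewrite -xe.
    by case: (tangle_disj tg aL); rewrite -xe.
  case: (boolP (v \in L)) => vL; first by move=> ue; case/negP: uL; rewrite ue.
  by case: (boolP (v \in C)) => vC => [ue|ue]; [case/negP: uC; rewrite ue|rewrite ue].
have [[/andP[spL _] [/andP[sqL _] /andP[srL _]]] [/andP[pqL _] [/andP[prL _] /andP[qrL _]]]] :
  (sep s p /\ sep s q /\ sep s r) /\ (sep p q /\ sep p r /\ sep q r) by [].
have pb : p \in L -> (p \in H) = b.
  by rewrite /b /=; move=> pL; move: spL pqL prL; rewrite pL /= andbT => /negPf-> /negPf-> /negPf->; rewrite !orbF.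
have qb : q \in L -> (q \in H) = b.
  by rewrite /b /=; move=> pL; move: sqL pqL qrL; rewrite pL /= !andbT => /negPf-> /negPf-> /negPf->; rewrite !orbF.
have rb : r \in L -> (r \in H) = b.
  by rewrite /b /=; move=> pL; move: srL prL qrL; rewrite pL /= !andbT => /negPf-> /negPf-> /negPf->; rewrite !orbF.
have sb : s \in L -> (s \in H) = b.
  by rewrite /b /=; move=> pL; move: spL sqL srL; rewrite pL /= => /negPf-> /negPf-> /negPf->; rewrite !orbF.
have inc u v : sep u v -> (u \in L -> (u \in H) = b) -> (v \in L -> (v \in H) = b) ->
    incomp (untangle H) u v -> incomp lt (phi u) (phi v).
  move=> uv ub vb /and3P[nuv luv lvu]; apply/and3P; split; first exact: phi_neq.
    by rewrite phiE.
  by rewrite phiE //; exact: sepC.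
by apply: (fr (a := phi p) (b := phi q) (c := phi r) (x := phi s)); rewrite ?phiE ?inc.
Qed.

(** Two tops in [C] are impossible, since in the new order all elements of [C] have the same lower
    set. With one top in [C] and one bottom in [L], replacing the altered pair by one from
    [tangle_mixed] gives a 2+2 of [lt] with only one top in [C], against [tangle_C_closed]. *)
Lemma quad_untangle H a x b y : quad (untangle H) a x b y ->
  quad lt a x b y /\ ~~ ((x \in C) && (y \in C)).
Proof.
move=> q; have [xC|xC] := boolP (x \in C); have [yC|yC] := boolP (y \in C).
- case/and4P: q; rewrite /untangle xC yC !andbT; case: ifP => [_ ->//|/negbT aL].
  by rewrite (tangle_C_below tg xC yC aL) => ->.
- split=> //; case/and4P: q; rewrite /untangle xC (negPf yC) !andbT !andbF.
  have [aL|aL] := boolP (a \in L); have [bL|bL] := boolP (b \in L).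
  + by rewrite (tangle_L_above tg aL bL yC) => _ ->.
  + move=> _ by_ nay nbx; have [a' [x' [aL' xC' ax']]] := tangle_mixed true.
    case/negP: (yC); apply: (tangle_C_closed tg (a := a') (x := x') (b := b)) => //.
    rewrite /quad ax' by_ -(tangle_L_above tg aL aL' yC) nay /=.
    by rewrite -(tangle_C_below tg xC xC' bL).
  + move=> ax by_ nay _; have [b' [x' [bL' xC' bx']]] := tangle_mixed false.
    case/negP: (yC); apply: (tangle_C_closed tg (a := a) (x := x') (b := b')) => //.
    rewrite /quad bx' -(tangle_L_above tg bL bL' yC) by_ nay andbT /=.
    by rewrite -(tangle_C_below tg xC xC' aL) ax.
  + by move=> ax by_ nay nbx; rewrite /quad ax by_ nay.
- split=> //; case/and4P: q; rewrite /untangle yC (negPf xC) !andbT !andbF.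
  have [aL|aL] := boolP (a \in L); have [bL|bL] := boolP (b \in L).
  + by rewrite (tangle_L_above tg aL bL xC) => -> _ _.
  + move=> ax by_ nay nbx; have [a' [y' [aL' yC' ay']]] := tangle_mixed false.
    case/negP: (xC); apply: (tangle_C_closed tg (a := b) (x := y') (b := a')) => //.
    rewrite /quad ay' -(tangle_L_above tg aL aL' xC) ax nbx andbT /=.
    by rewrite -(tangle_C_below tg yC yC' bL) by_.
  + move=> ax _ nay nbx; have [b' [y' [bL' yC' by']]] := tangle_mixed true.
    case/negP: (xC); apply: (tangle_C_closed tg (a := b') (x := y') (b := a)) => //.
    rewrite /quad by' ax -(tangle_L_above tg bL bL' xC) nbx /=.
    by rewrite -(tangle_C_below tg yC yC' aL).
  + by move=> ax by_ nay nbx; rewrite /quad ax by_ nay.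
- by move: q; rewrite /quad /untangle (negPf xC) (negPf yC) !andbF.
Qed.

Lemma card_quads_untangle H : (#|quads (untangle H)| < #|quads lt|)%N.
Proof.
apply: proper_card; apply/properP; split.
  by apply/fintype.subsetP => p; rewrite !inE => /quad_untangle[].
have [a [x [b [y [aL xC bL yC q]]]]] := tangle_quad tg.
exists ((a, x), (b, y)); rewrite inE //=.
by apply/negP => /quad_untangle[_]; rewrite xC yC.
Qed.

Definition crossing u v := ((u \in L) && (v \in C)) || ((u \in C) && (v \in L)).

Lemma incomp_untangle H u v : ~~ crossing u v -> incomp (untangle H) u v = incomp lt u v.
Proof.
by rewrite negb_or /incomp /untangle => /andP[/negPf-> /negPf]; rewrite andbC => ->.
Qed.

Lemma incomp_untangle_LC H l c : l \in L -> c \in C -> incomp (untangle H) l c = (l \notin H).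
Proof.
move=> lL cC; rewrite /incomp /untangle lL cC (tangle_CL cC) /= tangle_down //= andbT.
by rewrite andb_idl // => _; apply: contraTneq cC => <-; rewrite tangle_LC.
Qed.

Lemma incomp_LC l c : l \in L -> c \in C -> incomp lt l c = ~~ lt l c.
Proof.
move=> lL cC; rewrite /incomp (tangle_down lL cC) /= andbT andb_idl // => _.
by apply: contraTneq cC => <-; rewrite tangle_LC.
Qed.

Definition proper_away (U : eqType) (k : T -> U) :=
  [forall u, forall v, incomp lt u v && ~~ crossing u v ==> (k u != k v)].

Definition properb (U : eqType) (r : rel T) (k : T -> U) :=
  [forall u, forall v, incomp r u v ==> (k u != k v)].

Lemma properb_crossing (U : eqType) (r : rel T) (k : T -> U) :
    (forall u v, ~~ crossing u v -> incomp r u v = incomp lt u v) ->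
  properb r k = proper_away k &&
    [forall l in L, forall c in C, incomp r l c ==> (k l != k c)].
Proof.
move=> rlt; apply/idP/andP.
  move=> /forallP h; have {}h u v : incomp r u v -> k u != k v.
    by have /forallP/(_ v)/implyP := h u.
  split.
    apply/forallP => u; apply/forallP => v; apply/implyP => /andP[uv ncr].
    by apply: h; rewrite rlt.
  apply/forall_inP => l lL; apply/forall_inP => c cC; apply/implyP; exact: h.
move=> [/forallP away /forall_inP cross]; apply/forallP => u; apply/forallP => v; apply/implyP.
have [/orP[/andP[uL vC]|/andP[uC vL]]|ncr] := boolP (crossing u v).
- by have /forall_inP/(_ v vC)/implyP := cross u uL.
- by have /forall_inP/(_ u uC)/implyP := cross v vL; rewrite incomp_sym eq_sym.
- by rewrite rlt // => uv; have /forallP/(_ v)/implyP := away u; rewrite uv ncr; apply.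
Qed.

(** Incomparabilities that do not cross between [L] and [C] do not distinguish the elements of
    [C]. *)
Lemma proper_away_perm (U : eqType) (k : T -> U) (s : {perm T}) : perm_on C s ->
  proper_away k -> proper_away (k \o s).
Proof.
move=> sC /forallP h; apply/forallP => u; apply/forallP => v; apply/implyP => /andP[uv ncr].
have sin z : (s z \in C) = (z \in C) by exact: perm_closed.
have sout z : z \notin C -> s z = z by exact: out_perm.
have /forallP/(_ (s v))/implyP /= := h (s u); apply.
have sL z : (s z \in L) = (z \in L).
  have [zC|zC] := boolP (z \in C); last by rewrite sout.
  by rewrite !tangle_CL ?sin.
rewrite /crossing !sin !sL -/(crossing u v) ncr andbT.
move: uv; rewrite /incomp (inj_eq perm_inj) => /and3P[-> nuv nvu] /=.
have [uC|uC] := boolP (u \in C); have [vC|vC] := boolP (v \in C).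
- by rewrite !tangle_C_anti ?sin.
- have vL : v \notin L by apply: contra ncr => vL; rewrite /crossing uC vL orbT.
  rewrite (sout v vC) (tangle_C_above tg (x := s u) (y := u)) ?sin //.
  by rewrite (tangle_C_below tg (x := s u) (y := u)) ?sin // nuv.
- have uL : u \notin L by apply: contra ncr => uL; rewrite /crossing uL vC.
  rewrite (sout u uC) (tangle_C_above tg (x := s v) (y := v)) ?sin //.
  by rewrite (tangle_C_below tg (x := s v) (y := v)) ?sin // nuv.
- by rewrite !sout // nuv.
Qed.
End Untangle.

(** * Averaging over the permutations of [C] *)

Lemma extend_to_perm (T : finType) (C : {set T}) (D : seq T) (f g : T -> T) :
    {in D &, injective f} -> {in D &, injective g} ->
    (forall d, d \in D -> f d \in C) -> (forall d, d \in D -> g d \in C) ->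
  exists2 s : {perm T}, perm_on C s & forall d, d \in D -> s (f d) = g d.
Proof.
elim: D => [|d D IH] fi gi fC gC; first by exists 1%g => //; exact: perm_on1.
have sub x : x \in D -> x \in d :: D by rewrite inE orbC => ->.
have [s sC sfg] : exists2 s : {perm T}, perm_on C s & forall d, d \in D -> s (f d) = g d.
  apply: IH => [x y /sub xD /sub yD|x y /sub xD /sub yD|x /sub|x /sub].
  - exact: fi.
  - exact: gi.
  - exact: fC.
  - exact: gC.
have [dD|dD] := boolP (d \in D).
  by exists s => // x; rewrite inE => /orP[/eqP->|]; exact: sfg.
have dd : d \in d :: D by rewrite inE eqxx.
(* The transposition corrects the value at [f d]; by injectivity of [f] and [g] it fixes the values
   already prescribed. *)
exists (s * tperm (s (f d)) (g d))%g => [|x].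
  apply: perm_onM => //; apply: fintype.subset_trans (tperm_on _ _) _.
  by apply/fintype.subsetP => x; rewrite !inE => /orP[]/eqP->; rewrite ?perm_closed ?fC ?gC.
rewrite inE permM => /orP[/eqP->|xD]; first by rewrite tpermL.
have xd : x != d by apply: contraNneq dD => <-.
rewrite (sfg x xD) tpermD //.
  by rewrite -(sfg x xD) (inj_eq perm_inj); apply: contraNneq xd => /(fi _ _ dd (sub _ xD)) ->.
by apply: contraNneq xd => /(gi _ _ dd (sub _ xD)) ->.
Qed.

Lemma stanley_fin (V : finType) (E : rel V) K m : in_vars K m ->
  stanley_chromatic E rat m =
  \sum_(k : {ffun V -> 'I_K})
     (proper_coloring E (lift_coloring k) && (coloring_monomial (lift_coloring k) == m))%:R.
Proof.
move=> mK; rewrite -(chromatic1 E rat (fun _ _ => false)) (chromatic_fin _ _ _ mK) big_mkcond.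
by apply: eq_bigr => k _; rewrite expr1n; case: ifP.
Qed.

Lemma coloring_monomial_perm (V : finType) (k : {ffun V -> nat}) (s : {perm V}) :
  coloring_monomial [ffun v => k (s v)] = coloring_monomial k.
Proof.
have sK : {on predT, bijective s} by apply: onW_bij; exists (s^-1)%g; [exact: permK|exact: permKV].
rewrite /coloring_monomial [RHS](reindex s) //.
by apply: eq_bigr => v _; rewrite ffunE.
Qed.

Section Averaging.
Variables (T : finType) (lt : rel T) (L C : {set T}).
Hypotheses (so : strict_order lt) (tg : tangle lt L C).
Variable tau : T -> T.
Hypotheses (tau_inj : {in L &, injective tau}) (tauC : forall l, l \in L -> tau l \in C).

Definition hits (s : {perm T}) : {set T} := [set l | lt l (s (tau l))].

(** In the permuted coloring the color [k c] sits on [s c], so [l] and [s c] must be comparable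
    whenever [l] and [c] have equal colors. *)
Lemma proper_perm_crossing (k : T -> nat) (s : {perm T}) : perm_on C s -> proper_away lt L C k ->
  properb lt (k \o (s^-1)%g) =
  [forall l in L, forall c in C, (k l == k c) ==> lt l (s c)].
Proof.
move=> sC away; have sC' : perm_on C (s^-1)%g by exact: perm_onV.
rewrite (properb_crossing (lt := lt) (L := L) (C := C)) // (proper_away_perm so tg sC' away) /=.
have fixL l : l \in L -> (s^-1)%g l = l.
  by move=> lL; apply: (out_perm sC'); rewrite (tangle_LC tg lL).
apply/forall_inP/forall_inP => h l lL; apply/forall_inP => c cC; apply/implyP.
  move=> /eqP klc; have /forall_inP/(_ (s c)) := h l lL; rewrite perm_closed // => /(_ cC).
  rewrite (incomp_LC so tg) ?perm_closed //= permK fixL //.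
  by rewrite klc eqxx implybF negbK.
rewrite (incomp_LC so tg) //= fixL //; apply: contra => klc.
have /forall_inP/(_ ((s^-1)%g c)) := h l lL; rewrite (perm_closed c sC') => /(_ cC)/implyP.
by rewrite permKV; apply.
Qed.

Lemma proper_untangle (k : T -> nat) (s : {perm T}) : proper_away lt L C k ->
  properb (untangle lt L C (hits s)) k =
  [forall l in L, forall c in C, (k l == k c) ==> lt l (s (tau l))].
Proof.
move=> away; rewrite (properb_crossing (lt := lt) (L := L) (C := C)); last first.
  by move=> u v; exact: incomp_untangle.
rewrite away /=; apply: eq_forallb => l; case: (boolP (l \in L)) => //= lL.
apply: eq_forallb => c; case: (boolP (c \in C)) => //= cC.
rewrite (incomp_untangle_LC so tg) // inE.
by case: (k l == k c); case: lt.
Qed.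

(** If [k] is proper away from the crossing pairs, it is injective on [L] and on [C], so equality of
    colors is a partial injection [g] from [L] to [C]. As [tau] is injective too, some permutation
    [s'] of [C] sends [tau l] to [g l] wherever [g] is defined. Multiplying by [s'] turns the
    condition on [s (tau l)] into the condition on [s (g l)]. *)
Lemma sum_proper_perm (k : T -> nat) :
  (\sum_(s : {perm T} | perm_on C s) properb lt (k \o (s^-1)%g) =
   \sum_(s : {perm T} | perm_on C s) properb (untangle lt L C (hits s)) k)%N.
Proof.
have [away|naway] := boolP (proper_away lt L C k); last first.
  rewrite !big1 // => s sC; apply/eqP; rewrite eqb0; apply: contra naway.
    rewrite (properb_crossing (lt := lt) (L := L) (C := C)) => [/andP[]//|u v].
    exact: incomp_untangle.
  rewrite (properb_crossing (lt := lt) (L := L) (C := C)) // => /andP[away _].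
  have := proper_away_perm so tg sC away; congr (is_true (proper_away _ _ _ _)).
  by apply/funext => x /=; rewrite permK.
have kC c c' : c \in C -> c' \in C -> k c = k c' -> c = c'.
  move=> cC c'C kcc; apply/eqP; apply: contraT => ncc.
  have /forallP/(_ c)/forallP/(_ c')/implyP := away; rewrite kcc eqxx; apply.
  rewrite /incomp ncc !(tangle_C_anti so tg) //= /crossing cC c'C.
  by rewrite !(tangle_CL tg).
have kL l l' : l \in L -> l' \in L -> k l = k l' -> l = l'.
  move=> lL l'L kll; apply/eqP; apply: contraT => nll.
  have /forallP/(_ l)/forallP/(_ l')/implyP := away; rewrite kll eqxx; apply.
  rewrite /incomp nll !(tangle_L_anti so tg) //= /crossing lL l'L.
  by rewrite !(tangle_LC tg).
pose g l := odflt l [pick c in C | k l == k c].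
pose D := [seq l <- enum L | [exists c in C, k l == k c]].
have gP l : l \in D -> g l \in C /\ k l = k (g l).
  rewrite mem_filter /g => /andP[/existsP[c cP] _]; case: pickP => [c' /andP[c'C /eqP]//|/(_ c)].
  by rewrite cP.
have DL l : l \in D -> l \in L by rewrite mem_filter mem_enum => /andP[].
have [s' s'C s'g] : exists2 s : {perm T}, perm_on C s & forall d, d \in D -> s (tau d) = g d.
  apply: extend_to_perm => [l l' /DL lL /DL l'L|l l' lD l'D gg|l /DL|l /gP[]//].
  - exact: tau_inj.
  - by apply: kL; rewrite ?DL // (gP l lD).2 gg -(gP l' l'D).2.
  - exact: tauC.
rewrite [RHS](reindex_inj (mulgI s')) /=; apply: eq_big => [s|s sC].
  apply/idP/idP => [sC|ssC]; first exact: perm_onM.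
  by rewrite -[s](mulKg s'); apply: perm_onM => //; exact: perm_onV.
rewrite proper_perm_crossing // proper_untangle //; congr (nat_of_bool _).
apply: eq_forallb => l; case: (boolP (l \in L)) => //= lL.
apply: eq_forallb => c; case: (boolP (c \in C)) => //= cC.
case: eqP => //= klc; rewrite permM; congr (lt l (s _)).
have lD : l \in D.
  by rewrite mem_filter mem_enum lL andbT; apply/existsP; exists c; rewrite cC klc eqxx.
by rewrite s'g //; apply: kC => //; [exact: (gP l lD).1|rewrite -klc (gP l lD).2].
Qed.

(** Permuting the vertices preserves the monomial of a coloring, so summing over the colorings
    composed with a fixed permutation gives the chromatic function again. Then [sum_proper_perm]
    applies to each coloring. *)
Lemma stanley_average m :
  #|[set s : {perm T} | perm_on C s]|%:R * stanley_chromatic (incomp lt) rat m =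
  \sum_(s : {perm T} | perm_on C s)
     stanley_chromatic (incomp (untangle lt L C (hits s))) rat m.
Proof.
have [K mK] := in_vars_ex m.
transitivity (\sum_(s : {perm T} | perm_on C s) \sum_(k : {ffun T -> 'I_K})
    (properb lt (lift_coloring k \o (s^-1)%g) && (coloring_monomial (lift_coloring k) == m))%:R : rat).
  rewrite -sum1dep_card natr_sum mulr_suml; apply: eq_bigr => s sC; rewrite mul1r.
  rewrite (stanley_fin _ mK).
  pose h (k : {ffun T -> 'I_K}) := [ffun v => k ((s^-1)%g v)].
  have hK : bijective h.
    exists (fun k : {ffun T -> 'I_K} => [ffun v => k (s v)]) => k; apply/ffunP => v.
      by rewrite !ffunE permK.
    by rewrite !ffunE permKV.
  rewrite (reindex h) /=; last exact: onW_bij.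
  apply: eq_bigr => k _.
  have -> : lift_coloring (h k) = [ffun v => lift_coloring k ((s^-1)%g v)].
    by apply/ffunP => v; rewrite !ffunE.
  rewrite coloring_monomial_perm; congr ((nat_of_bool (_ && _))%:R).
  rewrite /proper_coloring /properb; apply: eq_forallb => u; apply: eq_forallb => v.
  by rewrite !ffunE /= !ffunE.
rewrite exchange_big /=.
under [RHS]eq_bigr do rewrite (stanley_fin _ mK).
rewrite [RHS]exchange_big /=; apply: eq_bigr => k _.
case: eqP => _; last by under eq_bigr do rewrite andbF; under [RHS]eq_bigr do rewrite andbF.
under eq_bigr do rewrite andbT; under [RHS]eq_bigr do rewrite andbT.
by rewrite -!natr_sum sum_proper_perm.
Qed.
End Averaging.

(** * Unit interval orders *)

Section Interval_order.
Variables (T : finType) (lt : rel T).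
Hypotheses (so : strict_order lt) (fr : free31 lt).
Hypothesis no_quad : forall a x b y, ~~ quad lt a x b y.

Let ir := proj1 so.
Let tr := proj2 so.

Definition down_set x : {set T} := [set z | lt z x].
Definition up_set x : {set T} := [set z | lt x z].

Lemma down_set_total x y : (down_set x \subset down_set y) || (down_set y \subset down_set x).
Proof.
apply: contraT; rewrite negb_or => /andP[/fintype.subsetPn[a + nay] /fintype.subsetPn[b + nbx]].
rewrite !inE in nay nbx *; move=> ax by_.
by have := no_quad a x b y; rewrite /quad ax by_ nay nbx.
Qed.

Lemma up_set_total x y : (up_set x \subset up_set y) || (up_set y \subset up_set x).
Proof.
apply: contraT; rewrite negb_or => /andP[/fintype.subsetPn[a + nay] /fintype.subsetPn[b + nbx]].
rewrite !inE in nay nbx *; move=> ax by_.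
by have := no_quad x a y b; rewrite /quad ax by_ nay nbx.
Qed.

(** With [a] below [y] but not [x], and [z] above [y] but not [x], the chain [a < y < z] and the
    point [x] would form a 3+1. *)
Lemma down_proper_up x y : down_set x \proper down_set y -> up_set y \subset up_set x.
Proof.
case/fintype.properP => _ [a]; rewrite !inE => ay nax.
apply/fintype.subsetP => z; rewrite !inE => yz; apply: contraT => nxz.
case: (fr (a := a) (b := y) (c := z) (x := x) ay yz); apply/and3P; split=> //.
- by apply: contraNneq nxz => ->; exact: tr ay yz.
- by apply: contra nxz => xa; apply: tr xa (tr ay yz).
- by apply: contraNneq nxz => ->.
- by apply: contra nxz => xy; exact: tr xy yz.
- by apply: contra nax => yx; exact: tr ay yx.
- by apply: contraNneq nax => ->; exact: tr ay yz.
- by apply: contra nax => zx; apply: tr ay (tr yz zx).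
Qed.

(** Lower sets form a chain under inclusion, upper sets too, and the two chains are compatible by
    [down_proper_up]. Adding the sizes gives one rank that sorts both at once. *)
Definition height x := (#|down_set x| + (#|T| - #|up_set x|))%N.

Lemma height_le x y : (height x <= height y)%N ->
  (down_set x \subset down_set y) /\ (up_set y \subset up_set x).
Proof.
rewrite /height => hxy; have ux := max_card (up_set x); have uy := max_card (up_set y).
have [xy|nxy] := boolP (down_set x \subset down_set y).
  split=> //; have [yx|nyx] := boolP (down_set y \subset down_set x); last first.
    by apply: down_proper_up; rewrite /fintype.proper xy.
  have := subset_leq_card xy; have := subset_leq_card yx => c1 c2.
  have := up_set_total x y; case/orP => // ss; have c3 := subset_leq_card ss.
  have /eqP -> : up_set x == up_set y by rewrite eqEcard ss /=; lia.
  exact: fintype.subxx.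
have yx : down_set y \subset down_set x by have := down_set_total x y; rewrite (negPf nxy).
have pyx : down_set y \proper down_set x by rewrite /fintype.proper yx.
have := proper_card pyx; have := subset_leq_card (down_proper_up pyx); lia.
Qed.

(** Numbering by height makes every lower set an initial segment, and [e j] is its size. *)
Lemma interval_order_hessenberg : exists (e : 'I_#|T| -> 'I_#|T|) (v : 'I_#|T| -> T),
  [/\ reverse_hessenberg e, bijective v &
      forall i j, incomp lt (v i) (v j) = unit_interval_graph e i j].
Proof.
pose s := sort (fun x y => height x <= height y)%N (enum T).
have sizes : size s = #|T| by rewrite size_sort cardE.
have us : uniq s by rewrite sort_uniq enum_uniq.
have mems x : x \in s by rewrite mem_sort mem_enum.
case: (pickP T) => [t0 _|T0]; last first.
  have n0 : #|T| = 0%N by apply: eq_card0.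
  have noI (i : 'I_#|T|) : False by case: i => i; rewrite n0.
  exists id, (fun i => match noI i with end); split; first by split=> [i|i]; case: (noI i).
    by exists (fun x => match notF (etrans (esym (T0 x)) isT) with end) => [i|x]; [case: (noI i)|have := T0 x].
  by move=> i; case: (noI i).
pose v (i : 'I_#|T|) := nth t0 s i.
have vinj : injective v.
  move=> i j /eqP; rewrite nth_uniq ?sizes // => /eqP ij; exact: ord_inj.
have vbij : bijective v by apply: inj_card_bij => //; rewrite card_ord.
have vmono (i j : 'I_#|T|) : (i <= j)%N -> (height (v i) <= height (v j))%N.
  have tot : total (fun x y => height x <= height y)%N by move=> x y; exact: leq_total.
  have trans : transitive (fun x y => height x <= height y)%N by move=> y x z; exact: leq_trans.
  have refl : reflexive (fun x y => height x <= height y)%N by move=> x; exact: leqnn.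
  by apply: (sorted_leq_nth trans refl t0 (sort_sorted tot (enum T))); rewrite inE sizes.
have dn (j : 'I_#|T|) : (#|down_set (v j)| < #|T|)%N.
  rewrite -cardsT; apply: proper_card; apply/fintype.properP; split; first exact: finset.subsetT.
  by exists (v j); rewrite ?inE ?ir.
pose e j := Ordinal (dn j); exists e, v.
have ltE i j : lt (v i) (v j) = (i < e j)%N.
  have -> : (e j : nat) = #|[set i | lt (v i) (v j)]|.
    rewrite /= -[RHS](card_imset _ vinj); apply: eq_card => x; rewrite inE.
    apply/idP/imsetP => [xj|[k + ->]]; last by rewrite inE.
    by have [w vw wv] := vbij; exists (w x); rewrite ?inE wv.
  apply/esym; apply: (card_downset (P := fun i => lt (v i) (v j))) => k l kl lj.
  have [_ /fintype.subsetP/(_ (v j))] := height_le (vmono k l kl).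
  by rewrite !inE; apply.
have ej i : (e i <= i)%N by rewrite leqNgt -ltE ir.
split=> //.
  split=> [i j ij|i]; last by rewrite ltnS.
  by apply: subset_leq_card; exact: (height_le (vmono i j ij)).1.
move=> i j; rewrite /incomp (inj_eq vinj) !ltE /unit_interval_graph !precE -!leqNgt.
have := ej i; have := ej j.
have [ij|ji|/ord_inj->] := ltngtP i j; rewrite ?andbT ?andbF ?eqxx //= ?orbF.
  have -> : i != j by rewrite -val_eqE ltn_eqF.
  by move=> _ ei; rewrite (leq_trans ei (ltnW ij)) andbT.
have -> : i != j by rewrite -val_eqE gtn_eqF.
by move=> ei _; rewrite (leq_trans ei (ltnW ji)).
Qed.
End Interval_order.

(** * Positivity for (3+1)-free orders *)

Lemma stanley_bij (V W : finType) (E : rel V) (E' : rel W) (h : W -> V) m : bijective h ->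
    (forall u v, E (h u) (h v) = E' u v) ->
  stanley_chromatic E rat m = stanley_chromatic E' rat m.
Proof.
move=> [h' hK h'K] hE; have [K mK] := in_vars_ex m; rewrite !(stanley_fin _ mK).
pose f (k : {ffun W -> 'I_K}) : {ffun V -> 'I_K} := [ffun v => k (h' v)].
have fbij : bijective f.
  by exists (fun k : {ffun V -> 'I_K} => [ffun w => k (h w)]) => k; apply/ffunP => v;
     rewrite !ffunE ?hK ?h'K.
rewrite (reindex f) /=; last exact: onW_bij.
apply: eq_bigr => k _; congr ((nat_of_bool (_ && (_ == m)))%:R).
  apply/forallP/forallP => pk u; apply/forallP => v; apply/implyP => uv.
    have /forallP/(_ (h v))/implyP := pk (h u); rewrite hE !ffunE !hK; exact.
  have /forallP/(_ (h' v))/implyP := pk (h' u); rewrite -hE !h'K !ffunE; exact.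
have hbij : {on predT, bijective h} by apply: onW_bij; exists h'.
rewrite /coloring_monomial (reindex h) //.
by apply: eq_bigr => w _; rewrite !ffunE hK.
Qed.

Definition e_positive (T : finType) (E : rel T) :=
  exists c : seq nat -> rat,
    (forall lam, partitions #|T| lam -> 0 <= c lam) /\
    (forall m, stanley_chromatic E rat m =
       \sum_(lam \in partitions #|T|) c lam * elementary_part rat lam m).

Lemma inj_below (T : finType) (L C : {set T}) : (#|L| <= #|C|)%N ->
  exists2 tau : T -> T, {in L &, injective tau} & forall l, l \in L -> tau l \in C.
Proof.
move=> LC; have idx l : l \in L -> (index l (enum L) < size (enum C))%N.
  by move=> lL; rewrite -cardE (leq_trans _ LC) // cardE index_mem mem_enum.
exists (fun l => nth l (enum C) (index l (enum L))) => [l l' lL l'L|l lL]; last first.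
  by rewrite -mem_enum mem_nth // idx.
rewrite (set_nth_default l') ?idx // => /eqP; rewrite nth_uniq ?idx ?enum_uniq // => /eqP.
by move=> e; rewrite -[RHS](nth_index l (s := enum L)) -?e ?nth_index ?mem_enum.
Qed.

(* The incomparability graph of a (3+1)-free order with a tangle is an average
   of those of (3+1)-free orders with fewer copies of 2+2. *)
Theorem free31_e_positive (T : finType) (lt : rel T) :
  strict_order lt -> free31 lt -> e_positive (incomp lt).
Proof.
have [N] := ubnP #|quads lt|; elim: N lt => // N IH lt ltN so fr.
have [/existsP[[[a0 x0] [b0 x1]] /= q0]|noq] :=
    boolP [exists p : T * T * (T * T), quad lt p.1.1 p.1.2 p.2.1 p.2.2]; last first.
  have no_quad a x b y : ~~ quad lt a x b y.
    by move: noq; rewrite negb_exists => /forallP/(_ ((a, x), (b, y))).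
  have [e [v [he vbij inc]]] := interval_order_hessenberg so fr no_quad.
  exists (e_coef_at1 e); split=> [lam _|m]; first exact: e_coef_at1_ge0.
  rewrite (stanley_bij _ vbij inc) -(chromatic1 _ rat (fun i j : 'I_#|T| => (i < j)%N)).
  exact: chi1_expansion.
have [L [C tg]] := tangle_ex so fr q0.
(* Reversing the order exchanges [L] and [C], and keeps the incomparability graph and the number of
   copies of 2+2. The smaller set may thus be taken to be [L], which provides the injection
   [tau]. *)
wlog LC : lt L C so fr tg ltN {q0} / (#|L| <= #|C|)%N.
  move=> hw; case: (leqP #|L| #|C|) => [|/ltnW] LC; first exact: (hw lt L C).
  have -> : incomp lt = incomp (dual_rel lt).
    by apply/funext => x; apply/funext => y; rewrite (incomp_dual lt).
  apply: (hw _ C L) => //; [exact: strict_order_dual|exact: free31_dual|exact: tangle_dual|].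
  by rewrite card_quads_dual.
have [tau tau_inj tauC] := inj_below LC.
pose lts s := untangle lt L C (hits lt tau s).
have lts_pos s : e_positive (incomp (lts s)).
  apply: IH; last exact: untangle_free31.
    by apply: leq_trans (card_quads_untangle tg _) _.
  exact: untangle_strict.
have [c cP] := fin_all_exists lts_pos.
pose M : rat := #|[set s : {perm T} | perm_on C s]|%:R.
have M0 : 0 < M.
  by rewrite ltr0n; apply/card_gt0P; exists 1%g; rewrite inE perm_on1.
exists (fun lam => M^-1 * \sum_(s : {perm T} | perm_on C s) c s lam); split=> [lam lamP|m].
  by rewrite mulr_ge0 ?invr_ge0 ?(ltW M0) // sumr_ge0 // => s _; exact: (cP s).1.
apply: (mulfI (lt0r_neq0 M0)); rewrite (stanley_average so tg tau_inj tauC).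
rewrite (eq_bigr _ (fun s _ => (cP s).2 m)) mulr_fsumr.
rewrite (fsbig_finite _ _ (partitions_finite _)) /=.
under eq_bigr do rewrite (fsbig_finite _ _ (partitions_finite _)) /=.
rewrite exchange_big /=; apply: eq_bigr => lam _.
by rewrite !mulrA divff ?mul1r ?mulr_suml // lt0r_neq0.
Qed.

Lemma incomp_order (d : Order.disp_t) (P : finPOrderType d) :
  incomp (fun x y : P => (x < y)%O) =2 @incomparability_graph d P.
Proof.
move=> x y; rewrite /incomp /incomparability_graph /Order.comparable !le_eqVlt.
by rewrite [y == x]eq_sym !negb_or; case: (x == y); rewrite //= andbC.
Qed.

Lemma order_strict (d : Order.disp_t) (P : finPOrderType d) :
  strict_order (fun x y : P => (x < y)%O).
Proof. by split=> [x|y x z]; [exact: ltxx|exact: lt_trans]. Qed.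

Lemma order_free31 (d : Order.disp_t) (P : finPOrderType d) :
  three_plus_one_free P -> free31 (fun x y : P => (x < y)%O).
Proof.
move=> fr a b c x ab bc; rewrite !incomp_order => xa xb xc.
by apply: fr; exists a, b, c, x.
Qed.

Local Open Scope classical_set_scope.

Theorem corollary3p8 :
  (forall (n : nat) (e : 'I_n -> 'I_n),
      (1 <= n)%N -> reverse_hessenberg e ->
      (* the expansion of chi_e[X;q] *)
      [/\ (forall m : {cmonom nat},
             chi e qvar m =
             qvar ^ (q_exponent e) *
             \sum_(lam \in partitions n)
                e_coef qvar e lam * elementary_part ratfun lam m),
      (* setting q = 1 in both sides *)
          (forall m : {cmonom nat},
             has_value_at (chi e qvar m) 1 (chi e (1 : rat) m)),
          (forall lam : seq nat, partitions n lam ->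
             has_value_at (qvar ^ (q_exponent e) * e_coef qvar e lam) 1
               (e_coef_at1 e lam)),
          (forall m : {cmonom nat},
             chi e (1 : rat) m =
             \sum_(lam \in partitions n)
                e_coef_at1 e lam * elementary_part rat lam m) &
      (* positivity *)
          (forall lam : seq nat, partitions n lam -> 0 <= e_coef_at1 e lam)]) /\
  (* the Stanley-Stembridge conjecture *)
  (forall (d : Order.disp_t) (P : finPOrderType d),
      three_plus_one_free P ->
      exists c : seq nat -> rat,
        (forall lam : seq nat, partitions #|{: P}| lam -> 0 <= c lam) /\
        (forall m : {cmonom nat},
           stanley_chromatic (@incomparability_graph d P) rat m =
           \sum_(lam \in partitions #|{: P}|)
              c lam * elementary_part rat lam m)).
Proof.
split=> [n e _ he|d P fr].
  split=> [m|m|lam _|m|lam _].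
  - exact: (chi_expansion qvar_neq0 qvar_pow_neq1 two_neq0_ratfun he).
  - exact: chi_value1.
  - exact: e_coef_value1.
  - exact: chi1_expansion.
  - exact: e_coef_at1_ge0.
have [c [c_ge0 cE]] := free31_e_positive (order_strict P) (order_free31 fr).
have -> : @incomparability_graph d P = incomp (fun x y : P => (x < y)%O).
  by apply/funext => x; apply/funext => y; rewrite incomp_order.
by exists c; split.
Qed.
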